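(* Let $N\ge 1$, let $\mathbb{K}$ be a field, and let $X=(x_1,\dots,x_{N-1})$ and $Y=(y_1,\dots,y_{N-2})$ be two sequences of elements of $\mathbb{K}$. The dimension of the diagram algebra $\widetilde{\mathsf{O}}_N(X,Y)$ is $N!$ and it is generated by the elementary diagrams $\mathsf{G}_1,\dots,\mathsf{G}_{N-1}$. Furthermore, the map sending $\mathsf{E}_i$ to $\mathsf{G}_i$ for $1\le i\le N-1$ extends multiplicatively to a unique algebra isomorphism $\Theta:\mathsf{O}_N(X,Y)\to\widetilde{\mathsf{O}}_N(X,Y)$.
   Context: The Okada algebra $\mathsf{O}_N(X,Y)$ is the associative unital $\mathbb{K}$-algebra generated by $\mathsf{E}_1,\dots,\mathsf{E}_{N-1}$ with relations $\mathsf{E}_i^2=x_i\mathsf{E}_i$ ($1\le i\le N-1$); $\mathsf{E}_i\mathsf{E}_j=\mathsf{E}_j\mathsf{E}_i$ ($|i-j|\ge 2$); $\mathsf{E}_{i+1}\mathsf{E}_i\mathsf{E}_{i+1}=y_i\mathsf{E}_{i+1}$ ($1\le i\le N-2$). Okada arc-diagrams. Write $[N]=\{1,\dots,N\}$, $\overline{a}=-a$ and $|\overline a|=a$. The node set $V_N=[N]\cup\{\overline N,\dots,\overline 1\}$ is totally ordered by $1<2<\dots<N<\overline N<\dots<\overline 2<\overline 1$ (positive nodes lie on the left boundary of a rectangle and overlined nodes on the right boundary). A rank $N$ non-crossing arc-diagram is a perfect matching of $V_N$ into pairs (arcs) $\{a,b\}$, written with $a<b$, such that no two arcs $\{a,b\},\{c,d\}$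 satisfy $a<c<b<d$. An arc $\{a,b\}$ is nested in $\{c,d\}$ if $c<a<b<d$. A rank $N$ Okada arc-diagram is a rank $N$ non-crossing arc-diagram together with an integer height-label ${\bf h}(\{a,b\})$ for each arc such that: (1) $1\le {\bf h}(\{a,b\})\le\min(|a|,|b|)$; (2) ${\bf h}(\{a,b\})\equiv\min(|a|,|b|)\pmod 2$; (3) ${\bf h}(\{a,b\})>{\bf h}(\{c,d\})$ whenever $\{a,b\}$ is nested in $\{c,d\}$. The set of these diagrams is $\mathfrak{A}_N$. The elementary diagram $\mathsf{G}_i\in\mathfrak{A}_N$ ($1\le i<N$) has arcs $\{j,\overline j\}$ with label $j$ for $j\ne i,i+1$, and arcs $\{i,i+1\}$ and $\{\overline{i+1},\overline{i}\}$, both with label $i$. Composition. For $C,D\in\mathfrak{A}_N$, the composition $C\circ D$ is obtained by identifying, for each $a\in[N]$, the right node $\overline a$ of $C$ with the left node $a$ of $D$ and concatenating arcs; it consists of arcs between nodes of $V_N$ and possibly some closed loops. The height label of an arc or loop of $C\circ D$ is the minimum of the labels of the arcs of $C$ and $D$ composing it. $[C\circ D]$ is the labeled arc-diagram obtained by removing all loops; it belongs to $\mathfrak{A}_N$, and $(C,D)\mapsto[C\circ D]$ makes $\mathfrak{A}_N$ a monoid whose unit is the diagram with arcs $\{a,\overline a\}$ of label $a$ for $1\le a\le N$. Product with parameters. A diamond diagram consists of boxes $(d,r)$, with $d\ge1$ (number of the south-east diagonal) and $1\le r\le\min(d,N-1)$ (row index, counted from the bottom), each black or white, finitely many black. Its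 reading is the sequence of row indices of its black boxes, taken diagonal by diagonal for increasing $d$, and for decreasing $r$ within a diagonal; it represents the element of $\mathfrak{A}_N$ obtained by multiplying in the monoid $\mathfrak{A}_N$ the corresponding diagrams $\mathsf{G}_r$ in the order of the reading. The rewriting rule consists of the following local moves, in which left $=(d,r)$, bottom $=(d,r-1)$, top $=(d+1,r+1)$, right $=(d+1,r)$, top is white, and a box with row index $0$ or $N$ is regarded as white: (i) if left and bottom are white and right is black, make left black and right white, with coefficient $1$; (ii) if left and right are black and bottom is white, make right white, with coefficient $x_r$; (iii) if left, bottom and right are black, make bottom and right white, with coefficient $y_{r-1}$. A diamond diagram to which no move applies is called normal. Every diamond diagram reduces by moves to a unique normal one, moves do not change the represented element of $\mathfrak{A}_N$, and every element of $\mathfrak{A}_N$ is represented by exactly one normal diamond diagram. For $C,D\in\mathfrak{A}_N$, let $w(C,D)$ be the product of the coefficients of the moves used to reduce to normal form a diamond diagram whose reading is the reading of the normal diamond diagram of $C$ followed by that of $D$; this does not depend on the choices. The algebra $\widetilde{\mathsf{O}}_N(X,Y)$ is the $\mathbb{K}$-vector space with basis $\mathfrak{A}_N$ and bilinear product $C\cdot D=w(C,D)\,[C\circ D]$. When $y_k=1$ for all $k$, $w(C,D)=\prod_{k\ge1}x_k^{\ell_k}$, where $\ell_k$ is the number of loops of $C\circ D$ with height label $k$. *)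

(* Defs.v *)
(* Mathematical Components, with the classical choice operator [xget] of
   mathcomp.classical. *)
From HB Require Import structures.
From mathcomp Require Import all_boot all_order all_algebra ring_quotient.
From mathcomp Require Import zify finmap monalg.
From mathcomp Require Import boolp classical_sets.

Set Implicit Arguments.
Unset Strict Implicit.
Unset Printing Implicit Defensive.

Import GRing.Theory.

Local Open Scope ring_scope.

(* The ordinal [i : 'I_N] stands for the integer i + 1; the node [inl i] is the
   positive (left) node i + 1 and [inr i] is the overlined (right) one. *)
Definition node (N : nat) : Type := ('I_N + 'I_N)%type.

(* |v| *)
Definition absn N (v : node N) : nat := match v with inl i | inr i => i.+1 end.

(* Position of a node in 1 < 2 < ... < N < bar N < ... < bar 2 < bar 1. *)
Definition pos N (v : node N) : nat :=
  match v with inl i => i.+1 | inr i => (N.*2 - i)%N end.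

Definition nlt N (v w : node N) : bool := (pos v < pos w)%N.

(* A pair (m, h) encodes the arcs {v, m v}, the label of {v, m v} being
   h v = h (m v). Labels of Okada diagrams lie in [1, N]. *)
Definition labelled (N : nat) : Type :=
  ({ffun node N -> node N} * {ffun node N -> 'I_N.+1})%type.

Definition perfect_matching N (m : node N -> node N) : bool :=
  [forall v, (m v != v) && (m (m v) == v)].

Definition noncrossing N (m : node N -> node N) : bool :=
  [forall a, forall c, ~~ [&& nlt a c, nlt c (m a) & nlt (m a) (m c)]].

(* In the last clause {a, m a} is nested in {c, m c}. *)
Definition okada_labels N (m : node N -> node N) (h : node N -> nat) : bool :=
  [&& [forall v, h (m v) == h v],
      [forall v, 1 <= h v <= minn (absn v) (absn (m v))]%N,
      [forall v, h v == minn (absn v) (absn (m v)) %[mod 2]]%N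
    & [forall a, forall c,
        [&& nlt c a, nlt a (m a) & nlt (m a) (m c)] ==> (h c < h a)%N]].

Definition is_okada N (D : labelled N) : bool :=
  [&& perfect_matching D.1, noncrossing D.1
    & okada_labels D.1 (fun v => D.2 v : nat)].

(* The set of rank N Okada arc-diagrams. *)
Record diagram (N : nat) : predArgType :=
  Diagram { diag :> labelled N; diagP : is_okada diag }.

HB.instance Definition _ N := [isSub for @diag N].
HB.instance Definition _ N := [Finite of diagram N by <:].

Section Elementary.
Variable N : nat.

Lemma inord_label (h : node N -> nat) v : (h v <= absn v)%N ->
  (inord (h v) : 'I_N.+1) = h v :> nat.
Proof.
move=> le_h; rewrite inordK // ltnS (leq_trans le_h) //.
by case: (v) => i /=; apply: ltn_ord.
Qed.

Definition flip (v : node N) : node N :=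
  match v with inl i => inr i | inr i => inl i end.

Definition unit_labelled : labelled N :=
  ([ffun v => flip v], [ffun v => inord (absn v)]).

Lemma unit_okada : is_okada unit_labelled.
Proof.
have hE v : unit_labelled.2 v = absn v :> nat by rewrite ffunE inord_label.
apply/and3P; split; last apply/and4P; last split.
- by apply/forallP => -[i|i]; rewrite !ffunE /= !eqxx.
- apply/forallP => a; apply/forallP => c; apply/negP; rewrite !ffunE /nlt.
  case: a c => [a|a] [c|c] /=; have := ltn_ord a; have := ltn_ord c;
    by move=> ? ? /and3P[]; lia.
- by apply/forallP => v; rewrite !hE ffunE; case: v.
- by apply/forallP => v; rewrite !hE ffunE; case: v => i; rewrite /= minnn leqnn.
- by apply/forallP => v; rewrite !hE ffunE; case: v => i; rewrite /= minnn.
- apply/forallP => a; apply/forallP => c; apply/implyP; rewrite !hE !ffunE /nlt.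
  case: a c => [a|a] [c|c] /=; have := ltn_ord a; have := ltn_ord c;
    by move=> ? ? /and3P[]; lia.
Qed.

Definition unit_diagram : diagram N := Diagram unit_okada.

(* [i : 'I_N.-1] stands for the index r = i + 1 of the diagram G_r; the ordinals
   [lo i] and [hi i] then stand for r and r + 1. *)
Definition lo (i : 'I_N.-1) : 'I_N := widen_ord (leq_pred N) i.

Lemma hi_subproof (i : 'I_N.-1) : (i.+1 < N)%N.
Proof. by rewrite -ltn_predRL. Qed.

Definition hi (i : 'I_N.-1) : 'I_N := Ordinal (hi_subproof i).

Definition elem_partner (i : 'I_N.-1) (v : node N) : node N :=
  match v with
  | inl j => if j == lo i then inl (hi i)
             else if j == hi i then inl (lo i) else inr j
  | inr j => if j == lo i then inr (hi i)
             else if j == hi i then inr (lo i) else inl j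
  end.

Definition elem_label (i : 'I_N.-1) (v : node N) : nat :=
  if absn v == (hi i).+1 then (lo i).+1 else absn v.

Definition elem_labelled (i : 'I_N.-1) : labelled N :=
  ([ffun v => elem_partner i v], [ffun v => inord (elem_label i v)]).

Lemma node_eqE (v w : node N) : (v == w) = (pos v == pos w).
Proof.
apply/eqP/eqP => [-> //|]; case: v w => [[v ?]|[v ?]] [[w ?]|[w ?]] /= e;
  by [exfalso; lia | congr inl; apply: val_inj => /=; lia
     | congr inr; apply: val_inj => /=; lia].
Qed.

Lemma elem_okada (i : 'I_N.-1) : is_okada (elem_labelled i).
Proof.
have hE v : (elem_labelled i).2 v = elem_label i v :> nat.
  by rewrite ffunE inord_label // /elem_label /=; case: eqP; lia.
have mE v : (elem_labelled i).1 v = elem_partner i v by rewrite ffunE.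
pose fE := (fun_if (@absn N), fun_if (@pos N)).
case: i hE mE => i Hi hE mE.
apply/and3P; split; last apply/and4P; last split;
  apply/forallP => -[[a Ha]|[a Ha]].
all: try (rewrite !mE ?node_eqE ?hE /elem_label /= -!val_eqE /= ?fE /=;
  case: (boolP (a == i)) => ? /=; case: (boolP (a == i.+1)) => ? /=;
  rewrite -?val_eqE /=; repeat (case: ifP => ? /=); lia).
all: apply/forallP => -[[c Hc]|[c Hc]];
  rewrite ?mE ?hE /elem_label /nlt /= -!val_eqE /= ?fE /=;
  case: (boolP (a == i)) => ? /=; case: (boolP (a == i.+1)) => ? /=;
  case: (boolP (c == i)) => ? /=; case: (boolP (c == i.+1)) => ? /=;
  repeat (case: ifP => ? /=); lia.
Qed.

Definition elem_diagram (i : 'I_N.-1) : diagram N := Diagram (elem_okada i).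

End Elementary.

Section Composition.
Variable N : nat.

(* Nodes of the concatenation of C (first summand) and D (second summand). *)
Definition glued : Type := (node N + node N)%type.

Definition glue (C D : labelled N) (u v : glued) : bool :=
  match u, v with
  | inl a, inl b => b == C.1 a
  | inr a, inr b => b == D.1 a
  | inl (inr i), inr (inl j) => i == j
  | inr (inl i), inl (inr j) => i == j
  | _, _ => false
  end.

Definition glued_label (C D : labelled N) (u : glued) : nat :=
  match u with inl a => C.2 a | inr a => D.2 a end.

Definition outer (v : node N) : glued :=
  match v with inl i => inl (inl i) | inr i => inr (inr i) end.

Definition comp_partner (C D : labelled N) (v : node N) : node N :=
  odflt v [pick w | (w != v) && connect (glue C D) (outer v) (outer w)].

(* The minimum of the labels along the component of v; N bounds all labels. *)
Definition comp_label (C D : labelled N) (v : node N) : nat :=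
  \big[minn/N]_(u : glued | connect (glue C D) (outer v) u) glued_label C D u.

Definition comp_labelled (C D : labelled N) : labelled N :=
  ([ffun v => comp_partner C D v], [ffun v => inord (comp_label C D v)]).

(* [C o D]; loops are the components without outer node, and so disappear. As
   comp_labelled C D is an Okada diagram, the default value is not reached. *)
Definition comp (C D : diagram N) : diagram N :=
  insubd (unit_diagram N) (comp_labelled C D).

Definition word_diagram (s : seq 'I_N.-1) : diagram N :=
  \big[comp/unit_diagram N]_(i <- s) elem_diagram i.

End Composition.

Section Diamonds.
Variables (N : nat) (K : fieldType).
Variables (X : (N.-1).-tuple K) (Y : (N.-2).-tuple K).

(* 1-based indexing of the parameters. *)
Definition xpar (r : nat) : K := nth 0 X r.-1.
Definition ypar (r : nat) : K := nth 0 Y r.-1.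

Local Open Scope fset_scope.

(* A diamond diagram is the set of its black boxes (d, r). *)
Definition is_box (b : nat * nat) : bool :=
  (1 <= b.1)%N && (1 <= b.2 <= minn b.1 N.-1)%N.

Definition diamond (P : {fset nat * nat}) : Prop :=
  forall b, b \in P -> is_box b.

Definition reading_le (b c : nat * nat) : bool :=
  (b.1 < c.1)%N || (b.1 == c.1) && (c.2 <= b.2)%N.

Definition reading (P : {fset nat * nat}) : seq nat :=
  [seq b.2 | b <- sort reading_le P].

Definition represents (P : {fset nat * nat}) (C : diagram N) : Prop :=
  exists2 s : seq 'I_N.-1, reading P = [seq (val i).+1 | i <- s]
                         & C = word_diagram s.

(* move P c Q: a local move of coefficient c from P to Q. In a diamond diagram
   the boxes with row index 0 or N are white, as they are not in the set. *)
Inductive move (P : {fset nat * nat}) : K -> {fset nat * nat} -> Prop :=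
| move_slide d r of is_box (d, r) & (d.+1, r.+1) \notin P
    & (d, r) \notin P & (d, r.-1) \notin P & (d.+1, r) \in P :
    move P 1 ((d, r) |` (P `\ (d.+1, r)))
| move_square d r of is_box (d, r) & (d.+1, r.+1) \notin P
    & (d, r) \in P & (d, r.-1) \notin P & (d.+1, r) \in P :
    move P (xpar r) (P `\ (d.+1, r))
| move_braid d r of is_box (d, r) & (d.+1, r.+1) \notin P
    & (d, r) \in P & (d, r.-1) \in P & (d.+1, r) \in P :
    move P (ypar r.-1) (P `\ (d, r.-1) `\ (d.+1, r)).

Inductive reduces (P : {fset nat * nat}) : K -> {fset nat * nat} -> Prop :=
| reduces_refl : reduces P 1 P
| reduces_step c Q c' Q' of move P c Q & reduces Q c' Q' :
    reduces P (c * c') Q'.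

Definition normal (P : {fset nat * nat}) : Prop := forall c Q, ~ move P c Q.

Definition normal_form_of (C : diagram N) (P : {fset nat * nat}) : Prop :=
  [/\ diamond P, normal P & represents P C].

Definition is_weight (C D : diagram N) (c : K) : Prop :=
  exists PC PD P Q : {fset nat * nat},
    [/\ normal_form_of C PC, normal_form_of D PD,
        diamond P /\ reading P = reading PC ++ reading PD,
        reduces P c Q & normal Q].

(* w(C, D), computed from one choice of diamond diagrams and moves. *)
Definition weight (C D : diagram N) : K := xget 0 [set c | is_weight C D c]%classic.

End Diamonds.

Section DiagramAlgebra.
Variables (N : nat) (K : fieldType).
Variables (X : (N.-1).-tuple K) (Y : (N.-2).-tuple K).

(* The vector space with basis the Okada diagrams. *)
Definition diagram_space : Type := {ffun diagram N -> K^o}.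

HB.instance Definition _ := GRing.Lmodule.on diagram_space.
HB.instance Definition _ := Vector.on diagram_space.

Definition diagram_vect (C : diagram N) : diagram_space :=
  [ffun D => (C == D)%:R].

Definition diagram_one : diagram_space := diagram_vect (unit_diagram N).

Definition diagram_mul (u v : diagram_space) : diagram_space :=
  \sum_(C : diagram N) \sum_(D : diagram N)
    (u C * v D * weight X Y C D) *: diagram_vect (comp C D).

End DiagramAlgebra.

Section OkadaAlgebra.
Variables (N : nat) (K : fieldType).
Variables (X : (N.-1).-tuple K) (Y : (N.-2).-tuple K).

(* The free algebra: the monoid algebra of the free monoid on 'I_N.-1. *)
Local Notation free_alg := {malg K[{fmonom 'I_N.-1}]}.

(* [gen i] is the free generator number i + 1. *)
Definition gen (i : 'I_N.-1) : free_alg := << fmu i >>.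

Inductive okada_relator : free_alg -> Prop :=
| relator_square i : okada_relator (gen i * gen i - xpar X i.+1 *: gen i)
| relator_comm (i j : 'I_N.-1) of (i.+2 <= j)%N || (j.+2 <= i)%N :
    okada_relator (gen i * gen j - gen j * gen i)
| relator_braid (i j : 'I_N.-1) of j = i.+1 :> nat :
    okada_relator (gen j * gen i * gen j - ypar Y i.+1 *: gen j).

(* The two-sided ideal generated by the relators. *)
Inductive okada_ideal_prop : free_alg -> Prop :=
| ideal_relator u of okada_relator u : okada_ideal_prop u
| ideal_zero : okada_ideal_prop 0
| ideal_add u v of okada_ideal_prop u & okada_ideal_prop v :
    okada_ideal_prop (u + v)
| ideal_mull a u of okada_ideal_prop u : okada_ideal_prop (a * u)
| ideal_mulr a u of okada_ideal_prop u : okada_ideal_prop (u * a).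

Definition okada_ideal : {pred free_alg} :=
  fun u => `[< okada_ideal_prop u >].

Lemma gen_coeff0 i : (gen i)@_(@mone _) = 0.
Proof. by rewrite mcoeffU; case: eqP => // /(congr1 (@fdeg _)); rewrite fdeg1 fdegU. Qed.

Lemma mulr_coeff0 (a u : free_alg) : u@_(@mone _) = 0 -> (a * u)@_(@mone _) = 0.
Proof. by move=> u0; rewrite rmorphM /= u0 mulr0. Qed.

Lemma subr_coeff0 (u v : free_alg) :
  u@_(@mone _) = 0 -> v@_(@mone _) = 0 -> (u - v)@_(@mone _) = 0.
Proof. by move=> u0 v0; rewrite mcoeffB u0 v0 subr0. Qed.

Lemma relator_coeff0 u : okada_relator u -> u@_(@mone _) = 0.
Proof.
have M0 a i : (a * gen i)@_(@mone _) = 0 := mulr_coeff0 a (gen_coeff0 i).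
have Z0 c i : (c *: gen i)@_(@mone _) = 0 by rewrite mcoeffZ gen_coeff0 mulr0.
case=> {u} [i | i j _ | i j _]; apply: subr_coeff0;
  by [exact: M0 | exact: Z0].
Qed.

Lemma okada_ideal_coeff0 u : okada_ideal_prop u -> u@_(@mone _) = 0.
Proof.
elim=> {u} [u /relator_coeff0 // || u v _ u0 _ v0 | a u _ u0 | a u _ u0].
- by rewrite mcoeff0.
- by rewrite mcoeffD u0 v0 addr0.
- exact: mulr_coeff0.
- by rewrite rmorphM /= u0 mul0r.
Qed.

Lemma okada_idealr : idealr_closed okada_ideal.
Proof.
split; first by apply/asboolP; exact: ideal_zero.
- apply/negP => /asboolP/okada_ideal_coeff0/eqP.
  by rewrite rmorph1 oner_eq0.
- move=> a u v /asboolP Iu /asboolP Iv; apply/asboolP.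
  by apply: ideal_add => //; apply: ideal_mull.
Qed.

HB.instance Definition _ := isIdealr.Build free_alg okada_ideal okada_idealr.

Lemma okada_idealMl a u : u \in okada_ideal -> a * u \in okada_ideal.
Proof. by move=> /asboolP Iu; apply/asboolP; exact: ideal_mull. Qed.

Lemma okada_idealMr a u : u \in okada_ideal -> u * a \in okada_ideal.
Proof. by move=> /asboolP Iu; apply/asboolP; exact: ideal_mulr. Qed.

Lemma malgC_central (k : K) (u : free_alg) : u * k%:MP = k%:MP * u.
Proof. 
rewrite !malgM_def fgmulUg fgmulgU; apply: eq_bigr => m _.
by rewrite mulm1 mul1m mulrC.
 Qed.

Definition okada_algebra : Type := {ideal_quot okada_ideal}.

HB.instance Definition _ := GRing.Zmodule.on okada_algebra.

Local Open Scope quotient_scope.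

Definition okada_pi (u : free_alg) : okada_algebra := \pi_{ideal_quot okada_ideal} u.

Lemma okada_piP u v : reflect (okada_pi u = okada_pi v) (u - v \in okada_ideal).
Proof. by rewrite Quotient.idealrBE; exact: eqP. Qed.

Lemma okada_pi_surj (a : okada_algebra) : exists u, a = okada_pi u.
Proof. by exists (repr a); rewrite /okada_pi reprK. Qed.

Lemma okada_piD u v : okada_pi (u + v) = okada_pi u + okada_pi v.
Proof. by rewrite /okada_pi piE. Qed.

Definition okada_mul (a b : okada_algebra) : okada_algebra :=
  okada_pi (repr a * repr b).

Definition okada_scale (k : K) (a : okada_algebra) : okada_algebra :=
  okada_pi (k *: repr a).

Lemma okada_repr u : repr (okada_pi u) - u \in okada_ideal.
Proof. by apply/okada_piP; rewrite /okada_pi reprK. Qed.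

Lemma okada_piM u v : okada_pi (u * v) = okada_mul (okada_pi u) (okada_pi v).
Proof.
apply/esym/okada_piP; set u' := repr _; set v' := repr _.
rewrite (_ : _ - _ = u' * (v' - v) + (u' - u) * v).
  apply: rpredD; first by apply: okada_idealMl; exact: okada_repr.
  by apply: okada_idealMr; exact: okada_repr.
by rewrite mulrBr mulrBl addrA subrK.
Qed.

Lemma okada_piZ k u : okada_pi (k *: u) = okada_scale k (okada_pi u).
Proof.
apply/esym/okada_piP; rewrite -scalerBr -mul_malgC.
by apply: okada_idealMl; exact: okada_repr.
Qed.

Lemma okada_mulA : associative okada_mul.
Proof.
move=> a b c; have [u ->] := okada_pi_surj a; have [v ->] := okada_pi_surj b.
by have [w ->] := okada_pi_surj c; rewrite -!okada_piM mulrA.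
Qed.

Lemma okada_mul1 : left_id (okada_pi 1) okada_mul.
Proof. by move=> a; have [u ->] := okada_pi_surj a; rewrite -okada_piM mul1r. Qed.

Lemma okada_mulr1 : right_id (okada_pi 1) okada_mul.
Proof. by move=> a; have [u ->] := okada_pi_surj a; rewrite -okada_piM mulr1. Qed.

Lemma okada_mulDl : left_distributive okada_mul +%R.
Proof.
move=> a b c; have [u ->] := okada_pi_surj a; have [v ->] := okada_pi_surj b.
have [w ->] := okada_pi_surj c.
by rewrite -okada_piD -!okada_piM -okada_piD mulrDl.
Qed.

Lemma okada_mulDr : right_distributive okada_mul +%R.
Proof.
move=> a b c; have [u ->] := okada_pi_surj a; have [v ->] := okada_pi_surj b.
have [w ->] := okada_pi_surj c.
by rewrite -okada_piD -!okada_piM -okada_piD mulrDr.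
Qed.

Lemma okada_oner_neq0 : okada_pi 1 != 0.
Proof.
have -> : 0 = okada_pi 0 by rewrite /okada_pi piE.
apply/eqP => /okada_piP; rewrite subr0 => I1.
by case: okada_idealr => _ /negP[].
Qed.

HB.instance Definition _ := GRing.Zmodule_isNzRing.Build okada_algebra
  okada_mulA okada_mul1 okada_mulr1 okada_mulDl okada_mulDr okada_oner_neq0.

Lemma okada_scaleA k l a : okada_scale k (okada_scale l a) = okada_scale (k * l) a.
Proof.
by have [u ->] := okada_pi_surj a; rewrite -!okada_piZ scalerA.
Qed.

Lemma okada_scale1 : left_id 1 okada_scale.
Proof. by move=> a; have [u ->] := okada_pi_surj a; rewrite -okada_piZ scale1r. Qed.

Lemma okada_scaleDr : right_distributive okada_scale +%R.
Proof.
move=> k a b; have [u ->] := okada_pi_surj a; have [v ->] := okada_pi_surj b.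
by rewrite -okada_piD -!okada_piZ -okada_piD scalerDr.
Qed.

Lemma okada_scaleDl a : {morph okada_scale^~ a : k l / k + l}.
Proof.
move=> k l; have [u ->] := okada_pi_surj a.
by rewrite -!okada_piZ -okada_piD scalerDl.
Qed.

HB.instance Definition _ := GRing.Zmodule_isLmodule.Build K okada_algebra
  okada_scaleA okada_scale1 okada_scaleDr okada_scaleDl.

Lemma okada_scaleAl (k : K) (a b : okada_algebra) : k *: (a * b) = k *: a * b.
Proof.
have [u ->] := okada_pi_surj a; have [v ->] := okada_pi_surj b.
rewrite -[LHS]/(okada_scale k (okada_mul _ _)).
rewrite -[RHS]/(okada_mul (okada_scale k _) _).
by rewrite -!(okada_piM, okada_piZ) scalerAl.
Qed.

HB.instance Definition _ :=
  GRing.Lmodule_isLalgebra.Build K okada_algebra okada_scaleAl.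

Lemma okada_scaleAr (k : K) (a b : okada_algebra) : k *: (a * b) = a * (k *: b).
Proof.
have [u ->] := okada_pi_surj a; have [v ->] := okada_pi_surj b.
rewrite -[LHS]/(okada_scale k (okada_mul _ _)).
rewrite -[RHS]/(okada_mul _ (okada_scale k _)).
by rewrite -!(okada_piM, okada_piZ) -!mul_malgC mulrA -malgC_central mulrA.
Qed.

HB.instance Definition _ :=
  GRing.Lalgebra_isAlgebra.Build K okada_algebra okada_scaleAr.

(* [okada_gen i] is the generator E_{i+1}. *)
Definition okada_gen (i : 'I_N.-1) : okada_algebra := okada_pi (gen i).

End OkadaAlgebra.

(* [Theta] is a unital algebra isomorphism onto the diagram algebra. *)
Definition algebra_isomorphism N (K : fieldType)
    (X : (N.-1).-tuple K) (Y : (N.-2).-tuple K)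
    (Theta : okada_algebra X Y -> diagram_space N K) : Prop :=
  [/\ linear Theta, Theta 1 = diagram_one N K,
      {morph Theta : a b / a * b >-> diagram_mul X Y a b} & bijective Theta].

Definition subalgebra N (K : fieldType)
    (X : (N.-1).-tuple K) (Y : (N.-2).-tuple K)
    (U : {vspace diagram_space N K}) : Prop :=
  diagram_one N K \in U /\ {in U &, forall u v, diagram_mul X Y u v \in U}.

(* Main.v *)
(* The monomial words of the Okada algebra whose letters are the blocks
   [E_d E_(d-1) ... E_(d-k+1)] with k <= d, for d = 1, ..., N-1, number N!. Call
   them normal: they are the readings of the normal diamond diagrams, so every
   word is a multiple of a normal one, by relations only. Three facts then
   suffice.
   - A word s has a well-defined coefficient: letters act on the multiples of
     normal words by a rule compatible with the relations, hence s = c n, with n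
     normal, determines c. The weight w(C, D) is the coefficient of the
     concatenation of the normal words of C and D.
   - The composition of diagrams is associative, because the component of an
     outer node in a glued graph is an orbit of the dihedral group generated by
     the matching and the gluing, and the elementary diagrams satisfy the
     relations with all parameters 1.
   - Normal words biject with diagrams. The last block of a normal word is read
     off the labels of the right nodes of its diagram, and can be cancelled;
     conversely a diagram other than the unit has a right arc {i, i+1} of label
     i, which can be pushed outwards until a strand of height d appears.
   So Theta maps the class of a normal word to its diagram, and multiplying
   normal words on both sides yields the same coefficients. *)
From HB Require Import structures.
Require Import Defs.
From mathcomp Require Import all_boot all_order all_algebra.
From mathcomp Require Import zify finmap monalg boolp classical_sets.

Set Implicit Arguments.
Unset Strict Implicit.
Unset Printing Implicit Defensive.

Import GRing.Theory.

(** * Words and their coefficients *)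

(** That the composition of two Okada diagrams is again one is not checked on arbitrary pairs. Only
    right multiplication by an elementary diagram is analysed, where the result has the closed form
    [rmul]. Generation is proved with [rmul] alone; the general case then follows, because
    associativity holds for all labelled matchings and so is available before closure is known.
    Generation is delicate because, unlike in the Temperley-Lieb case, E_i E_(i+1) E_i is not a
    multiple of E_i. Its diagram version holds only under a bound on one label ([rmul_braidV]). An
    arc can thus be pushed outwards past a strand of low label only; a strand of maximal label
    blocks it, but then another pushable arc exists further out. Confluence of the moves is not
    studied through critical pairs: reduction provides existence of a normal word, and the
    invariants [coef] and [wd] provide its uniqueness. *)

Section Words.
Local Open Scope ring_scope.
Variables (K : comNzRingType) (x y : nat -> K).

(* Letters are numbered from 0: the letter i stands for the generator of index
   i + 1, and y i is the parameter of E_(i+2) E_(i+1) E_(i+2). *)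
Inductive weq (M : nat) : seq nat -> K -> seq nat -> Prop :=
| weq_refl s : weq M s 1 s
| weq_trans s c t d u of weq M s c t & weq M t d u : weq M s (c * d) u
| weq_square a b i : weq M (a ++ [:: i; i] ++ b) (x i) (a ++ [:: i] ++ b)
| weq_comm a b i j of (i.+1 < j)%N || (j.+1 < i)%N :
    weq M (a ++ [:: i; j] ++ b) 1 (a ++ [:: j; i] ++ b)
| weq_braid a b i of (i.+1 < M)%N :
    weq M (a ++ [:: i.+1; i; i.+1] ++ b) (y i) (a ++ [:: i.+1] ++ b).

Lemma weq_cat M a b s c t : weq M s c t -> weq M (a ++ s ++ b) c (a ++ t ++ b).
Proof.
have E (u v w : seq nat) : a ++ (u ++ v ++ w) ++ b = (a ++ u) ++ v ++ (w ++ b).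
  by rewrite !catA.
elim=> {s c t}.
- by move=> s; exact: weq_refl.
- by move=> s c t d u _ IH1 _ IH2; apply: weq_trans IH1 IH2.
- by move=> u v i; rewrite !E; apply: weq_square.
- by move=> u v i j ij; rewrite !E; apply: weq_comm.
- by move=> u v i iM; rewrite !E; apply: weq_braid.
Qed.

Definition far (i j : nat) : bool := (i.+1 < j)%N || (j.+1 < i)%N.

Lemma weq_trans1 M s t c u : weq M s 1 t -> weq M t c u -> weq M s c u.
Proof. by move=> st tu; rewrite -[c]mul1r; apply: weq_trans st tu. Qed.

Lemma weq_1trans M s t c u : weq M s c t -> weq M t 1 u -> weq M s c u.
Proof. by move=> st tu; rewrite -[c]mulr1; apply: weq_trans st tu. Qed.

Lemma weq_far M i s : all (far i) s -> weq M (s ++ [:: i]) 1 (i :: s).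
Proof.
elim: s => [|j s IH] /=; first by move=> _; exact: weq_refl.
case/andP=> ij /IH/(weq_cat [:: j] [::]); rewrite !cats0 => H.
apply: weq_trans1 H _; apply: (@weq_comm M [::] s j i).
by rewrite orbC.
Qed.

Lemma weq_far_cat M s t : all (fun i => all (far i) s) t ->
  weq M (s ++ t) 1 (t ++ s).
Proof.
elim: t => [|i t IH] /=; first by move=> _; rewrite cats0; exact: weq_refl.
case/andP=> /(weq_far M) H1 /IH/(weq_cat [:: i] [::]); rewrite !cats0 => H2.
apply: weq_trans1 _ H2; have := weq_cat [::] t H1.
by rewrite /= -catA.
Qed.

Definition dn (b k : nat) : seq nat := rev (iota b k).

Lemma mem_dn b k i : (i \in dn b k) = (b <= i < b + k)%N.
Proof. by rewrite mem_rev mem_iota. Qed.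

Lemma dn_cat b k l : dn b (k + l) = dn (b + k) l ++ dn b k.
Proof. by rewrite /dn iotaD rev_cat. Qed.

Lemma dnS b k : dn b k.+1 = rcons (dn b.+1 k) b.
Proof. by rewrite /dn /= rev_cons. Qed.

(** The last letter [i] commutes leftwards to just after [i.-1], and the braid relation there
    absorbs it and deletes [i.-1]. The run is thereby cut into two pieces with no adjacent letters,
    which commute. *)
Lemma dn_braid M b i j : (b < i)%N -> (i < M)%N -> (i.+1 < j)%N ->
  weq M (dn b (j.-1 - b) ++ [:: i]) (y i.-1)
        (dn b (i.-1 - b) ++ dn i (j.-1 - i)).
Proof.
move=> bi iM ij; case: i => // i in bi iM ij *; rewrite /=.
have ->: dn b (j.-1 - b) = dn i.+2 (j - i.+3) ++ [:: i.+1; i] ++ dn b (i - b).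
  have ->: (j.-1 - b = (i - b) + (2 + (j - i.+3)))%N by lia.
  rewrite dn_cat (_ : (b + (i - b))%N = i); last by lia.
  by rewrite dn_cat -catA; congr (_ ++ _); rewrite ?addn2.
have ->: dn i.+1 (j.-1 - i.+1) = dn i.+2 (j - i.+3) ++ [:: i.+1].
  have ->: (j.-1 - i.+1 = (j - i.+3).+1)%N by lia.
  by rewrite dnS -cats1.
rewrite -!catA.
have H1 : weq M (dn b (i - b) ++ [:: i.+1]) 1 ([:: i.+1] ++ dn b (i - b)).
  by apply: weq_far; apply/allP => k; rewrite mem_dn /far; lia.
have := weq_cat (dn i.+2 (j - i.+3) ++ [:: i.+1; i]) [::] H1.
rewrite !cats0 -!catA => H; apply: weq_trans1 H _.
apply: (@weq_1trans _ _ (dn i.+2 (j - i.+3) ++ [:: i.+1] ++ dn b (i - b))).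
  exact: (@weq_braid M (dn i.+2 (j - i.+3)) (dn b (i - b)) i).
rewrite catA; apply: weq_far_cat; apply/allP => k; rewrite mem_dn => Hk.
by apply/allP => l; rewrite mem_cat inE mem_dn /far; lia.
Qed.

(* A state [(k, [:: b_n; ...; b_1])] is the multiple by k of the normal word
   whose d-th block, read from d = 1, is the descending run [:: d - 1; ...; b_d]
   (empty when b_d = d); [act n] appends one letter to it. The value 0 at level
   0 makes the relations hold without assumption on the state. *)
Definition scl (c : K) (p : K * seq nat) := (c * p.1, p.2).
Definition pcons (b : nat) (p : K * seq nat) := (p.1, b :: p.2).

(** The cases for a top block [[:: n'; ...; b]]: a letter with r + 1 < b commutes with the block and
    goes to the lower levels; r + 1 = b lengthens the block; r = b squares its last letter; for r >
    b, [dn_braid] leaves the block [[:: n'; ...; r]] and sends the cut-off run from r - 2 down to b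
    to the lower levels. *)
Fixpoint act (n : nat) (p : K * seq nat) (r : nat) : K * seq nat :=
  if n is n'.+1 then
    let b := head 0%N p.2 in let q := (p.1, behead p.2) in
    if (r.+1 < b)%N then pcons b (act n' q r)
    else if r.+1 == b then pcons r q
    else if r == b then scl (x b) (pcons b q)
    else scl (y r.-1) (pcons r (foldl (act n') q (dn b (r.-1 - b))))
  else (0, p.2).

Notation acts n := (foldl (act n)).

Lemma scl_scl c d p : scl c (scl d p) = scl (c * d) p.
Proof. by rewrite /scl /= mulrA. Qed.

Lemma sclC c d p : scl c (scl d p) = scl d (scl c p).
Proof. by rewrite !scl_scl mulrC. Qed.

Lemma pcons_scl b c p : pcons b (scl c p) = scl c (pcons b p).
Proof. by []. Qed.

Lemma act_scl n c p r : act n (scl c p) r = scl c (act n p r).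
Proof.
elim: n c p r => [|n IH] c p r /=; first by rewrite /scl /= mulr0.
have IHs s q : acts n (scl c q) s = scl c (acts n q s).
  by elim: s q => //= i s IHs q; rewrite IH IHs.
case: ifP => _; first by rewrite -pcons_scl -IH.
case: ifP => _ //.
case: ifP => _; first by rewrite /scl /pcons /= mulrCA.
by rewrite sclC; congr scl; rewrite -pcons_scl -IHs.
Qed.

Lemma acts_scl n c p s : acts n (scl c p) s = scl c (acts n p s).
Proof. by elim: s p => //= i s IH p; rewrite act_scl IH. Qed.

Lemma scl1 p : scl 1 p = p.
Proof. by case: p => k t; rewrite /scl mul1r. Qed.

Definition act_rel n := [/\
  forall p i, act n (act n p i) i = scl (x i) (act n p i),
  forall p i j, (i.+1 < j)%N -> act n (act n p i) j = act n (act n p j) i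
& forall p i, act n (act n (act n p i.+1) i) i.+1 = scl (y i) (act n p i.+1)].

Lemma acts_weq_rel n : act_rel n ->
  forall M p s c t, weq M s c t -> acts n p s = scl c (acts n p t).
Proof.
case=> Hsq Hcomm Hbr M p s c t H; elim: H p => {s c t}.
- by move=> s p; rewrite scl1.
- by move=> s c t d u _ IH1 _ IH2 p; rewrite IH1 IH2 scl_scl.
- by move=> a b i p; rewrite !foldl_cat /= Hsq acts_scl.
- by move=> a b i j ij p; rewrite !foldl_cat /= scl1; case/orP: ij => /Hcomm ->.
- by move=> a b i _ p; rewrite !foldl_cat /= Hbr acts_scl.
Qed.

Variant act_spec n (b : nat) (q : K * seq nat) r : K * seq nat -> Prop :=
| ActLow of (r.+1 < b)%N : act_spec n b q r (pcons b (act n q r))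
| ActNext of r.+1 = b : act_spec n b q r (pcons r q)
| ActSame of r = b : act_spec n b q r (scl (x r) (pcons r q))
| ActHigh of (b < r)%N :
    act_spec n b q r (scl (y r.-1) (pcons r (acts n q (dn b (r.-1 - b))))).

Lemma actP n b q r : act_spec n b q r (act n.+1 (pcons b q) r).
Proof.
rewrite /= -surjective_pairing; case: ifP => [|rb]; first exact: ActLow.
case: eqP => [|rb']; first exact: ActNext.
case: eqP => [<-|rb'']; first exact: ActSame.
by apply: ActHigh; lia.
Qed.

Lemma act_split n p : exists b q, forall r, act n.+1 p r = act n.+1 (pcons b q) r.
Proof. by exists (head 0%N p.2), (p.1, behead p.2). Qed.

Lemma act_low n b q r : (r.+1 < b)%N ->
  act n.+1 (pcons b q) r = pcons b (act n q r).
Proof. by move=> H; case: actP => //; lia. Qed.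

Lemma act_next n q r : act n.+1 (pcons r.+1 q) r = pcons r q.
Proof. by case: actP => //; lia. Qed.

Lemma act_same n q r : act n.+1 (pcons r q) r = scl (x r) (pcons r q).
Proof. by case: actP => //; lia. Qed.

Lemma act_high n b q r : (b < r)%N -> act n.+1 (pcons b q) r =
  scl (y r.-1) (pcons r (acts n q (dn b (r.-1 - b)))).
Proof. by move=> H; case: actP => //; lia. Qed.

Local Opaque act.

(** By induction on the level. A high letter sends a whole run to the level below, so the induction
    hypothesis is used on words, through [acts_weq_rel]. When two commuting letters are both high,
    the runs sent down in the two orders are the two sides of [dn_braid]. *)
Lemma act_relP n : act_rel n.
Proof.
elim: n => [|n IH].
  have E0 p r : act 0 p r = (0, p.2) by [].
  by split=> [p i|p i j _|p i]; rewrite !E0 /scl /= ?mulr0.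
have [IHsq IHcomm IHbr] := IH.
have W := acts_weq_rel IH.
split=> [p i|p i j ij|p i]; have [b [q Hp]] := act_split n p; rewrite !Hp.
- case: actP => [ib|_|_|ib].
  + by rewrite act_low // IHsq.
  + by rewrite act_same.
  + by rewrite act_scl act_same.
  + by rewrite act_scl act_same sclC.
- case: (actP n b q j) => [jb|jb|jb|jb].
  + by rewrite !act_low 1?IHcomm //; lia.
  + by rewrite -jb act_low ?act_next ?act_low //; lia.
  + by rewrite jb act_scl act_low ?act_same ?act_low //; lia.
  rewrite act_scl (@act_low n j); last by lia.
  case: (actP n b q i) => [ib|ib|ib|ib].
  + rewrite act_high //; congr (scl _ (pcons _ _)).
    have H : weq 0 (dn b (j.-1 - b) ++ [:: i]) 1 ([:: i] ++ dn b (j.-1 - b)).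
      by apply: weq_far; apply/allP => k; rewrite mem_dn /far; lia.
    by have := W _ q _ _ _ H; rewrite scl1 !foldl_cat /= => ->.
  + rewrite -ib act_high; last by lia.
    congr (scl _ (pcons _ _)).
    rewrite (_ : j.-1 - i = (j.-1 - i.+1).+1)%N; last by lia.
    by rewrite dnS -cats1 foldl_cat.
  + rewrite ib act_scl act_high //.
    have H : weq 0 (dn b (j.-1 - b) ++ [:: b]) (x b) (dn b (j.-1 - b)).
      rewrite (_ : j.-1 - b = (j.-1 - b).-1.+1)%N; last by lia.
      rewrite dnS -cats1 -catA.
      by have := @weq_square 0 (dn b.+1 (j.-1 - b).-1) [::] b; rewrite cats0.
    have := W _ q _ _ _ H; rewrite !foldl_cat /= => ->.
    by rewrite pcons_scl sclC.
  + rewrite act_scl act_high; last by lia.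
    have H := @dn_braid i.+1 b i j ib (leqnn _) ij.
    have := W _ q _ _ _ H; rewrite !foldl_cat /= => ->.
    by rewrite pcons_scl sclC.
(* Unless the first letter [i.+1] goes to the level below, it leaves a top block ending at [i.+1],
   so this computation settles the last three cases. The run cut off by the second [i.+1] is
   empty. *)
- have E c : act n.+1 (act n.+1 (pcons i.+1 c) i) i.+1 = scl (y i) (pcons i.+1 c).
    by rewrite act_next act_high // /= (_ : i - i = 0)%N //; lia.
  case: actP => [ib|ib|ib|ib].
  + by rewrite !act_low ?IHbr //; lia.
  + by rewrite E.
  + by rewrite 2!act_scl E sclC.
  + by rewrite 2!act_scl E sclC.
Qed.

Lemma acts_weq M n p s c t : weq M s c t -> acts n p s = scl c (acts n p t).
Proof. exact/acts_weq_rel/act_relP. Qed.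

(** Lehmer codes: a normal word is given by its block lengths, the one of the block numbered d
    ranging over 0, ..., d. *)
Fixpoint code (n : nat) : finType :=
  if n is n'.+1 then (code n' * 'I_n'.+2)%type else unit.

Lemma card_code n : #|{: code n}| = (n.+1)`!.
Proof.
elim: n => [|n IH]; first by rewrite card_unit.
by rewrite /= card_prod IH card_ord mulnC.
Qed.

Fixpoint nword (n : nat) : code n -> seq nat :=
  match n return code n -> seq nat with
  | 0 => fun _ => [::]
  | n'.+1 => fun c => nword c.1 ++ dn (n'.+1 - c.2) c.2
  end.

Lemma nword_lt n (c : code n) : all (fun i => i < n)%N (nword c).
Proof.
elim: n c => //= n IH [c k] /=; rewrite all_cat; apply/andP; split.
  by apply: sub_all (IH c) => i /ltnW.
by apply/allP => i; rewrite mem_dn; have := ltn_ord k; lia.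
Qed.

Fixpoint nstate (n : nat) : seq nat := if n is n'.+1 then n :: nstate n' else [::].

Definition coef (n : nat) (s : seq nat) : K := (acts n (1, nstate n) s).1.

Lemma coef_weq M n s c t : weq M s c t -> coef n s = c * coef n t.
Proof. by move/(acts_weq n (1, nstate n)); rewrite /coef => ->. Qed.

Lemma acts_low n b p s : all (fun i => i.+1 < b)%N s ->
  acts n.+1 (pcons b p) s = pcons b (acts n p s).
Proof. by elim: s p => //= i s IH p /andP[ib ?]; rewrite act_low // IH. Qed.

(** Starting from empty blocks, the letters of a normal word meet only the first two cases of [act]:
    they pass below the still empty upper blocks, then lengthen their own block one by one. No
    parameter appears. *)
Lemma coef_nword n (c : code n) : coef n (nword c) = 1.
Proof.
rewrite /coef; suff [t ->]: exists t, acts n (1, nstate n) (nword c) = (1, t) by [].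
elim: n c => [|n IH] c; first by exists [::].
case: c => c k; have [t Ht] := IH c.
rewrite [nword _]/= foldl_cat [nstate _]/= -/(pcons n.+1 (1, nstate n)).
rewrite acts_low; last exact: nword_lt.
rewrite Ht.
exists ((n.+1 - k)%N :: t).
rewrite -/(pcons n.+1 (1, t)) -[RHS]/(pcons (n.+1 - k) (1, t)).
move: (k : nat) (ltn_ord k) => m; rewrite ltnS.
elim: m => [|m IHm] mn; first by rewrite subn0.
rewrite dnS (_ : (n.+1 - m.+1).+1 = n.+1 - m)%N; last by lia.
rewrite -cats1 foldl_cat IHm ?(ltnW mn) // [foldl _ _ [:: _]]/foldl.
rewrite (_ : n.+1 - m = (n.+1 - m.+1).+1)%N; last by lia.
by rewrite act_next.
Qed.

End Words.

(** * Diamond diagrams *)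

(** Strict form of [reading_le]. Being irreflexive, it makes a sorted list depend on its set of
    elements only, which is how readings are computed. *)
Definition blt (b c : nat * nat) : bool :=
  (b.1 < c.1)%N || (b.1 == c.1) && (c.2 < b.2)%N.

Lemma blt_trans : transitive blt.
Proof. by move=> [a b] [c d] [e f]; rewrite /blt /=; lia. Qed.

Lemma blt_irr : irreflexive blt.
Proof. by move=> [a b]; rewrite /blt /=; lia. Qed.

Lemma blt_total b c : [|| blt b c, b == c | blt c b].
Proof. by case: b c => [a b] [c d]; rewrite /blt xpair_eqE /=; lia. Qed.

Definition boxes (P : {fset nat * nat}) : seq (nat * nat) := sort reading_le P.

Definition word (P : {fset nat * nat}) : seq nat := map predn (reading P).

Lemma wordE P : word P = [seq b.2.-1 | b <- boxes P].
Proof. by rewrite /word /reading -map_comp. Qed.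

Lemma mem_boxes P : boxes P =i P.
Proof. by move=> b; rewrite mem_sort. Qed.

Lemma boxes_pairwise P : pairwise blt (boxes P).
Proof.
have tot : total reading_le by move=> [a b] [c d]; rewrite /reading_le /=; lia.
have tr : transitive reading_le.
  by move=> [a b] [c d] [e f]; rewrite /reading_le /=; lia.
have : sorted reading_le (boxes P) by apply: sort_sorted.
have : uniq (boxes P) by rewrite sort_uniq fset_uniq.
rewrite uniq_pairwise => U; rewrite sorted_pairwise // => S.
have {U S} : pairwise [rel x y | (x != y) && reading_le x y] (boxes P).
  by rewrite pairwise_relI U.
by apply: sub_pairwise => -[a b] [c d] /=; rewrite /blt /reading_le xpair_eqE /=; lia.
Qed.

Lemma boxesE (P : {fset nat * nat}) s :
  pairwise blt s -> (forall b, (b \in s) = (b \in P)) -> boxes P = s.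
Proof.
move=> sp sP; apply: (irr_sorted_eq blt_trans blt_irr).
- by rewrite (sorted_pairwise blt_trans) boxes_pairwise.
- by rewrite (sorted_pairwise blt_trans).
- by move=> b; rewrite mem_boxes sP.
Qed.

Definition between (l u : nat * nat) P := [seq b <- boxes P | blt l b && blt b u].
Definition before (u : nat * nat) P := [seq b <- boxes P | blt b u].
Definition after (l : nat * nat) P := [seq b <- boxes P | blt l b].

Lemma pairwise_filter_boxes (p : pred (nat * nat)) P :
  pairwise blt [seq b <- boxes P | p b].
Proof.
apply: (subseq_pairwise _ (boxes_pairwise P)).
exact: filter_subseq.
Qed.

Section Moves.
Local Open Scope ring_scope.
Variables (N : nat) (K : fieldType) (X : (N.-1).-tuple K) (Y : (N.-2).-tuple K).

Definition xs (i : nat) : K := xpar X i.+1.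
Definition ys (i : nat) : K := ypar Y i.+1.

Local Open Scope fset_scope.


Lemma mem_before l P b : b \in before l P -> blt b l.
Proof. by rewrite mem_filter => /andP[]. Qed.
Lemma mem_between l u P b : b \in between l u P -> blt l b && blt b u.
Proof. by rewrite mem_filter => /andP[]. Qed.
Lemma mem_after l P b : b \in after l P -> blt l b.
Proof. by rewrite mem_filter => /andP[]. Qed.

Ltac pw := rewrite /= ?(pairwise_cat, allrel_catr, allrel_catl, allrel_consr,
    allrel_consl, allrel1l, allrel1r, pairwise_filter_boxes, pairwise_cons,
    all_cat, allrel0r, allrel0l) /= ?(pairwise_filter_boxes, all_cat, andbT);
  repeat (apply/andP; split);
  try (apply/allrelP => ? ?); try (apply/allP => ?);
  do 2?[move/mem_before => ? | move/mem_between => /andP[? ?] | move/mem_after => ?];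
  eauto 5 using blt_trans.

(** The effect of a move on the reading. The list [M] holds what is read before the right box, after
    the left one (after the bottom one for a braid): rows below r on diagonal d and rows above r on
    diagonal d + 1. As top is white, and bottom is white or set apart, no row adjacent to r occurs
    in [M], whose letters thus commute with that of row r. *)
Variant move_boxes (P : {fset nat * nat}) (c : K) (Q : {fset nat * nat}) : Prop :=
| MoveSlide A M B d r of c = 1 & boxes P = A ++ M ++ (d.+1, r) :: B
    & boxes Q = A ++ (d, r) :: M ++ B & (1 <= r)%N
    & all (fun b => far r.-1 b.2.-1) M
| MoveSquare A M B d r of c = xs r.-1
    & boxes P = A ++ (d, r) :: M ++ (d.+1, r) :: B
    & boxes Q = A ++ (d, r) :: M ++ B & (1 <= r)%N
    & all (fun b => far r.-1 b.2.-1) M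
| MoveBraid A M B d r of c = ys r.-2
    & boxes P = A ++ (d, r) :: (d, r.-1) :: M ++ (d.+1, r) :: B
    & boxes Q = A ++ (d, r) :: M ++ B & (1 < r < N)%N
    & all (fun b => far r.-1 b.2.-1) M.

Lemma eq_filter_boxes (p : pred (nat * nat)) P Q :
  (forall b, p b -> (b \in P) = (b \in Q)) ->
  [seq b <- boxes P | p b] = [seq b <- boxes Q | p b].
Proof.
move=> PQ; apply: (irr_sorted_eq blt_trans blt_irr);
  rewrite ?(sorted_pairwise blt_trans) ?pairwise_filter_boxes //.
by move=> b; rewrite !mem_filter !mem_boxes; case: (boolP (p b)) => // /PQ ->.
Qed.

Lemma boxes_split (x : nat * nat) P :
  boxes P = before x P ++ nseq (x \in P) x ++ after x P.
Proof.
apply: boxesE.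
  rewrite !pairwise_cat allrel_catr !pairwise_filter_boxes andbT /=.
  have -> : pairwise blt (nseq (x \in P) x) by case: (x \in P).
  rewrite andbT -andbA; apply/and3P; split.
  - apply/allrelP => b c; rewrite mem_filter => /andP[bx _].
    by rewrite mem_nseq => /andP[_ /eqP ->].
  - apply/allrelP => b c; rewrite !mem_filter => /andP[bx _] /andP[xc _].
    exact: blt_trans bx xc.
  - apply/allrelP => b c; rewrite mem_nseq => /andP[_ /eqP ->].
    by rewrite mem_filter => /andP[].
move=> b; rewrite !mem_cat mem_nseq !mem_filter mem_boxes.
have [->|bx] := eqVneq b x; first by rewrite blt_irr orbF; case: (x \in P).
rewrite andbF /= -andb_orl.
by have := blt_total b x; rewrite (negPf bx) /= => ->.
Qed.

(** Used for a diamond diagram and for the outcome of a move on it: the lists taken from P are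
    common to both readings. *)
Lemma boxes_form (P Q : {fset nat * nat}) (l u : nat * nat) :
  blt l u -> (forall b, b != l -> b != u -> (b \in Q) = (b \in P)) ->
  boxes Q = before l P ++ nseq (l \in Q) l ++
            between l u P ++ nseq (u \in Q) u ++ after u P.
Proof.
move=> lu QP.
have bneq b c : blt b c -> b != c.
  by apply: contraTneq => ->; rewrite blt_irr.
have nul : blt u l = false.
  by apply: contraTF lu => ul; apply/negP => /(blt_trans ul); rewrite blt_irr.
rewrite (boxes_split u Q) {1}/before (boxes_split l Q) !filter_cat -!catA.
have -> : [seq b <- before l Q | blt b u] = before l P.
  rewrite (_ : [seq _ <- _ | _] = before l Q).
    apply: eq_filter_boxes => b bl; apply: QP; first exact: bneq.
    exact: bneq (blt_trans bl lu).
  apply/all_filterP/allP => b; rewrite mem_filter => /andP[bl _].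
  exact: blt_trans bl lu.
have -> : [seq b <- nseq (l \in Q) l | blt b u] = nseq (l \in Q) l.
  by case: (l \in Q) => //=; rewrite lu.
have -> : [seq b <- after l Q | blt b u] = between l u P.
  rewrite /after -filter_predI.
  rewrite (eq_filter (a2 := fun b => blt l b && blt b u)); last first.
    by move=> b /=; rewrite andbC.
  apply: eq_filter_boxes => b /andP[lb bu]; apply: QP; last exact: bneq.
  by rewrite eq_sym; apply: bneq.
congr (_ ++ (_ ++ (_ ++ (_ ++ _)))).
apply: eq_filter_boxes => b ub; apply: QP; rewrite eq_sym; apply: bneq => //.
exact: blt_trans lu ub.
Qed.

Lemma moveP P c Q : diamond N P -> move X Y P c Q -> move_boxes P c Q.
Proof.
move=> dP; case=> d r bdr top left bot right;
  have nul : ((d.+1, r) == (d, r)) = false by rewrite xpair_eqE; lia.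
- have lu : blt (d, r) (d.+1, r) by rewrite /blt /=; lia.
  apply: (@MoveSlide _ _ _ (before (d, r) P) (between (d, r) (d.+1, r) P)
      (after (d.+1, r) P) d r) => //.
  + by rewrite (boxes_form (P := P) lu) // (negPf left) right.
  + rewrite (boxes_form (P := P) lu); last first.
      by move=> b bl bu; rewrite !inE (negPf bl) bu.
    by rewrite !inE !eqxx nul.
  + by move: bdr; rewrite /is_box /=; lia.
  apply/allP => -[a s]; rewrite mem_filter mem_boxes /blt /= => /andP[H inP].
  have /= := dP _ inP; rewrite /is_box /= => sbox.
  have: (a, s) != (d.+1, r.+1) by apply: contraNneq top => <-.
  have: (a, s) != (d, r.-1) by apply: contraNneq bot => <-.
  by rewrite !xpair_eqE /far; move: bdr; rewrite /is_box /=; lia.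
- have lu : blt (d, r) (d.+1, r) by rewrite /blt /=; lia.
  apply: (@MoveSquare _ _ _ (before (d, r) P) (between (d, r) (d.+1, r) P)
      (after (d.+1, r) P) d r) => //.
  + by rewrite (boxes_form (P := P) lu) // left right.
  + rewrite (boxes_form (P := P) lu); last first.
      by move=> b bl bu; rewrite !inE bu.
    by rewrite !inE !eqxx left andbT eq_sym nul.
  + by move: bdr; rewrite /is_box /=; lia.
  apply/allP => -[a s]; rewrite mem_filter mem_boxes /blt /= => /andP[H inP].
  have /= := dP _ inP; rewrite /is_box /= => sbox.
  have: (a, s) != (d.+1, r.+1) by apply: contraNneq top => <-.
  have: (a, s) != (d, r.-1) by apply: contraNneq bot => <-.
  by rewrite !xpair_eqE /far; move: bdr; rewrite /is_box /=; lia.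
- have r1 : (1 < r)%N by have := dP _ bot; rewrite /is_box /=; lia.
  have lu : blt (d, r.-1) (d.+1, r) by rewrite /blt /=; lia.
  have ll : blt (d, r) (d, r.-1) by rewrite /blt /=; lia.
  (* No box comes between [(d, r)] and [(d, r.-1)] in the reading order. *)
  have bE : before (d, r.-1) P = before (d, r) P ++ [:: (d, r)].
    rewrite /before {1}(boxes_split (d, r) P) left !filter_cat /= ll.
    rewrite (_ : [seq b <- after _ _ | _] = [::]) ?cats0.
      congr (_ ++ _); apply/all_filterP/allP => b; rewrite mem_filter => /andP[bl _].
      exact: blt_trans bl ll.
    apply/eqP; rewrite -size_eq0 size_filter -leqn0 leqNgt -has_count.
    apply/hasPn => -[a s]; rewrite mem_filter /blt /= => /andP[H _].
    by lia.
  apply: (@MoveBraid _ _ _ (before (d, r) P) (between (d, r.-1) (d.+1, r) P)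
      (after (d.+1, r) P) d r) => //.
  + by rewrite (boxes_form (P := P) lu) // bot right bE -!catA.
  + rewrite (boxes_form (P := P) lu); last first.
      by move=> b bl bu; rewrite !inE bu bl.
    by rewrite bE -!catA !inE !eqxx /= !andbF.
  + by move: bdr; rewrite /is_box /=; lia.
  apply/allP => -[a s]; rewrite mem_filter mem_boxes /blt /= => /andP[H inP].
  have /= := dP _ inP; rewrite /is_box /= => sbox.
  have: (a, s) != (d.+1, r.+1) by apply: contraNneq top => <-.
  by rewrite !xpair_eqE /far; move: bdr; rewrite /is_box /=; lia.
Qed.

Lemma move_diamond P c Q : diamond N P -> move X Y P c Q -> diamond N Q.
Proof.
by move=> dP [] d r bdr _ _ _ _ b; rewrite !inE;
  [case/orP => [/eqP -> //|] | | ]; do ?[case/andP => _]; apply: dP.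
Qed.

Lemma move_weq P c Q : diamond N P -> move X Y P c Q ->
  weq xs ys N.-1 (word P) c (word Q).
Proof.
move=> dP /(moveP dP) [] A M B d r -> eP eQ rN farM;
  rewrite !wordE {}eP {}eQ !(map_cat, map_cons) /=;
  set a := [seq _ | b <- A]; set m := [seq _ | b <- M]; set b := [seq _ | b <- B];
  (have {farM} H : weq xs ys N.-1 (m ++ [:: r.-1]) 1 (r.-1 :: m)
    by apply: weq_far; rewrite all_map).
- by have := weq_cat a b H; rewrite -!catA.
- have := weq_cat (a ++ [:: r.-1]) b H; rewrite -!catA /= => /weq_trans1; apply.
  exact: (@weq_square _ xs ys N.-1 a (m ++ b) r.-1).
- have := weq_cat (a ++ [:: r.-1; r.-2]) b H; rewrite -!catA /= => /weq_trans1; apply.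
  case: r rN {H} => // -[] // r rN /=.
  by apply: (@weq_braid _ xs ys N.-1 a (m ++ b) r); lia.
Qed.

(** The termination measure: a slide lowers one diagonal number by 1, and the other moves delete
    boxes. *)
Lemma move_sum P c Q : diamond N P -> move X Y P c Q ->
  (sumn (map fst (boxes Q)) < sumn (map fst (boxes P)))%N.
Proof.
move=> dP /(moveP dP) [] A M B d r _ -> -> rN _;
  by rewrite !(map_cat, map_cons) /= !(sumn_cat, map_cat) /= ?sumn_cat /=; lia.
Qed.

Lemma reducesP P c Q : diamond N P -> reduces X Y P c Q ->
  diamond N Q /\ weq xs ys N.-1 (word P) c (word Q).
Proof.
move=> dP r; elim: r dP => {P c Q} [P dP|P c Q c' Q' m _ IH dP].
  by split=> //; apply: weq_refl.
have [dQ' W] := IH (move_diamond dP m); split=> //.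
exact: weq_trans (move_weq dP m) W.
Qed.

Lemma exists_normal P : diamond N P -> exists c Q, reduces X Y P c Q /\ normal X Y Q.
Proof.
elim: {P}_.+1 {-2}P (ltnSn (sumn (map fst (boxes P)))) => // n IH P Pn dP.
have [nP|/existsNP[c /existsNP[Q /contrapT m]]] := pselect (normal X Y P).
  by exists 1, P; split=> //; apply: reduces_refl.
have Qn := leq_trans (move_sum dP m) Pn.
have [c' [Q' [red nQ']]] := IH Q Qn (move_diamond dP m).
by exists (c * c'), Q'; split=> //; apply: reduces_step red.
Qed.

(** If [(d, r.+1)] were white, it would be the top of a move with right box [(d, r)]. The only
    configuration in which no move applies has a white left box above a black bottom one, on
    diagonal d - 1, and the induction on r excludes it. *)
Lemma normal_up P d r : diamond N P -> normal X Y P -> (d, r) \in P -> (r < d)%N ->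
  (d, r.+1) \in P.
Proof.
move=> dP nP; elim: r d => [|r IH] d inP rd.
  by have := dP _ inP; rewrite /is_box /= andbF.
case: d => // d in inP rd *.
apply/negPn/negP => top.
have := dP _ inP; rewrite /is_box /= => bP.
have box : is_box N (d, r.+1) by rewrite /is_box /=; lia.
have [left|left] := boolP ((d, r.+1) \in P).
  have [bot|bot] := boolP ((d, r) \in P).
    by apply: nP (move_braid X Y box top left bot inP).
  by apply: nP (move_square X Y box top left bot inP).
have [bot|bot] := boolP ((d, r) \in P).
  by move/negP: left; apply; apply: IH.
by apply: nP (move_slide X Y box top left bot inP).
Qed.

(** Iterating [normal_up] blackens all rows from r to d; on a diagonal d >= N this would reach row
    N, which is not a box. *)
Lemma normal_le P d r : diamond N P -> normal X Y P -> (d, r) \in P ->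
  (d < N)%N /\ forall r', (r <= r' <= d)%N -> (d, r') \in P.
Proof.
move=> dP nP inP.
have H r' : (r <= r' <= d)%N -> (d, r') \in P.
  elim: r' => [|r' IH] h; first by move: inP; rewrite (_ : r = 0)%N //; lia.
  have [<- //|rr] := eqVneq r r'.+1.
  by apply: normal_up => //; first apply: IH; lia.
split=> //; rewrite ltnNge; apply/negP => Nd.
have := dP _ inP; rewrite /is_box /= => bP.
have rN : (r <= N <= d)%N by lia.
by have := dP _ (H N rN); rewrite /is_box /=; lia.
Qed.

Lemma normal_word P : diamond N P -> normal X Y P ->
  exists c : code N.-1, word P = nword c.
Proof.
move=> dP nP.
suff H n : (n <= N.-1)%N ->
    exists c : code n, nword c = [seq b.2.-1 | b <- boxes P & (b.1 <= n)%N].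
  have [c Hc] := H _ (leqnn _); exists c; rewrite Hc wordE; congr map.
  apply/esym/all_filterP/allP => -[d r]; rewrite mem_boxes => /(normal_le dP nP)[/=].
  by lia.
elim: n => [|n IH] nN.
  exists tt; rewrite (eq_in_filter (a2 := pred0)) ?filter_pred0 // => -[d r].
  by rewrite mem_boxes => /dP; rewrite /is_box /=; lia.
have [c Hc] := IH (ltnW nN).
have [k kn Hk] : exists2 k, (k < n.+2)%N &
    forall r, ((n.+1, r) \in P) = (n.+1 - k < r <= n.+1)%N.
  have up r : (n.+1, r) \in P -> (n.+1, r.+1) \in P = (r < n.+1)%N.
    move=> inP; apply/idP/idP => [/dP|]; first by rewrite /is_box /=; lia.
    exact: normal_up.
  have [[r0 r0P]|none] := pselect (exists r, (n.+1, r) \in P); last first.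
    exists 0%N => // r; rewrite subn0; apply/idP/idP => [inP|]; last by lia.
    by case: none; exists r.
  have ex : exists r, (n.+1, r) \in P by exists r0.
  case: (ex_minnP ex) => m mP mmin.
  have := dP _ mP; rewrite /is_box /= => bm.
  (* The black rows are m, ..., n + 1, with m the least one. *)
  exists (n.+2 - m)%N; first by lia.
  move=> r; apply/idP/idP => [inP|h].
    by have := mmin _ inP; have := dP _ inP; rewrite /is_box /=; lia.
  by have [_] := normal_le dP nP mP; apply; lia.
exists (c, Ordinal kn).
rewrite [nword _]/= Hc.
have -> : [seq b <- boxes P | (b.1 <= n.+1)%N] =
    [seq b <- boxes P | (b.1 <= n)%N] ++ [seq (n.+1, r.+1) | r <- dn (n.+1 - k) k].
  apply: (irr_sorted_eq blt_trans blt_irr); rewrite ?(sorted_pairwise blt_trans).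
  - exact: pairwise_filter_boxes.
  - rewrite pairwise_cat pairwise_filter_boxes /=; apply/andP; split.
      apply/allrelP => -[d r] b; rewrite mem_filter => /andP[/= dn _] /mapP[r' _ ->].
      by rewrite /blt /= ltnS dn.
    rewrite pairwise_map /dn.
    apply: (@sub_pairwise _ (fun a b => (b < a)%N)).
      by move=> a b /=; rewrite /blt /=; lia.
    rewrite -(sorted_pairwise (rev_trans ltn_trans)) rev_sorted.
    exact: iota_ltn_sorted.
  - move=> [d r]; rewrite mem_cat !mem_filter !mem_boxes /=.
    have [->|dn] := eqVneq d n.+1.
      rewrite ltnn leqnn /= Hk; apply/idP/mapP => [h|[s]].
        by exists r.-1; rewrite ?mem_dn ?prednK //; lia.
      by rewrite mem_dn => h [->]; lia.
    rewrite (_ : _ \in map _ _ = false) ?orbF.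
      by congr (_ && _); lia.
    by apply/mapP => -[s _ [/eqP]]; rewrite (negPf dn).
rewrite map_cat; congr (_ ++ _).
by rewrite -map_comp (eq_map (g := id)) ?map_id.
Qed.

(** The letters are placed one per diagonal, from diagonal N on, where every row from 1 to N - 1 is
    available. *)
Lemma word_diamond s : all (fun i => i < N.-1)%N s ->
  exists P, diamond N P /\ reading P = map S s.
Proof.
move=> sN; pose L := zip (iota N (size s)) (map S s).
have sz : size (iota N (size s)) = size (map S s) by rewrite size_iota size_map.
have memL b : b \in L -> (N <= b.1)%N /\ (b.2.-1 \in s) /\ (0 < b.2)%N.
  case: b => d r bL.
  have : d \in unzip1 L by apply/mapP; exists (d, r).
  have : r \in unzip2 L by apply/mapP; exists (d, r).
  rewrite unzip1_zip ?sz // unzip2_zip ?sz // mem_iota => /mapP[i i_s ->].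
  by case/andP.
have pL : pairwise blt L.
  have : pairwise ltn (unzip1 L).
    by rewrite unzip1_zip ?sz // -(sorted_pairwise ltn_trans) iota_ltn_sorted.
  by rewrite pairwise_map; apply: sub_pairwise => a b /=; rewrite /blt => ->.
exists [fset b in L]; split.
  move=> [d r]; rewrite inE /= => /memL [/= Nd [/(allP sN) /= rN r0]].
  by apply/andP; split; rewrite /=; lia.
rewrite /reading -/(boxes _) (@boxesE _ L) //; last by move=> b; rewrite inE.
by rewrite -/(unzip2 L) unzip2_zip ?sz.
Qed.

Lemma word_lt P : diamond N P -> all (fun i => i < N.-1)%N (word P).
Proof.
move=> dP; rewrite wordE all_map; apply/allP => b; rewrite mem_boxes => /dP.
by rewrite /is_box /=; lia.
Qed.

Lemma reading_word P : diamond N P -> reading P = map S (word P).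
Proof.
move=> dP; rewrite /word -map_comp -[LHS]map_id; apply/eq_in_map => r /mapP[b].
by rewrite mem_boxes => /dP; rewrite /is_box => h -> /=; rewrite prednK //; lia.
Qed.

End Moves.

(** * Composition of labelled matchings *)

Section Connect.

Lemma connect_closed (T : finType) (e : rel T) (S : T -> Prop) :
  (forall a b, S a -> e a b -> S b) -> forall u v, S u -> connect e u v -> S v.
Proof.
move=> Se u v Su /connectP[p + ->]; elim: p u Su => //= w p IH u Su /andP[uw wp].
exact: IH (Se _ _ Su uw) wp.
Qed.

Lemma connect_image (T U : finType) (e : rel T) (e' : rel U) (f : T -> U) :
  (forall a b, e a b -> connect e' (f a) (f b)) ->
  forall a b, connect e a b -> connect e' (f a) (f b).
Proof.
move=> H a b; apply: (connect_closed (S := fun b => connect e' (f a) (f b))) => //.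
by move=> c d ac /H; apply: connect_trans ac.
Qed.

(* The component of v is the orbit of v under p = g m, because g and m act on
   it by reflections: g p^k v = p^-k v and m p^k v = p^(-k-1) v. As m has no
   fixed point the orbit has even length 2q, and then g only fixes v and p^q v. *)
Lemma reflections_component (T : finType) (e : rel T) (g m : T -> T) (v : T) :
  involutive g -> involutive m -> (forall u, m u <> u) -> g v = v ->
  (forall a, e a (m a)) -> (forall a, connect e a (g a)) ->
  (forall a b, e a b -> b = m a \/ b = g a) ->
  exists w, [/\ w <> v, g w = w, connect e v w
    & forall u, g u = u -> connect e v u -> u = v \/ u = w].
Proof.
move=> gK mK m_neq gv em eg e_mg.
pose p u := g (m u).
have p_inj : injective p by apply: inj_comp; apply: can_inj; [exact: gK|exact: mK].
have refl k u : iter k p (g (iter k p u)) = g u.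
  elim: k => //= k IH; rewrite -iterS iterSr /p.
  by rewrite gK mK.
pose n := order p v.
have n_gt0 : (0 < n)%N by apply: order_gt0.
have pn : iter n p v = v by apply: iter_order.
have pkn k : iter (k * n) p v = v.
  by elim: k => // k IH; rewrite mulSn iterD IH.
have iterI k a b : iter k p a = iter k p b -> a = b.
  by elim: k => //= k IH /p_inj.
(* The exponent [k * n - k] stands for -k, as p^n fixes v. *)
have gE k : g (iter k p v) = iter (k * n - k) p v.
  apply: (iterI k); rewrite refl -iterD subnKC ?gv ?pkn //.
  by rewrite leq_pmulr.
have modE k : iter k p v = iter (k %% n) p v.
  by rewrite {1}(divn_eq k n) addnC iterD pkn.
have modI k l : iter k p v = iter l p v -> k = l %[mod n].
  rewrite (modE k) (modE l) => H.
  by rewrite -(findex_iter (ltn_pmod k n_gt0)) H findex_iter // ltn_pmod.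
have orb u : connect e v u -> exists k, u = iter k p v.
  move=> vu; apply: (connect_closed (S := fun u => exists k, u = iter k p v) _ _ vu);
    last by exists 0.
  move=> _ b [k ->] /e_mg[]->; last by exists (k * n - k)%N.
  exists (k.+1 * n - k.+1)%N; rewrite -gE /= /p gK.
  by [].
have conn k : connect e v (iter k p v).
  elim: k => //= k IH; apply: connect_trans IH _.
  exact: connect_trans (connect1 (em _)) (eg _).
(* For odd n, the node halfway along the orbit would be fixed by m. *)
have n_even : ~~ odd n.
  apply/negP => n_odd; apply: (m_neq (iter n./2 p v)).
  rewrite -[LHS]gK -/(p _) -iterS; apply: (iterI n./2.+1).
  rewrite refl gv -iterD -{1}pn; congr (iter _ p v).
  by rewrite -{1}(odd_double_half n) n_odd; lia.
have n2 : n = n./2.*2 by rewrite even_halfK.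
exists (iter n./2 p v); split=> //.
- move/(modI _ 0); rewrite mod0n modn_small; lia.
- apply: (iterI n./2); rewrite refl gv -iterD -{1}pn; congr (iter _ p v); lia.
move=> u gu /orb[k uE].
(* If g fixes p^k v, then p^k v = p^-k v, so n divides 2k. *)
have : iter (k + k) p v = iter 0 p v.
  by rewrite iterD /= -uE -{1}gu uE refl gv.
move/modI; rewrite mod0n => /eqP; rewrite -/(dvdn n (k + k)) => nk.
rewrite uE modE.
have: (k %% n = 0 \/ k %% n = n./2)%N.
  have kn := ltn_pmod k n_gt0.
  have : n %| (k %% n + k %% n) by rewrite /dvdn modnDm.
  case/dvdnP => q Hq; have : (q < 2)%N by rewrite -(ltn_pmul2r n_gt0); lia.
  by case: q Hq => [|[|q]] //; lia.
by case=> ->; [left|right].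
Qed.

(* The graph e1 on B is obtained from e by contracting, for each u, the part
   I u of a component, represented by the node i u of it. *)
Lemma connect_contract (T B : finType) (e : rel T) (e1 : rel B) (i : B -> T)
    (I : B -> pred T) :
  (forall u, I u (i u)) ->
  (forall u u', e1 u u' -> connect e (i u) (i u')) ->
  (forall u z, I u z -> connect e (i u) z) ->
  (forall u z z', I u z -> e z z' ->
     I u z' \/ exists2 u', connect e1 u u' & I u' z') ->
  forall u z, connect e (i u) z <-> exists2 u', connect e1 u u' & I u' z.
Proof.
move=> H0 H1 H2 H3 u z; split=> [uz|[u' uu' u'z]].
  apply: (connect_closed (S := fun z => exists2 u', connect e1 u u' & I u' z) _ _ uz).
    move=> a b [u' uu' u'a] ab; case: (H3 _ _ _ u'a ab) => [u'b|[u'' u'u'' u''b]].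
      by exists u'.
    by exists u'' => //; apply: connect_trans uu' u'u''.
  by exists u.
exact: connect_trans (connect_image H1 uu') (H2 _ _ u'z).
Qed.

End Connect.

Lemma leq_bigmin (T : finType) (P : pred T) (F : T -> nat) n t :
  (t <= \big[minn/n]_(u | P u) F u)%N = (t <= n)%N && [forall (u | P u), t <= F u]%N.
Proof.
apply/idP/andP => [tm|[tn /forall_inP tF]].
  split; last apply/forall_inP => u Pu; apply: leq_trans tm _.
    by elim/big_rec: _ => // i x _; rewrite geq_min => ->; rewrite orbT.
  have := mem_index_enum u; elim: (index_enum T) => // a s IH.
  rewrite inE big_cons => /predU1P[<-|/IH H]; first by rewrite Pu geq_min leqnn.
  by case: ifP => // _; rewrite geq_min H orbT.
by elim/big_ind: _ => // a b ta tb; rewrite leq_min ta tb.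
Qed.

Lemma leq_ext a b : (forall t, (t <= a) = (t <= b))%N -> a = b.
Proof. by move=> H; apply/eqP; rewrite eqn_leq -H leqnn H leqnn. Qed.

Section Matching.
Variable N : nat.
Implicit Types C D E : labelled N.

Definition matching C : Prop :=
  [/\ forall v, C.1 v <> v, involutive C.1 & forall v, C.2 (C.1 v) = C.2 v].

Definition gmatch C D (u : glued N) : glued N :=
  match u with inl a => inl (C.1 a) | inr a => inr (D.1 a) end.

Definition gswap (u : glued N) : glued N :=
  match u with
  | inl (inr i) => inr (inl i)
  | inr (inl i) => inl (inr i)
  | _ => u
  end.

Lemma gswapK : involutive gswap.
Proof. by case=> [[i|i]|[i|i]]. Qed.

Lemma gmatchK C D : matching C -> matching D -> involutive (gmatch C D).
Proof. by move=> [_ CK _] [_ DK _] [a|a] /=; rewrite ?CK ?DK. Qed.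

Lemma gmatch_neq C D : matching C -> matching D -> forall u, gmatch C D u <> u.
Proof. by move=> [Cn _ _] [Dn _ _] [a|a] /= [] => [/Cn|/Dn]. Qed.

Lemma glue_ll C D a b : glue C D (inl a) (inl b) = (b == C.1 a).
Proof. by case: a. Qed.

Lemma glue_rr C D a b : glue C D (inr a) (inr b) = (b == D.1 a).
Proof. by case: a. Qed.

Lemma glue_gmatch C D u : glue C D u (gmatch C D u).
Proof. by case: u => [[i|i]|[i|i]] /=. Qed.

Lemma connect_gswap C D u : connect (glue C D) u (gswap u).
Proof. by case: u => [[i|i]|[i|i]] //=; apply: connect1 => /=. Qed.

Lemma glueE C D u v : glue C D u v -> v = gmatch C D u \/ v = gswap u.
Proof.
case: u v => [[i|i]|[i|i]] [[j|j]|[j|j]] //= /eqP ->;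
  by [left | right].
Qed.

Lemma gswap_outer v : gswap (outer v) = outer v.
Proof. by case: v. Qed.

Lemma gswap_fix u : gswap u = u -> exists v, u = outer v.
Proof. by case: u => [[i|i]|[i|i]] //= _; [exists (inl i) | exists (inr i)]. Qed.

Lemma outer_inj : injective (@outer N).
Proof. by case=> i [] j // [->]. Qed.

Lemma glue_sym C D : matching C -> matching D -> connect_sym (glue C D).
Proof.
move=> mC mD; apply: sym_connect_sym => u v.
have [_ CK _] := mC; have [_ DK _] := mD.
case: u v => [[i|i]|[i|i]] [[j|j]|[j|j]] //=;
  by [rewrite eq_sym | rewrite -(can_eq CK) CK eq_sym | rewrite -(can_eq DK) DK eq_sym].
Qed.

Lemma glued_component C D v : matching C -> matching D ->
  exists w, [/\ w <> v, connect (glue C D) (outer v) (outer w)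
    & forall u, connect (glue C D) (outer v) (outer u) -> u = v \/ u = w].
Proof.
move=> mC mD.
have [w [wv /gswap_fix[w' wE] vw H]] := reflections_component gswapK
  (gmatchK mC mD) (gmatch_neq mC mD) (gswap_outer v) (@glue_gmatch C D)
  (@connect_gswap C D) (@glueE C D).
exists w'; rewrite -wE; split=> // [E|u vu].
  by apply: wv; rewrite wE E.
have [/outer_inj|E] := H (outer u) (gswap_outer u) vu; first by left.
by right; apply: outer_inj; rewrite E.
Qed.

Lemma comp_partnerP C D v : matching C -> matching D ->
  [/\ comp_partner C D v <> v,
      connect (glue C D) (outer v) (outer (comp_partner C D v))
    & forall u, connect (glue C D) (outer v) (outer u) ->
        u = v \/ u = comp_partner C D v].
Proof.
move=> mC mD; have [w [wv vw H]] := glued_component v mC mD.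
suff -> : comp_partner C D v = w by [].
rewrite /comp_partner; case: pickP => [u /andP[/eqP uv /H[]]//|/(_ w)].
by rewrite vw andbT => /eqP.
Qed.

Lemma comp_labelleq C D v t : (t <= comp_label C D v)%N =
  (t <= N)%N && [forall (u | connect (glue C D) (outer v) u),
    t <= glued_label C D u]%N.
Proof. exact: leq_bigmin. Qed.

Lemma comp_label_leN C D v : (comp_label C D v <= N)%N.
Proof. by have := comp_labelleq C D v (comp_label C D v); rewrite leqnn => /esym/andP[]. Qed.

Lemma comp_labelledE1 C D v : (comp_labelled C D).1 v = comp_partner C D v.
Proof. by rewrite ffunE. Qed.

Lemma comp_labelledE2 C D v : (comp_labelled C D).2 v = comp_label C D v :> nat.
Proof. by rewrite ffunE inordK // ltnS comp_label_leN. Qed.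

Lemma labelled_eq C D : (forall v, C.1 v = D.1 v) ->
  (forall v, C.2 v = D.2 v :> nat) -> C = D.
Proof.
case: C D => [m h] [m' h'] /= H1 H2; congr (_, _); apply/ffunP => v.
  exact: H1.
by apply: val_inj; apply: H2.
Qed.

Lemma comp_labelled_matching C D : matching C -> matching D ->
  matching (comp_labelled C D).
Proof.
move=> mC mD; split=> [v|v|v].
- by rewrite comp_labelledE1; case: (comp_partnerP v mC mD).
- rewrite !comp_labelledE1; have [n1 c1 _] := comp_partnerP v mC mD.
  have [_ _ H] := comp_partnerP (comp_partner C D v) mC mD.
  by case: (H v) => //; [rewrite glue_sym | move=> E; case: n1].
- apply: val_inj => /=; rewrite !comp_labelledE2 comp_labelledE1.
  have [_ c1 _] := comp_partnerP v mC mD.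
  by apply: eq_bigl => u; apply/esym/same_connect => //; apply: glue_sym.
Qed.

(** * Associativity: three glued diagrams, contracted on either side *)

Section Triple.
Variables C D E : labelled N.
Hypotheses (mC : matching C) (mD : matching D) (mE : matching E).

Definition triple : finType := (glued N + node N)%type.

Definition tri (u v : triple) : bool :=
  match u, v with
  | inl a, inl b => glue C D a b
  | inl (inr (inr i)), inr (inl j) => i == j
  | inr (inl i), inl (inr (inr j)) => i == j
  | inr a, inr b => b == E.1 a
  | _, _ => false
  end.

Lemma tri_ll a b : tri (inl a) (inl b) = glue C D a b.
Proof. by case: a => [[i|i]|[i|i]]. Qed.

Lemma tri_rr a b : tri (inr a) (inr b) = (b == E.1 a).
Proof. by case: a. Qed.

Definition tlabel (u : triple) : nat :=
  match u with inl a => glued_label C D a | inr a => E.2 a end.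

Definition touter (v : node N) : triple :=
  match v with inl i => inl (inl (inl i)) | inr i => inr (inr i) end.

Definition tmatch (u : triple) : triple :=
  match u with inl a => inl (gmatch C D a) | inr a => inr (E.1 a) end.

Definition tswap (u : triple) : triple :=
  match u with
  | inl (inr (inr i)) => inr (inl i)
  | inr (inl i) => inl (inr (inr i))
  | inl a => inl (gswap a)
  | _ => u
  end.

Lemma triple_component v : exists w,
  forall u, connect tri (touter v) (touter u) -> u = v \/ u = w.
Proof.
have swK : involutive tswap by case=> [[[i|i]|[i|i]]|[i|i]].
have maK : involutive tmatch.
  by case: mE => _ EK _ [a|a] /=; rewrite ?gmatchK ?EK.
have ma_neq u : tmatch u <> u.
  by case: u => [a|a] /= [] => [/gmatch_neq|]; [apply | case: mE => H _ _ /H].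
have sw_out u : tswap (touter u) = touter u by case: u.
have t_ma a : tri a (tmatch a) by case: a => [[[i|i]|[i|i]]|[i|i]] /=.
have t_sw a : connect tri a (tswap a).
  by case: a => [[[i|i]|[i|i]]|[i|i]] //=; apply: connect1 => /=.
have triE a b : tri a b -> b = tmatch a \/ b = tswap a.
  case: a b => [[[i|i]|[i|i]]|[i|i]] [[[j|j]|[j|j]]|[j|j]] //= /eqP ->;
  by [left | right].
have sw_fix u : tswap u = u -> exists v, u = touter v.
  by case: u => [[[i|i]|[i|i]]|[i|i]] //= _; [exists (inl i) | exists (inr i)].
have [w [_ /sw_fix[w' ->] _ H]] :=
  reflections_component swK maK ma_neq (sw_out v) t_ma t_sw triE.
have t_inj : injective touter by case=> i [] j // [->].
by exists w' => u /(H _ (sw_out u))[] /t_inj; [left | right].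
Qed.

Definition tri_label (v : node N) : nat :=
  \big[minn/N]_(u | connect tri (touter v) u) tlabel u.

Let emb_l (u : glued N) : triple :=
  match u with inl a => inl (outer a) | inr a => inr a end.

Let in_l (u : glued N) : pred triple := fun z =>
  match u, z with
  | inl a, inl p => connect (glue C D) (outer a) p
  | inr a, inr b => a == b
  | _, _ => false
  end.

Lemma connect_tri_l p q : connect (glue C D) p q -> connect tri (inl p) (inl q).
Proof. by apply: connect_image => a b ab; apply: connect1; rewrite tri_ll. Qed.

(** An edge from the C-D half to E starts at an outer right node of that half. By [comp_partnerP]
    this node is [a] itself or its partner in the composition, so the edge is seen in the contracted
    graph. *)
Lemma comp_tri_l u z : connect tri (emb_l u) z <->
  exists2 u', connect (glue (comp_labelled C D) E) u u' & in_l u' z.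
Proof.
apply: connect_contract => {u z}.
- by case=> a /=.
- case=> [a|a] [b|b].
  + rewrite glue_ll comp_labelledE1 => /eqP ->; apply: connect_tri_l.
    by case: (comp_partnerP a mC mD).
  + by case: a b => i [] j //= /eqP ->; apply: connect1 => /=.
  + by case: a b => i [] j //= /eqP ->; apply: connect1 => /=.
  + by rewrite glue_rr => ab; apply: connect1; rewrite tri_rr.
- case=> [a|a] [p|b] //=; first exact: connect_tri_l.
  by move/eqP ->.
case=> [a|a] [p|b] // z'; rewrite [in_l _ _]/=.
- case: z' => [q|b] ap.
    rewrite tri_ll => pq; left; apply: connect_trans ap _.
    exact: connect1.
  case: p b ap => [[i|i]|[i|i]] [j|j] //= ai /eqP <-; right.
  exists (inr (inl i)); last by rewrite /= eqxx.
  apply: (@connect_trans _ _ (inl (inr i))); last by apply: connect1 => /=.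
  have [_ _ H] := comp_partnerP a mC mD.
  have [->|->] := H (inr i) ai; first by [].
  by apply: connect1; rewrite (glue_ll, glue_rr) comp_labelledE1.
- move/eqP <-; case: z' => [q|b']; last first.
    rewrite tri_rr => ab; right; exists (inr b'); last by rewrite /= eqxx.
    by apply: connect1; rewrite glue_rr.
  case: a q => i [] [] j //= /eqP <-; right.
  by exists (inl (inr i)) => //=; apply: connect1 => /=.
Qed.

(** As [triple] is bracketed to the left, the D-E half is spread over two summands; [shift] embeds
    its glued graph. *)
Let emb_r (u : glued N) : triple :=
  match u with
  | inl a => inl (inl a)
  | inr (inl i) => inl (inr (inl i))
  | inr (inr i) => inr (inr i)
  end.

Let in_r (u : glued N) : pred triple := fun z =>
  match u, z with
  | inl a, inl (inl b) => a == b
  | inr a, inl (inr b) => connect (glue D E) (outer a) (inl b)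
  | inr a, inr b => connect (glue D E) (outer a) (inr b)
  | _, _ => false
  end.

Let shift (p : glued N) : triple :=
  match p with inl a => inl (inr a) | inr a => inr a end.

Lemma connect_tri_r p q : connect (glue D E) p q -> connect tri (shift p) (shift q).
Proof.
apply: connect_image => a b ab; apply: connect1.
by case: a b ab => [[i|i]|[i|i]] [[j|j]|[j|j]].
Qed.

Lemma comp_tri_r u z : connect tri (emb_r u) z <->
  exists2 u', connect (glue C (comp_labelled D E)) u u' & in_r u' z.
Proof.
apply: connect_contract => {u z}.
- by case=> [a|[a|a]] /=.
- case=> [a|a] [b|b].
  + by rewrite glue_ll => ab; apply: connect1; rewrite tri_ll glue_ll.
  + by case: a b => i [] j //= /eqP ->; apply: connect1 => /=.
  + by case: a b => i [] j //= /eqP ->; apply: connect1 => /=.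
  + rewrite glue_rr comp_labelledE1 => /eqP ->.
    have [_ H _] := comp_partnerP a mD mE.
    by have := connect_tri_r H; case: (a) => i; case: comp_partner.
- case=> [a|a] [[b|b]|b] //=; first by move/eqP ->.
  + by move/connect_tri_r; case: a.
  + by move/connect_tri_r; case: a.
have out a p j : connect (glue D E) (outer a) p -> glue D E p (outer j) \/ p = outer j ->
    connect (glue C (comp_labelled D E)) (inr a) (inr j).
  move=> ap pj.
  have aj : connect (glue D E) (outer a) (outer j).
    by case: pj => [pj|<- //]; apply: connect_trans ap (connect1 pj).
  have [_ _ H] := comp_partnerP a mD mE.
  have [->|->] := H j aj; first by [].
  by apply: connect1; rewrite (glue_ll, glue_rr) comp_labelledE1.
case=> [a|a] [[b|b]|b] // z'; rewrite [in_r _ _]/=.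
- move/eqP <-; case: z' => [[b'|b']|b'].
  + rewrite tri_ll glue_ll => ab; right; exists (inl b'); last by rewrite /= eqxx.
    by apply: connect1; rewrite glue_ll.
  + case: a b' => i [] j //= /eqP <-; right.
    by exists (inr (inl i)) => //=; apply: connect1 => /=.
  + by case: a.
- case: z' => [[b'|b']|b'] ab.
  + case: b b' ab => i [] j //= ai /eqP <-; right.
    exists (inl (inr i)) => //=.
    apply: (@connect_trans _ _ (inr (inl i))); last by apply: connect1 => /=.
    by apply: out ai _; right.
  + rewrite tri_ll glue_rr => bb'; left; apply: connect_trans ab (connect1 _).
    by rewrite glue_ll.
  + case: b b' ab => i [] j //= ai /eqP <-; left.
    by apply: connect_trans ai (connect1 _) => /=.
- case: z' => [[b'|b']|b'] ab.
  + by case: b ab.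
  + case: b b' ab => i [] j //= ai /eqP <-; left.
    by apply: connect_trans ai (connect1 _) => /=.
  + rewrite tri_rr => bb'; left; apply: connect_trans ab (connect1 _).
    by rewrite glue_rr.
Qed.

(** Two minima are compared through their lower bounds, which avoids reindexing: t bounds the labels
    of the contracted graph exactly when it bounds the labels over each contracted part. *)
Lemma comp_label_tri_l v :
  comp_label (comp_labelled C D) E v = tri_label v.
Proof.
have outE : touter v = emb_l (outer v) by case: v.
apply: leq_ext => t; rewrite comp_labelleq leq_bigmin.
case tN: (t <= N)%N => //=.
apply/forall_inP/forall_inP => H.
  move=> z; rewrite outE => /comp_tri_l[u vu]; have := H u vu.
  case: u vu => [a|a] _; case: z => [p|b] //=; last by move=> ? /eqP <-.
  by rewrite comp_labelledE2 comp_labelleq => /andP[_ /forall_inP]; apply.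
move=> u vu; have Hz z : in_l u z -> (t <= tlabel z)%N.
  by move=> uz; apply: H; rewrite outE; apply/comp_tri_l; exists u.
case: u vu Hz => [a|a] vu Hz /=; last by apply: (Hz (inr a)) => /=.
rewrite comp_labelledE2 comp_labelleq tN; apply/forall_inP => p ap.
exact: (Hz (inl p)).
Qed.

Lemma comp_label_tri_r v :
  comp_label C (comp_labelled D E) v = tri_label v.
Proof.
have outE : touter v = emb_r (outer v) by case: v.
apply: leq_ext => t; rewrite comp_labelleq leq_bigmin.
case tN: (t <= N)%N => //=.
apply/forall_inP/forall_inP => H.
  move=> z; rewrite outE => /comp_tri_r[u vu]; have := H u vu.
  case: u vu => [a|a] _; case: z => [[b|b]|b] //=; first by move=> ? /eqP <-.
    by rewrite comp_labelledE2 comp_labelleq => /andP[_ /forall_inP H'] /H'.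
  by rewrite comp_labelledE2 comp_labelleq => /andP[_ /forall_inP H'] /H'.
move=> u vu; have Hz z : in_r u z -> (t <= tlabel z)%N.
  by move=> uz; apply: H; rewrite outE; apply/comp_tri_r; exists u.
case: u vu Hz => [a|a] vu Hz /=; first by apply: (Hz (inl (inl a))) => /=.
rewrite comp_labelledE2 comp_labelleq tN; apply/forall_inP => -[b|b] ap.
  exact: (Hz (inl (inr b))).
exact: (Hz (inr b)).
Qed.

Lemma comp_labelledA :
  comp_labelled (comp_labelled C D) E = comp_labelled C (comp_labelled D E).
Proof.
have mCD := comp_labelled_matching mC mD; have mDE := comp_labelled_matching mD mE.
apply: labelled_eq => v; last first.
  by rewrite !comp_labelledE2 comp_label_tri_l comp_label_tri_r.
(* Both partners of v are outer nodes of its component in the triple graph, and w is the only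
   candidate apart from v. *)
rewrite !comp_labelledE1; have [w H] := triple_component v.
have [n1 c1 _] := comp_partnerP v mCD mE.
have [n2 c2 _] := comp_partnerP v mC mDE.
have t1 u : connect (glue (comp_labelled C D) E) (outer v) (outer u) ->
    connect tri (touter v) (touter u).
  move=> vu; rewrite (_ : touter v = emb_l (outer v)); last by case: (v).
  by apply/comp_tri_l; exists (outer u) => //; case: (u) => i /=.
have t2 u : connect (glue C (comp_labelled D E)) (outer v) (outer u) ->
    connect tri (touter v) (touter u).
  move=> vu; rewrite (_ : touter v = emb_r (outer v)); last by case: (v).
  by apply/comp_tri_r; exists (outer u) => //; case: (u) => i /=.
have [//|->] := H _ (t1 _ c1).
by have [//|->] := H _ (t2 _ c2).
Qed.

End Triple.

(** A criterion that avoids computing components: [S v] is closed under edges, hence contains the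
    component of v and bounds its labels from below; the partner and a node of minimal label only
    have to be reached by paths. *)
Lemma comp_labelledP C D (R : labelled N) (S : node N -> glued N -> Prop) :
  matching C -> matching D ->
  (forall v, R.1 v <> v) ->
  (forall v, S v (outer v)) ->
  (forall v u u', S v u -> glue C D u u' -> S v u') ->
  (forall v, connect (glue C D) (outer v) (outer (R.1 v))) ->
  (forall v u, S v u -> (R.2 v <= glued_label C D u)%N) ->
  (forall v, exists2 u, connect (glue C D) (outer v) u &
     glued_label C D u = R.2 v :> nat) ->
  comp_labelled C D = R.
Proof.
move=> mC mD Rn S0 Se Rc Sl lR; apply: labelled_eq => v.
  rewrite comp_labelledE1; have [_ _ H] := comp_partnerP v mC mD.
  by have [/Rn|//] := H _ (Rc v).
rewrite comp_labelledE2; apply/eqP; rewrite eqn_leq; apply/andP; split.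
  have [u vu <-] := lR v.
  by have := comp_labelleq C D v (comp_label C D v);
    rewrite leqnn => /esym/andP[_ /forall_inP]; apply.
rewrite comp_labelleq -ltnS ltn_ord; apply/forall_inP => u vu; apply: Sl.
exact: connect_closed (Se v) _ _ (S0 v) vu.
Qed.

End Matching.

(** * Right multiplication by an elementary diagram *)

Lemma even_card_involution (T : finType) (m : T -> T) (A : {set T}) :
  involutive m -> (forall u, m u <> u) -> (forall u, u \in A -> m u \in A) ->
  ~~ odd #|A|.
Proof.
move=> mK mn; elim: {A}_.+1 {-2}A (ltnSn #|A|) => // n IH A An Am.
have [->|[x xA]] := set_0Vmem A; first by rewrite cards0.
have mxA : m x \in A :\ x by rewrite !inE Am // andbT; apply/eqP/mn.
rewrite (cardsD1 x) xA (cardsD1 (m x)) mxA /= negbK.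
have cA : #|A :\ x :\ m x| < #|A|.
  by rewrite (cardsD1 x A) xA (cardsD1 (m x) (A :\ x)) mxA; lia.
apply: IH; first exact: leq_trans cA An.
move=> u; rewrite !inE => /and3P[umx ux uA]; rewrite Am // andbT.
by rewrite (inj_eq (can_inj mK)) ux /= (can2_eq mK mK).
Qed.

Section Okada.
Variable N : nat.
Implicit Types (L C D : labelled N) (u v w a c : node N) (i : 'I_N.-1).

Lemma pos_gt0 v : 0 < pos v.
Proof. by case: v => -[v /= ?]; lia. Qed.

Lemma pos_le v : pos v <= N.*2.
Proof. by case: v => -[v /= ?]; lia. Qed.

Lemma pos_surj p : 0 < p <= N.*2 -> exists v, pos v = p.
Proof.
move=> pN; have [pn|pn] := leqP p N.
  have h : p.-1 < N by lia.
  by exists (inl (Ordinal h)) => /=; lia.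
have h : N.*2 - p < N by lia.
by exists (inr (Ordinal h)) => /=; lia.
Qed.

Lemma card_pos_interval p k : p + k <= N.*2 ->
  #|[set u : node N | p < pos u <= p + k]| = k.
Proof.
elim: k => [|k IH] pk.
  by apply/eqP; rewrite cards_eq0; apply/eqP/setP => u; rewrite !inE; lia.
have [|v vE] := @pos_surj (p + k).+1; first by lia.
rewrite (cardsD1 v) inE (_ : (_ < _ <= _) = true); last by lia.
rewrite add1n -[in RHS]IH; last by lia.
congr (_.+1); apply: eq_card => u; rewrite !inE node_eqE vE; lia.
Qed.

(* The point w lies strictly between v and m v. *)
Definition ins (m : node N -> node N) (v w : node N) : bool :=
  (pos v < pos w) (+) (pos (m v) < pos w).

Lemma noncrossing_ins (m : node N -> node N) : involutive m -> noncrossing m ->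
  forall a c, c <> a -> c <> m a -> ins m a (m c) = ins m a c.
Proof.
move=> mK nc a c /eqP ca /eqP cma.
have nc' x y : ~~ [&& pos x < pos y, pos y < pos (m x) & pos (m x) < pos (m y)].
  by move/forallP/(_ x)/forallP/(_ y): nc.
have := nc' a c; have := nc' a (m c); have := nc' (m a) c; have := nc' (m a) (m c).
have := nc' c a; have := nc' c (m a); have := nc' (m c) a; have := nc' (m c) (m a).
have : (m c != m a) by rewrite (inj_eq (can_inj mK)).
have : (m c != a) by apply: contra cma => /eqP <-; rewrite mK.
rewrite !mK; move: ca cma; rewrite !node_eqE /ins.
move: (pos a) (pos c) (pos (m a)) (pos (m c)) => {nc nc' m mK a c} a c a' c' *.
by lia.
Qed.

(** The nodes strictly inside an arc are matched among themselves, so their number is even. *)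
Lemma matching_parity (m : node N -> node N) : (forall v, m v <> v) ->
  involutive m -> noncrossing m -> forall v, odd (pos (m v)) = ~~ odd (pos v).
Proof.
move=> mn mK nc; have insE := noncrossing_ins mK nc.
have H v : pos v < pos (m v) -> odd (pos (m v)) = ~~ odd (pos v).
  move=> vm; have := pos_le (m v) => le.
  have kE : pos v + (pos (m v) - (pos v).+1) <= N.*2 by lia.
  have := card_pos_interval kE.
  have := @even_card_involution _ m
    [set u | pos v < pos u <= pos v + (pos (m v) - (pos v).+1)] mK mn.
  set A := [set u | _] => even_A cA.
  suff: ~~ odd #|A| by rewrite cA; lia.
  apply: even_A => u; rewrite !inE => uv.
  have uneqv : u <> v by move=> E; move: uv; rewrite E; lia.
  have uneqmv : u <> m v by move=> E; move: uv; rewrite E; lia.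
  have := insE v u uneqv uneqmv; rewrite /ins.
  have : m u != v by apply/eqP => E; apply: uneqmv; rewrite -E mK.
  have : m u != m v by rewrite (inj_eq (can_inj mK)); apply/eqP.
  by rewrite !node_eqE; lia.
move=> v; have : pos v != pos (m v) by rewrite -node_eqE eq_sym; apply/eqP.
rewrite neq_ltn => /orP[/H //|]; rewrite -{2}[v]mK => /H.
by rewrite mK => ->; rewrite negbK.
Qed.

(** Heights and positions have equal parity on the left and opposite parity on the right, where the
    order is also reversed. So the parity condition on labels can be read on positions. *)
Lemma odd_min_absn v w : odd (pos w) = ~~ odd (pos v) ->
  odd (minn (absn v) (absn w)) = odd (minn (pos v) (pos w)).
Proof.
have oE (j : 'I_N) : odd (N.*2 - j) = odd j.
  by rewrite oddB ?odd_double //; have := ltn_ord j; lia.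
case: v w => -[v Hv] [] [w Hw] /=; lia.
Qed.

(** Working form of [is_okada], indifferent to which end of an arc comes first: crossing and nesting
    are expressed by the exclusive or in [ins], and the height bound node by node. *)
Record okada L : Prop := Okada {
  ok_neq : forall v, L.1 v <> v;
  ok_inv : involutive L.1;
  ok_sym : forall v, L.2 (L.1 v) = L.2 v;
  ok_cross : forall a c, c <> a -> c <> L.1 a -> ins L.1 a (L.1 c) = ins L.1 a c;
  ok_pos : forall v, 0 < L.2 v;
  ok_le : forall v, L.2 v <= absn v;
  ok_odd : forall v, odd (L.2 v) = odd (minn (pos v) (pos (L.1 v)));
  ok_nest : forall a c, a <> c -> a <> L.1 c -> ins L.1 c a -> L.2 c < L.2 a
}.

Lemma okada_noncrossing L : okada L -> noncrossing L.1.
Proof.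
move=> oL; apply/forallP => a; apply/forallP => c; apply/negP.
rewrite /nlt => /and3P[ac ca aa].
have := ok_cross oL (a := a) (c := c); rewrite /ins.
have neqP (x y : node N) : pos x < pos y -> y <> x by move=> xy E; rewrite E ltnn in xy.
move/(_ (neqP _ _ ac)); have /nesym nca := neqP _ _ ca.
by move/(_ nca); lia.
Qed.

Lemma okada_parity L : okada L -> forall v, odd (pos (L.1 v)) = ~~ odd (pos v).
Proof.
move=> oL; apply: matching_parity (okada_noncrossing oL); first exact: ok_neq.
exact: ok_inv.
Qed.

Lemma okadaP L : reflect (okada L) (is_okada L).
Proof.
apply: (iffP idP) => [|oL].
  case/and3P => /forallP pm nc /and4P[/forallP hm /forallP hle /forallP hmod nest].
  have mn v : L.1 v <> v by have /andP[/eqP] := pm v.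
  have mK : involutive L.1 by move=> v; have /andP[_ /eqP] := pm v.
  have insE := noncrossing_ins mK nc.
  have par := matching_parity mn mK nc.
  have hs v : L.2 (L.1 v) = L.2 v by apply: val_inj; apply/eqP/hm.
  split=> // [v|v|v|a c].
  - by have := hle v; lia.
  - by have := hle v; lia.
  - rewrite -(odd_min_absn (par v)); have /eqP := hmod v.
    by rewrite !modn2; case: (odd _); case: (odd _).
  - move=> ac acm; have := insE c a ac acm.
    have H x y : [&& pos y < pos x, pos x < pos (L.1 x) & pos (L.1 x) < pos (L.1 y)]
        -> L.2 y < L.2 x by move/forallP/(_ x)/forallP/(_ y)/implyP: nest; apply.
    have := H a c; have := H (L.1 a) c; have := H a (L.1 c); have := H (L.1 a) (L.1 c).
    have : pos a != pos (L.1 a) by rewrite -node_eqE eq_sym; apply/eqP.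
    have : pos a != pos c by rewrite -node_eqE; apply/eqP.
    have : pos a != pos (L.1 c) by rewrite -node_eqE; apply/eqP.
    have : pos (L.1 a) != pos (L.1 c).
      by rewrite -node_eqE (inj_eq (can_inj mK)); apply/eqP.
    have : pos (L.1 a) != pos c.
      by rewrite -node_eqE; apply: contra_not_neq acm => <-; rewrite mK.
    by rewrite !mK !hs /ins; lia.
apply/and3P; split; first 1 last.
- exact: okada_noncrossing.
- apply/and4P; split.
  + by apply/forallP => v; rewrite (ok_sym oL).
  + apply/forallP => v; rewrite ok_pos // leq_min ok_le //=.
    by rewrite -(ok_sym oL v) ok_le.
  + apply/forallP => v; rewrite !modn2 (odd_min_absn (okada_parity oL v)).
    by rewrite ok_odd.
  + apply/forallP => a; apply/forallP => c; apply/implyP.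
    rewrite /nlt => /and3P[ca aa ac].
    apply: (ok_nest oL); rewrite /ins; last by lia.
      by move=> E; rewrite E ltnn in ca.
    by move=> E; rewrite -E in ac; lia.
- apply/forallP => v; rewrite (ok_inv oL) eqxx andbT; apply/eqP; exact: ok_neq.
Qed.

Lemma okada_matching L : okada L -> matching L.
Proof. by move=> oL; split; [exact: ok_neq | exact: ok_inv | exact: ok_sym]. Qed.

Lemma diagram_okada (D : diagram N) : okada D.
Proof. exact/okadaP/diagP. Qed.

Lemma absn_pos v : absn v = minn (pos v) (N.*2.+1 - pos v).
Proof. by case: v => -[v Hv] /=; lia. Qed.

Lemma elemE1 i v : (elem_labelled i).1 v = elem_partner i v.
Proof. by rewrite ffunE. Qed.

Lemma elemE2 i v : (elem_labelled i).2 v = elem_label i v :> nat.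
Proof. by rewrite ffunE inord_label // /elem_label /=; case: eqP; lia. Qed.

Lemma unitE1 v : (unit_labelled N).1 v = flip v.
Proof. by rewrite ffunE. Qed.

Lemma unitE2 v : (unit_labelled N).2 v = absn v :> nat.
Proof. by rewrite ffunE inord_label. Qed.

(* The right nodes joined by the right arc of G_{i+1}. *)
Definition rlo i : node N := inr (lo i).
Definition rhi i : node N := inr (hi i).
Definition inpair i v : bool := (v == rlo i) || (v == rhi i).
Definition swap i v : node N :=
  if v == rlo i then rhi i else if v == rhi i then rlo i else v.

Lemma rlo_neq_rhi i : (rlo i == rhi i) = false.
Proof. by rewrite node_eqE /= ; have := hi_subproof i; lia. Qed.

Lemma inpair_lo i : inpair i (rlo i).
Proof. by rewrite /inpair eqxx. Qed.

Lemma inpair_hi i : inpair i (rhi i).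
Proof. by rewrite /inpair eqxx orbT. Qed.

Lemma swap_lo i : swap i (rlo i) = rhi i.
Proof. by rewrite /swap eqxx. Qed.

Lemma swap_hi i : swap i (rhi i) = rlo i.
Proof. by rewrite /swap eqxx eq_sym rlo_neq_rhi. Qed.

Lemma inpairP i v : inpair i v -> v = rlo i \/ v = rhi i.
Proof. by case/orP => /eqP; [left | right]. Qed.

Lemma swap_id i v : ~~ inpair i v -> swap i v = v.
Proof. by rewrite /inpair /swap; do !case: eqP. Qed.

Lemma swapK i : involutive (swap i).
Proof.
move=> v; have [/inpairP[] ->|nv] := boolP (inpair i v); rewrite ?(swap_lo, swap_hi) //.
by rewrite !swap_id.
Qed.

Lemma inpair_swap i v : inpair i (swap i v) = inpair i v.
Proof.
have [/inpairP[] ->|nv] := boolP (inpair i v); rewrite ?(swap_lo, swap_hi, inpair_lo, inpair_hi) //.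
by rewrite swap_id // (negPf nv).
Qed.

Lemma swap_neq i v : inpair i v -> swap i v <> v.
Proof.
by case/inpairP => ->; rewrite ?(swap_lo, swap_hi) => /eqP;
  rewrite ?rlo_neq_rhi // eq_sym rlo_neq_rhi.
Qed.

Lemma pos_rlo i : pos (rlo i) = N.*2 - i.
Proof. by []. Qed.

Lemma pos_rhi i : pos (rhi i) = N.*2 - i.+1.
Proof. by []. Qed.

(** The nodes [rhi i] and [rlo i] are consecutive, in this order, so every other node compares in
    the same way with both. *)
Lemma pos_swap_lt i v w : inpair i v -> ~~ inpair i w ->
  (pos (swap i v) < pos w) = (pos v < pos w).
Proof.
move=> iv; rewrite /inpair !node_eqE !pos_rlo !pos_rhi.
by have := ltn_ord i; case/inpairP: iv => ->; rewrite ?(swap_lo, swap_hi) pos_rlo pos_rhi; lia.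
Qed.

Lemma pos_lt_swap i v w : inpair i v -> ~~ inpair i w ->
  (pos w < pos (swap i v)) = (pos w < pos v).
Proof.
move=> iv; rewrite /inpair !node_eqE !pos_rlo !pos_rhi.
by have := ltn_ord i; case/inpairP: iv => ->; rewrite ?(swap_lo, swap_hi) pos_rlo pos_rhi; lia.
Qed.

(** The product by G_(i+1): its right arc becomes an arc of the result, and its left arc joins the
    two strands of C ending at the pair. If these are the two ends of a single arc, that arc closes
    into a loop and vanishes. *)
Definition rmul_partner C i v : node N :=
  if inpair i v then swap i v
  else if inpair i (C.1 v) then C.1 (swap i (C.1 v)) else C.1 v.

Definition rmul_label C i v : nat :=
  if inpair i v then i.+1 else minn (C.2 v) (C.2 (rmul_partner C i v)).

Definition rmul C i : labelled N :=
  ([ffun v => rmul_partner C i v], [ffun v => inord (rmul_label C i v)]).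

Lemma rmulE1 C i v : (rmul C i).1 v = rmul_partner C i v.
Proof. by rewrite ffunE. Qed.

Lemma rmulE2 C i v : (rmul C i).2 v = rmul_label C i v :> nat.
Proof.
rewrite ffunE inordK // /rmul_label; case: ifP => _.
  by have := ltn_ord i; lia.
by rewrite ltnS geq_min -ltnS ltn_ord.
Qed.

Lemma inpair_cases i x y : inpair i x -> inpair i y -> y = x \/ y = swap i x.
Proof.
by case/inpairP => -> /inpairP[] ->; rewrite ?(swap_lo, swap_hi); [left|right|right|left].
Qed.

Lemma inpair_thru C i v : matching C -> ~~ inpair i v ->
  ~~ inpair i (C.1 (swap i (C.1 v))).
Proof.
case=> Cn CK _ iv; have [ix|ix] := boolP (inpair i (C.1 v)); last by rewrite swap_id ?CK.
apply/negP => /(inpair_cases ix)[/(congr1 C.1)|/Cn//].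
by rewrite !CK => E; move: iv; rewrite -E inpair_swap ix.
Qed.

Variant rmul_spec C i v : node N -> nat -> Prop :=
| RmulPair of inpair i v : rmul_spec C i v (swap i v) i.+1
| RmulFar of ~~ inpair i v & ~~ inpair i (C.1 v) : rmul_spec C i v (C.1 v) (C.2 v)
| RmulThru x q of ~~ inpair i v & C.1 v = x & C.1 x = v & C.2 x = C.2 v & inpair i x
   & ~~ inpair i q & C.1 q = swap i x & C.1 (swap i x) = q
   & C.2 (swap i x) = C.2 q & q <> v :
    rmul_spec C i v q (minn (C.2 v) (C.2 q)).

Lemma rmulP C i v : matching C ->
  rmul_spec C i v ((rmul C i).1 v) ((rmul C i).2 v).
Proof.
move=> mC; have [Cn CK Cs] := mC; rewrite rmulE1 rmulE2 /rmul_label /rmul_partner.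
have [iv|iv] := ifPn; first exact: RmulPair.
have [ix|ix] := ifPn; last by rewrite Cs minnn; apply: RmulFar.
have q_neq : C.1 (swap i (C.1 v)) <> v.
  by move/(congr1 C.1); rewrite CK; apply: swap_neq.
by apply: (RmulThru (x := C.1 v)) => //; rewrite ?CK ?Cs // inpair_thru.
Qed.

Lemma rmul_pair1 C i v : inpair i v -> (rmul C i).1 v = swap i v.
Proof. by move=> iv; rewrite rmulE1 /rmul_partner iv. Qed.

Lemma rmul_pair2 C i v : inpair i v -> (rmul C i).2 v = i.+1 :> nat.
Proof. by move=> iv; rewrite rmulE2 /rmul_label iv. Qed.

Lemma rmul_far1 C i v : ~~ inpair i v -> ~~ inpair i (C.1 v) ->
  (rmul C i).1 v = C.1 v.
Proof. by move=> iv im; rewrite rmulE1 /rmul_partner (negPf iv) (negPf im). Qed.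

Lemma rmul_far2 C i v : matching C -> ~~ inpair i v -> ~~ inpair i (C.1 v) ->
  (rmul C i).2 v = C.2 v.
Proof.
move=> [_ _ Cs] iv im; apply: val_inj => /=.
by rewrite rmulE2 /rmul_label /rmul_partner (negPf iv) (negPf im) Cs minnn.
Qed.

Lemma rmul_thru1 C i v : ~~ inpair i v -> inpair i (C.1 v) ->
  (rmul C i).1 v = C.1 (swap i (C.1 v)).
Proof. by move=> iv im; rewrite rmulE1 /rmul_partner (negPf iv) im. Qed.

Lemma rmul_thru2 C i v : matching C -> ~~ inpair i v -> inpair i (C.1 v) ->
  (rmul C i).2 v = minn (C.2 v) (C.2 (swap i (C.1 v))) :> nat.
Proof.
move=> [_ _ Cs] iv im; rewrite rmulE2 /rmul_label /rmul_partner (negPf iv) im.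
by rewrite Cs.
Qed.

Lemma rmul_matching C i : matching C -> matching (rmul C i).
Proof.
move=> mC; have [Cn CK Cs] := mC; split=> v.
- case: (rmulP i v mC) => [iv|_ _|x q _ _ _ _ _ _ _ _ _ //]; last exact: Cn.
  exact: swap_neq.
- case: (rmulP i v mC) => [iv|iv im|x q iv vx xv _ ix iq qx xq _ _].
  + by rewrite rmulE1 /rmul_partner inpair_swap iv swapK.
  + by rewrite rmulE1 /rmul_partner (negPf im) CK (negPf iv).
  + by rewrite rmulE1 /rmul_partner (negPf iq) qx inpair_swap ix swapK.
- apply: val_inj => /=.
  case: (rmulP i v mC) => [iv|iv im|x q iv vx xv _ ix iq qx xq _ _].
  + by rewrite rmulE2 /rmul_label inpair_swap iv.
  + by rewrite rmulE2 /rmul_label /rmul_partner (negPf im) CK (negPf iv) Cs minnn.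
  + by rewrite rmulE2 /rmul_label /rmul_partner (negPf iq) qx inpair_swap ix swapK xv minnC.
Qed.

(** On a strand that meets C, the labels of G_(i+1) never lower the minimum: a straight arc has its
    height as label, which bounds the labels of C there, and a strand using the left arc passes
    through [rlo i], where the label in C is at most i + 1. *)
Lemma rmulE C i : okada C -> comp_labelled C (elem_labelled i) = rmul C i.
Proof.
move=> oC; have mC := okada_matching oC; have [Cn CK Cs] := mC.
have mG : matching (elem_labelled i) by apply/okada_matching/okadaP/elem_okada.
(* The nodes of C visited from v; if [C.1 v] is not in the pair, the swap is trivial and only v and
   its partner remain. *)
pose strand v a := a \in [:: v; C.1 v; swap i (C.1 v); C.1 (swap i (C.1 v))].
have strandC v a : strand v a -> strand v (C.1 a).
  rewrite /strand !inE => /or4P[] /eqP ->; rewrite ?CK eqxx ?orbT //.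
have strand_swap v a : ~~ inpair i v -> strand v a -> strand v (swap i a).
  move=> iv; rewrite /strand !inE => /or4P[] /eqP ->;
    rewrite ?swapK ?(swap_id iv) ?(swap_id (inpair_thru mC iv)) ?eqxx ?orbT //.
pose S v (u : glued N) := if inpair i v then
    (u == inr (rlo i)) || (u == inr (rhi i)) else
  match u with
  | inl a => strand v a
  | inr (inl j) => strand v (inr j)
  | inr (inr j) => strand v (inr j) && ~~ inpair i (inr j)
  end.
pose G := glue C (elem_labelled i).
have inpair_l j : inpair i (inl j) = false by [].
have pairE v : inpair i v -> elem_partner i v = swap i v.
  case/inpairP => ->; rewrite ?(swap_lo, swap_hi) /= ?eqxx //.
  by rewrite eq_sym (rlo_neq_rhi i : (lo i == hi i) = false).
have farE j : ~~ inpair i (inr j) ->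
    elem_partner i (inr j) = inl j /\ elem_partner i (inl j) = inr j.
  rewrite /inpair negb_or => /andP[n1 n2].
  by rewrite /= (negPf (n1 : j != lo i)) (negPf (n2 : j != hi i)).
have flipE j : inpair i (inr j) -> elem_partner i (inl j) = flip (swap i (inr j)).
  case/inpairP => -[->]; rewrite -/(rlo i) -/(rhi i) ?(swap_lo, swap_hi) /= ?eqxx //.
  by rewrite eq_sym (rlo_neq_rhi i : (lo i == hi i) = false).
have labE (j : 'I_N) (a : node N) : a \in [:: inl j; inr j] ->
    elem_label i a = if inpair i (inr j) then i.+1 else j.+1.
  rewrite !inE /elem_label /inpair => aj.
  have -> : absn a = j.+1 by case/orP: aj => /eqP ->.
  rewrite !node_eqE !pos_rlo !pos_rhi /=; have := ltn_ord j; have := ltn_ord i.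
  by do 2!case: ifP => ?; lia.
have reach v : ~~ inpair i v -> connect G (outer v) (inl v).
  case: v => j // iv; apply: (@connect_trans _ _ (inr (inl j))).
    by apply: connect1; rewrite /G glue_rr elemE1; case: (farE j iv) => -> _.
  by apply: connect1 => /=.
have GC v : connect G (inl v) (inl (C.1 v)) by apply: connect1; rewrite /G glue_ll.
have Gsym : connect_sym G by apply: glue_sym.
have Gswap v : connect G (inl v) (inl (swap i v)).
  have [iv|iv] := boolP (inpair i v); last by rewrite swap_id.
  have H : connect G (inl (rlo i)) (inl (rhi i)).
    apply: (@connect_trans _ _ (inr (inl (lo i)))); first by apply: connect1 => /=.
    apply: (@connect_trans _ _ (inr (inl (hi i)))); last by apply: connect1 => /=.
    by apply: connect1; rewrite /G glue_rr elemE1 /= eqxx.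
  by case/inpairP: iv => ->; rewrite ?(swap_lo, swap_hi) // Gsym.
have reachR v : ~~ inpair i v -> connect G (outer v) (inl ((rmul C i).1 v)).
  move=> iv; case: (rmulP i v mC) iv => [->//|iv im _|x q iv <- _ _ _ _ _ <- _ _ _].
    exact: connect_trans (reach _ iv) (GC _).
  apply: connect_trans (reach _ iv) _; apply: connect_trans (GC _) _.
  by apply: connect_trans (GC _); apply: Gswap.
have inpairR v : inpair i ((rmul C i).1 v) = inpair i v.
  case: (rmulP i v mC) => [iv|iv im|x q iv _ _ _ _ iq _ _ _ _]; last 2 first.
  - by rewrite (negPf iv) (negPf im).
  - by rewrite (negPf iv) (negPf iq).
  by rewrite inpair_swap.
have strand_label v a : ~~ inpair i v -> strand v a -> ((rmul C i).2 v <= C.2 a)%N.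
  move=> iv; rewrite /strand !inE.
  case: (rmulP i v mC) iv => [->//|iv im _|x q iv xE xv hx _ _ _ qE hq _ _].
    by rewrite swap_id // CK => /or4P[] /eqP ->; rewrite ?Cs.
  rewrite xE qE => /or4P[] /eqP ->; rewrite ?hx ?hq geq_min leqnn ?orbT //.
have oR : matching (rmul C i) by apply: rmul_matching.
apply: (comp_labelledP (S := S)) => //.
- by case: oR.
- move=> v; rewrite /S; have [/inpairP[] ->|iv] := ifPn; rewrite ?eqxx ?orbT //.
  by case: v iv => j iv; rewrite /outer /strand inE eqxx ?iv.
- move=> v u u'; rewrite /S; have [iv|iv] := ifPn.
    case/orP => /eqP ->; case: u' => // u'; rewrite glue_rr elemE1 pairE;
      rewrite ?(inpair_lo, inpair_hi) ?(swap_lo, swap_hi) // => /eqP ->;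
      by rewrite eqxx ?orbT.
  case: u => [a|[j|j]]; case: u' => [b|b].
  + by rewrite glue_ll => sa /eqP ->; apply: strandC.
  + by case: a b => j [] k //= sj /eqP <-.
  + by case: b => k //= sj /eqP <-.
  + rewrite glue_rr elemE1 => sj /eqP ->.
    have [ij|ij] := boolP (inpair i (inr j)).
      have := strand_swap v (inr j) iv sj; rewrite flipE //.
      by move: ij; rewrite -(inpair_swap i (inr j)); case/inpairP => ->.
    by case: (farE j ij) => _ ->; rewrite sj.
  + by case: b.
  + rewrite glue_rr elemE1 => /andP[sj ij] /eqP ->.
    by case: (farE j ij) => -> _.
- move=> v; have [iv|iv] := boolP (inpair i v).
    have outE u : inpair i u -> outer u = inr u by case/inpairP => ->.
    rewrite rmulE1 /rmul_partner iv; apply: connect1.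
    by rewrite !outE ?inpair_swap // glue_rr elemE1 pairE.
  apply: connect_trans (reachR _ iv) _; rewrite Gsym; apply: reach.
  by rewrite inpairR.
- move=> v u; rewrite /S; have [iv|iv] := ifPn.
    rewrite rmulE2 /rmul_label iv => /orP[] /eqP -> /=; rewrite elemE2.
      by rewrite (labE (lo i)) ?inE ?eqxx ?orbT // -/(rlo i) inpair_lo.
    by rewrite (labE (hi i)) ?inE ?eqxx ?orbT // -/(rhi i) inpair_hi.
  have lab j : strand v (inr j) -> ((rmul C i).2 v <= elem_label i (inl j))%N.
    move=> sj; rewrite (labE j) ?inE ?eqxx //; case: ifPn => ij.
      have slo : strand v (rlo i).
        by move: sj (strand_swap v _ iv sj); case/inpairP: ij => ->; rewrite ?swap_hi.
      exact: leq_trans (strand_label _ _ iv slo) (ok_le oC _).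
    exact: leq_trans (strand_label _ _ iv sj) (ok_le oC _).
  case: u => [a|[j|j]] /=; first exact: strand_label.
    by rewrite elemE2; apply: lab.
  by case/andP => sj _; rewrite elemE2; apply: lab.
- move=> v; have [iv|iv] := boolP (inpair i v).
    exists (outer v) => //; rewrite rmulE2 /rmul_label iv.
    case/inpairP: iv => -> /=; rewrite elemE2.
      by rewrite (labE (lo i)) ?inE ?eqxx ?orbT // -/(rlo i) inpair_lo.
    by rewrite (labE (hi i)) ?inE ?eqxx ?orbT // -/(rhi i) inpair_hi.
  have rv := reachR _ iv.
  have [le|lt] := leqP (C.2 v) (C.2 ((rmul C i).1 v)).
    exists (inl v); first exact: reach.
    by rewrite rmulE2 /rmul_label (negPf iv) -rmulE1; apply/esym/minn_idPl.
  exists (inl ((rmul C i).1 v)) => //=.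
  by rewrite rmulE2 /rmul_label (negPf iv) -rmulE1; apply/esym/minn_idPr/ltnW.
Qed.


Lemma rmul_okada C i : okada C -> okada (rmul C i).
Proof.
move=> oC; have mC := okada_matching oC; have [Cn CK Cs] := mC.
have mR := rmul_matching i mC; have [Rn RK Rs] := mR.
have crossC := ok_cross oC; have nestC := ok_nest oC.
(* Away from the pair, the inside of a joined arc is the symmetric difference of the insides of the
   two arcs of C. Crossing and nesting are thus inherited from C. *)
have insE v w : ~~ inpair i v -> inpair i (C.1 v) -> ~~ inpair i w ->
    ins (rmul C i).1 v w = ins C.1 v w (+) ins C.1 ((rmul C i).1 v) w.
  move=> iv im iw; rewrite /ins rmul_thru1 // CK pos_swap_lt //.
  by case: (pos v < _) (pos (C.1 v) < _) (pos (C.1 _) < _) => -[] [].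
have pairF v w : inpair i v -> ~~ inpair i w -> ins (rmul C i).1 v w = false.
  by move=> iv iw; rewrite /ins rmul_pair1 // pos_swap_lt // addbb.
have farE v w : ~~ inpair i v -> ~~ inpair i (C.1 v) -> ins (rmul C i).1 v w = ins C.1 v w.
  by move=> iv im; rewrite /ins rmul_far1.
have swapE v w : inpair i w -> ~~ inpair i v -> ~~ inpair i (C.1 v) ->
    ins C.1 v (swap i w) = ins C.1 v w.
  by move=> iw iv im; rewrite /ins !pos_lt_swap.
have inpairN v : ~~ inpair i v -> ~~ inpair i ((rmul C i).1 v).
  by case: (rmulP i v mC) => // ->.
have neqI y z : ~~ inpair i y -> inpair i z -> z <> y.
  by move=> iy iz E; rewrite -E iz in iy.
split=> //.
- move=> a c ca cRa.
  have [ia|ia] := boolP (inpair i a).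
    have ic : ~~ inpair i c.
      by apply/negP => /(inpair_cases ia)[]//; rewrite -(rmul_pair1 C ia).
    by rewrite !pairF ?inpairN.
  have [ic|ic] := boolP (inpair i c).
    by rewrite rmul_pair1 // /ins !pos_lt_swap ?inpairN.
  have Rac : (rmul C i).1 c <> a by move=> E; apply: cRa; rewrite -E RK.
  have RaRc : (rmul C i).1 c <> (rmul C i).1 a by move/(can_inj RK).
  have [im|im] := boolP (inpair i (C.1 a)); last first.
    rewrite !farE //; rewrite (rmul_far1 ia im) in cRa.
    have [icm|icm] := boolP (inpair i (C.1 c)); last by rewrite rmul_far1 // crossC.
    have icm' : inpair i (swap i (C.1 c)) by rewrite inpair_swap.
    rewrite rmul_thru1 // crossC; [|exact: neqI|exact: neqI].
    by rewrite swapE // crossC.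
  rewrite !insE ?inpairN //.
  have icm : ~~ inpair i (C.1 c).
    apply/negP => icm; case: (inpair_cases im icm) => [/(can_inj CK)//|E].
    by apply: cRa; rewrite rmul_thru1 // -E CK.
  rewrite rmul_far1 // crossC //; last by apply/nesym/neqI.
  rewrite crossC // rmul_thru1 // CK.
  by apply/nesym/neqI; rewrite // inpair_swap.
- by move=> v; case: (rmulP i v mC) => // *; rewrite ?leq_min !ok_pos.
- move=> v; case: (rmulP i v mC) => [/inpairP[] ->|_ _|x q *] /=; try lia.
    exact: ok_le.
  by rewrite geq_min ok_le.
- move=> v; case: (rmulP i v mC) => [iv|_ _|].
  + have := ltn_ord i.
    by case/inpairP: iv => ->; rewrite ?(swap_lo, swap_hi) pos_rlo pos_rhi; lia.
  + exact: ok_odd.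
  (* If v and q are on the same side of the pair, the two arcs are nested and the outer one, of
     smaller label, has the right parity; otherwise both labels have it. *)
  move=> x q iv vx xv hx ix iq qx xq hq qv.
  have ix' : inpair i (swap i x) by rewrite inpair_swap.
  have := ok_odd oC v; have := ok_odd oC q; rewrite vx qx.
  have := okada_parity oC v; have := okada_parity oC q; rewrite vx qx.
  have N1 : ins C.1 q v -> C.2 q < C.2 v.
    by apply: nestC; [exact: nesym | rewrite qx; apply/nesym/neqI].
  have N2 : ins C.1 v q -> C.2 v < C.2 q.
    by apply: nestC; [| rewrite vx; apply/nesym/neqI].
  have gtE (y z : node N) : y <> z -> (pos y < pos z) = ~~ (pos z < pos y).
    by move/eqP; rewrite node_eqE; lia.
  have pxs : odd (pos (swap i x)) = ~~ odd (pos x).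
    have := ltn_ord i; case/inpairP: ix => ->; rewrite ?(swap_lo, swap_hi) pos_rlo pos_rhi; lia.
  move: N1 N2 pxs; rewrite /ins vx qx !pos_swap_lt // /minn pos_lt_swap //.
  rewrite (gtE x v) ?(gtE x q) ?(gtE q v) //; try exact: neqI.
  case: (pos v < pos x) (pos q < pos x) (pos v < pos q) => -[] [] /=;
    move: (pos v) (pos q) (pos x) (pos (swap i x)) (C.2 v : nat) (C.2 q : nat);
    clear => pv pq px ps hv hq;
    case: (ltngtP hv hq) => [_|_|->]; rewrite ?ltnn /=;
    move: (odd pv) (odd pq) (odd px) (odd ps) (odd hv) (odd hq) => o1 o2 o3 o4 o5 o6;
    move=> N1 N2; first [by case: (N1 isT) | by case: (N2 isT) |
      by case: o1; case: o2; case: o3; case: o4; case: o5; case: o6].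
- move=> a c ac aRc.
  have [ic|ic] := boolP (inpair i c).
    have ia : ~~ inpair i a.
      by apply/negP => /(inpair_cases ic)[]//; rewrite -(rmul_pair1 C ic).
    by rewrite pairF.
  have [im|im] := boolP (inpair i (C.1 c)); last first.
    rewrite (rmul_far1 ic im) in aRc; rewrite farE // rmul_far2 //.
    have [ia|ia] := boolP (inpair i a).
      move=> ins_a; rewrite rmul_pair2 //.
      have lo_a : ins C.1 c (rlo i).
        by case/inpairP: ia ins_a => -> //; rewrite -swap_lo swapE ?inpair_lo.
      apply: leq_trans (nestC _ _ _ _ lo_a) (ok_le oC (rlo i));
        exact: neqI (inpair_lo i).
    have [ima|ima] := boolP (inpair i (C.1 a)); last by rewrite rmul_far2 //; apply: nestC.
    have ima' : inpair i (swap i (C.1 a)) by rewrite inpair_swap.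
    move=> ins_a; rewrite rmul_thru2 // leq_min nestC //=.
    apply: nestC; [exact: neqI|exact: neqI|].
    by rewrite swapE // crossC.
  have im' : inpair i (swap i (C.1 c)) by rewrite inpair_swap.
  rewrite rmul_thru2 // gtn_min; have [ia|ia] := boolP (inpair i a).
    rewrite rmul_pair2 // /ins => ins_a.
    (* The pair lies inside the joined arc, so one end of that arc comes after [rlo i]; its height,
       hence its label in C, is at most i. *)
    have small y : pos (rlo i) < pos y -> C.2 y < i.+1.
      move=> iy; apply: leq_ltn_trans (ok_le oC y) _; rewrite absn_pos.
      by move: iy; rewrite pos_rlo; have := ltn_ord i; lia.
    have right y : ~~ inpair i y -> ~~ (pos y < pos a) -> pos (rlo i) < pos y.
      have := ltn_ord i; rewrite /inpair !node_eqE.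
      by case/inpairP: ia => ->; rewrite !pos_rlo !pos_rhi; lia.
    rewrite -(Cs (swap _ _)) -rmul_thru1 //; case: (boolP (pos c < pos a)) ins_a => [_|ca _].
      by move=> Ra; rewrite (small ((rmul C i).1 c)) ?orbT // right ?inpairN.
    by rewrite small // right.
  have ima : ~~ inpair i (C.1 a).
    apply/negP => ima; case: (inpair_cases im ima) => [/(can_inj CK)//|E].
    by apply: aRc; rewrite rmul_thru1 // -E CK.
  (* By [insE], a is inside exactly one of the two joined arcs, and the label of that arc is already
     below that of a. *)
  rewrite insE // rmul_far2 // => ins_a.
  have [ica|ica] := boolP (ins C.1 c a).
    by rewrite nestC // => E; move: ia; rewrite E im.
  rewrite (negPf ica) /= in ins_a.
  rewrite -(Cs (swap _ _)) -rmul_thru1 // [X in _ || X]nestC ?orbT //.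
  by rewrite rmul_thru1 // CK => E; move: ia; rewrite E im'.
Qed.

End Okada.

(** * Relations between elementary diagrams *)

Section Relations.
Variable N : nat.
Implicit Types (L C D : labelled N) (u v w a c : node N) (i j : 'I_N.-1).

Lemma unit_matching : matching (unit_labelled N).
Proof. exact/okada_matching/okadaP/unit_okada. Qed.

Lemma comp_labelledr1 C : okada C -> comp_labelled C (unit_labelled N) = C.
Proof.
move=> oC; have mC := okada_matching oC; have [Cn CK Cs] := mC.
pose strand v a := (a == v) || (a == C.1 v).
have strandC v a : strand v a -> strand v (C.1 a).
  by rewrite /strand => /orP[] /eqP ->; rewrite ?CK eqxx ?orbT.
have strand_le v a : strand v a -> (C.2 v <= C.2 a)%N.
  by rewrite /strand => /orP[] /eqP ->; rewrite ?Cs.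
pose S v (u : glued N) :=
  match u with inl a => strand v a | inr (inl j | inr j) => strand v (inr j) end.
have Gsym : connect_sym (glue C (unit_labelled N)).
  by apply: glue_sym => //; exact: unit_matching.
have reach v : connect (glue C (unit_labelled N)) (outer v) (inl v).
  case: v => k //; apply: (@connect_trans _ _ (inr (inl k))).
    by apply: connect1; rewrite glue_rr unitE1.
  by apply: connect1 => /=.
apply: (comp_labelledP (S := S)) => //.
- exact: unit_matching.
- by move=> v; rewrite /S; case: v => k /=; rewrite /strand eqxx.
- move=> v [a|[k|k]] [b|b] /=.
  + by rewrite -/(glue C (unit_labelled N) (inl a) (inl b)) glue_ll => sa /eqP ->; apply: strandC.
  + by case: a b => k [] l //= sk /eqP <-.
  + by case: b => l //= sk /eqP <-.
  + by rewrite unitE1 => sk /eqP ->.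
  + by case: b.
  + by rewrite unitE1 => sk /eqP ->.
- move=> v; apply: connect_trans (reach v) _; rewrite Gsym.
  by apply: connect_trans (reach _) _; apply: connect1; rewrite glue_ll CK.
- move=> v [a|[k|k]] /= => [/strand_le//|/strand_le H|/strand_le H];
    by rewrite unitE2; apply: leq_trans H (ok_le oC _).
- by move=> v; exists (inl v).
Qed.

Definition wl (s : seq 'I_N.-1) : labelled N := foldl (@rmul N) (unit_labelled N) s.

Lemma foldl_rmul_okada C s : okada C -> okada (foldl (@rmul N) C s).
Proof. by elim: s C => //= i s IH C oC; apply/IH/rmul_okada. Qed.

Lemma wl_okada s : okada (wl s).
Proof. exact/foldl_rmul_okada/okadaP/unit_okada. Qed.

Lemma comp_labelled_wl C s : okada C -> comp_labelled C (wl s) = foldl (@rmul N) C s.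
Proof.
move=> oC; rewrite /wl; elim/last_ind: s => [|s i IH]; first exact: comp_labelledr1.
have mG : matching (elem_labelled i) by apply/okada_matching/okadaP/elem_okada.
have oF := foldl_rmul_okada s oC; have oW := wl_okada s.
rewrite -!cats1 !foldl_cat /= -!rmulE // -comp_labelledA ?IH //.
  exact: okada_matching.
exact: okada_matching.
Qed.

Lemma rmul_id C i : okada C -> C.1 (rlo i) = rhi i -> C.2 (rlo i) = i.+1 :> nat ->
  rmul C i = C.
Proof.
move=> oC E1 E2; have mC := okada_matching oC; have [Cn CK Cs] := mC.
have E1' : C.1 (rhi i) = rlo i by rewrite -E1 CK.
have E2' : C.2 (rhi i) = i.+1 :> nat by rewrite -E1 Cs.
have inpairC v : inpair i (C.1 v) = inpair i v.
  by rewrite /inpair -E1 (can_eq CK) -{1}(CK (rlo i)) (can_eq CK) E1 orbC.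
apply: labelled_eq => v; have [iv|iv] := boolP (inpair i v).
- by rewrite rmul_pair1 //; case/inpairP: iv => ->; rewrite ?(swap_lo, swap_hi).
- by rewrite rmul_far1 // inpairC.
- by rewrite rmul_pair2 //; case/inpairP: iv => ->.
- by rewrite rmul_far2 // inpairC.
Qed.

(* C has the right arc {s, t} of G_{i+1}; multiplication by G_{j+1} moves it to
   {s, t'} and lets the strand ending at t' end at t. *)
Lemma rmul_rmul_id C i j s t t' : okada C ->
  inpair i t -> s = swap i t -> inpair j t' -> s = swap j t' ->
  ~~ inpair i t' -> ~~ inpair j t -> C.1 t = s -> C.2 t = i.+1 :> nat ->
  (C.2 t' <= i.+1)%N -> (C.2 t' <= j.+1)%N ->
  rmul (rmul C j) i = C.
Proof.
move=> oC it si jt' sj it' jt E1 E2 l_i l_j.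
have mC := okada_matching oC; have [Cn CK Cs] := mC.
have oD := rmul_okada j oC; have mD := okada_matching oD; have [Dn DK Ds] := mD.
set D := rmul C j in oD mD Dn DK Ds *.
have is_ : inpair i s by rewrite si inpair_swap.
have js_ : inpair j s by rewrite sj inpair_swap.
have swis : swap i s = t by rewrite si swapK.
have swjs : swap j s = t' by rewrite sj swapK.
have E1' : C.1 s = t by rewrite -E1 CK.
have E2' : C.2 s = i.+1 :> nat by rewrite -E1 Cs.
have iP y : inpair i y -> y = t \/ y = s by rewrite si; apply: inpair_cases.
have jP y : inpair j y -> y = t' \/ y = s by rewrite sj; apply: inpair_cases.
have tt' : t <> t' by move=> E; rewrite -E it in it'.
have jp : ~~ inpair j (C.1 t').
  by apply/negP => /jP[/Cn//|E]; apply: tt'; rewrite -E1' -E CK.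
have ip : ~~ inpair i (C.1 t').
  apply/negP => /iP[E|E]; last by apply: tt'; rewrite -E1' -E CK.
  by move: it'; rewrite -(CK t') E E1 is_.
have D1t : D.1 t = C.1 t' by rewrite rmul_thru1 ?E1 // swjs.
have D2t : D.2 t = C.2 t' :> nat by rewrite rmul_thru2 ?E1 // swjs E2; apply/minn_idPr.
have D1t' : D.1 t' = s by rewrite rmul_pair1.
have D1s : D.1 s = t' by rewrite rmul_pair1.
have D2t' : D.2 t' = j.+1 :> nat by rewrite rmul_pair2.
have D2s : D.2 s = j.+1 :> nat by rewrite rmul_pair2.
apply: labelled_eq => v.
  have [/iP[]->|iv] := boolP (inpair i v).
  - by rewrite rmul_pair1 // -si.
  - by rewrite rmul_pair1 // swis.
  have [/jP[]->|jv] := boolP (inpair j v); last 2 first.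
  - by rewrite rmul_pair1 // swis.
  - have [/jP[E|E]|jm] := boolP (inpair j (C.1 v)).
    + have Dv : D.1 v = t by rewrite -[v]CK E -D1t DK.
      by rewrite rmul_thru1 ?Dv // -si D1s E.
    + by move: iv; rewrite -[v]CK E E1' it.
    have Dv : D.1 v = C.1 v by rewrite rmul_far1.
    rewrite rmul_far1 ?Dv //; apply/negP => /iP[E|E].
      by move: iv; rewrite -[v]CK E E1 is_.
    by move: iv; rewrite -[v]CK E E1' it.
  - by rewrite rmul_thru1 ?D1t' // swis D1t.
have [/iP[]->|iv] := boolP (inpair i v).
- by rewrite rmul_pair2.
- by rewrite rmul_pair2.
have [/jP[]->|jv] := boolP (inpair j v); last 2 first.
- by rewrite rmul_pair2.
- have [/jP[E|E]|jm] := boolP (inpair j (C.1 v)).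
  + have Dv : D.1 v = t by rewrite -[v]CK E -D1t DK.
    rewrite rmul_thru2 ?Dv // -si D2s -(Ds v) Dv D2t -(Cs v) E.
    exact/minn_idPl.
  + by move: iv; rewrite -[v]CK E E1' it.
  have Dv : D.1 v = C.1 v by rewrite rmul_far1.
  rewrite rmul_far2 // ?Dv; first by rewrite rmul_far2.
  apply/negP => /iP[E|E].
    by move: iv; rewrite -[v]CK E E1 is_.
  by move: iv; rewrite -[v]CK E E1' it.
- by rewrite rmul_thru2 ?D1t' // swis D2t D2t'; apply/minn_idPr.
Qed.

Lemma rhi_rlo i j : j = i.+1 :> nat -> rhi i = rlo j.
Proof. by move=> ij; congr inr; apply: val_inj. Qed.

Lemma rmul_braid C i j : okada C -> j = i.+1 :> nat ->
  C.1 (rlo j) = rhi j -> C.2 (rlo j) = j.+1 :> nat -> rmul (rmul C i) j = C.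
Proof.
move=> oC ij E1 E2; have hl := rhi_rlo ij; have [Cn CK Cs] := okada_matching oC.
have lt_i := ltn_ord i; have lt_j := ltn_ord j.
apply: (rmul_rmul_id (s := rlo j) (t := rhi j) (t' := rlo i)) => //;
  rewrite ?inpair_lo ?inpair_hi ?swap_hi ?swap_lo //.
- by rewrite /inpair !node_eqE !pos_rlo !pos_rhi; lia.
- by rewrite /inpair !node_eqE !pos_rlo !pos_rhi; lia.
- by rewrite -E1 CK.
- by rewrite -E1 Cs.
- by have := ok_le oC (rlo i); rewrite /=; lia.
- by have := ok_le oC (rlo i); rewrite /=; lia.
Qed.

(** The reversed braid, which is not a relation of the algebra: a strand at [rhi j] with label above
    i + 1 would have its label lowered to i + 1. In [rmul_braid] the corresponding bound is
    automatic, as the strand there ends at height i + 1. *)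
Lemma rmul_braidV C i j : okada C -> j = i.+1 :> nat ->
  C.1 (rlo i) = rhi i -> C.2 (rlo i) = i.+1 :> nat -> (C.2 (rhi j) <= i.+1)%N ->
  rmul (rmul C j) i = C.
Proof.
move=> oC ij E1 E2 le; have hl := rhi_rlo ij.
have lt_i := ltn_ord i; have lt_j := ltn_ord j.
apply: (rmul_rmul_id (s := rhi i) (t := rlo i) (t' := rhi j)) => //;
  rewrite ?inpair_lo ?inpair_hi ?swap_hi ?swap_lo //.
- by rewrite /inpair !node_eqE !pos_rlo !pos_rhi; lia.
- by rewrite /inpair !node_eqE !pos_rlo !pos_rhi; lia.
- by lia.
Qed.

Definition touches i v : bool := inpair i v || inpair i (flip v).

Lemma flipK : involutive (@flip N).
Proof. by case. Qed.

Lemma elem_partnerE i v : elem_partner i v =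
  if inpair i v then swap i v
  else if inpair i (flip v) then flip (swap i (flip v)) else flip v.
Proof.
have E (x y : 'I_N) : ((inr x : node N) == inr y) = (x == y) by [].
case: v => k; rewrite /inpair /swap /= !E; do !case: eqP => //=.
Qed.

Lemma elem_labelE i v : elem_label i v = if touches i v then i.+1 else absn v.
Proof.
rewrite /elem_label /touches /inpair !node_eqE !pos_rlo !pos_rhi.
have := ltn_ord i; case: v => -[k kN] /=; do ?case: ifP => //; lia.
Qed.

Lemma absn_flip v : absn (flip v) = absn v.
Proof. by case: v. Qed.

Lemma far_inpair i j v : far i j -> inpair i v -> ~~ touches j v.
Proof.
rewrite /far /touches /inpair !node_eqE !pos_rlo !pos_rhi.
by have := ltn_ord i; have := ltn_ord j; case: v => -[k kN] /=; lia.
Qed.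

Lemma rmul_elem_far i j : far i j -> rmul (elem_labelled i) j = rmul (elem_labelled j) i.
Proof.
have H i' j' v : far i' j' ->
    ((rmul (elem_labelled i') j').1 v =
      if touches j' v then elem_partner j' v else elem_partner i' v) /\
    ((rmul (elem_labelled i') j').2 v =
      (if touches j' v then j'.+1 else elem_label i' v) :> nat).
  move=> ij; have ji : far j' i' by rewrite /far orbC.
  have mG : matching (elem_labelled i') by apply/okada_matching/okadaP/elem_okada.
  rewrite rmulE1 rmulE2 /rmul_label /rmul_partner /touches.
  rewrite [elem_partner j' v]elem_partnerE.
  case: ifP => //= jv; case jfv: (inpair j' (flip v)).
    have := far_inpair ji jfv; rewrite /touches negb_or flipK => /andP[ifv iv].
    have Ev : elem_partner i' v = flip v.
      by rewrite elem_partnerE (negPf iv) (negPf ifv).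
    have jsw : inpair j' (swap j' (flip v)) by rewrite inpair_swap.
    have := far_inpair ji jsw; rewrite /touches negb_or => /andP[isw ifsw].
    have Es : elem_partner i' (swap j' (flip v)) = flip (swap j' (flip v)).
      by rewrite elem_partnerE (negPf isw) (negPf ifsw).
    rewrite !elemE1 Ev jfv Es; split=> //.
    rewrite !elemE2 !elem_labelE /touches flipK (negPf iv) (negPf ifv) (negPf isw) (negPf ifsw) /=.
    rewrite absn_flip -(absn_flip v).
    by case/inpairP: jfv => ->; rewrite ?(swap_lo, swap_hi) /=; lia.
  have nj : ~~ inpair j' (elem_partner i' v).
    rewrite elem_partnerE; case: ifP => iv.
      by have := @far_inpair i' j' (swap i' v) ij; rewrite inpair_swap iv /touches => /(_ isT)/norP[].
    case: ifP => ifv; last by rewrite jfv.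
    have := @far_inpair i' j' (swap i' (flip v)) ij.
    by rewrite inpair_swap ifv /touches => /(_ isT)/norP[].
  rewrite elemE1 (negPf nj); split=> //.
  by case: mG => _ _ /(_ v); rewrite elemE1 => ->; rewrite minnn elemE2.
move=> ij; have ji : far j i by rewrite /far orbC.
apply: labelled_eq => v.
  rewrite (H i j v ij).1 (H j i v ji).1; case: ifP => tj; case: ifP => ti //.
    move: ti tj => /orP[] /(far_inpair ij); rewrite /touches ?flipK; first by move/negP.
    by rewrite orbC => /negP.
  move: ti tj; rewrite /touches !elem_partnerE.
  by move=> /norP[/negPf -> /negPf ->] /norP[/negPf -> /negPf ->].
rewrite (H i j v ij).2 (H j i v ji).2 !elem_labelE; case: ifP => tj; case: ifP => ti //.
move: ti tj => /orP[] /(far_inpair ij); rewrite /touches ?flipK; first by move/negP.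
by rewrite orbC => /negP.
Qed.

End Relations.

(** * Generation by elementary diagrams *)

Section Level.
Variable N : nat.
Implicit Types (L C D : labelled N) (u v w a c : node N) (i j : 'I_N.-1).

(* L is the identity above the height n. *)
Definition level n L : Prop := forall j : 'I_N, (n <= j)%N ->
  L.1 (inr j) = inl j /\ L.2 (inr j) = j.+1 :> nat.

Lemma level_flip n L v : okada L -> level n L -> (n < absn v)%N ->
  L.1 v = flip v /\ L.2 v = absn v :> nat.
Proof.
move=> oL lv; have [Ln LK Ls] := okada_matching oL.
case: v => k /=; rewrite ltnS => /lv[E1 E2] //.
by rewrite -E1 LK Ls.
Qed.

Lemma level0 L : okada L -> level 0 L -> L = unit_labelled N.
Proof.
move=> oL l0; apply: labelled_eq => v; rewrite ?unitE1 ?unitE2;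
  by case: (level_flip oL l0 (v := v)) => //; case: v.
Qed.

Lemma level_top L : level N L.
Proof. by move=> j; rewrite leqNgt ltn_ord. Qed.

Lemma absn_eq v w : absn v = absn w -> v = w \/ v = flip w.
Proof.
by case: v w => k [] l /= [] /val_inj ->; [left|right|right|left].
Qed.

(** A maximal label forces the other end of the arc to height at least j + 1; greater heights are
    taken by straight strands, so that end is the opposite node. *)
Lemma level_pred L (j : 'I_N) : okada L -> level j.+1 L ->
  L.2 (inr j) = j.+1 :> nat -> level j L.
Proof.
move=> oL lL Lj k; have [Ln LK Ls] := okada_matching oL.
rewrite leq_eqVlt => /predU1P[/val_inj <-|/lL //]; split=> //.
have le : (j.+1 <= absn (L.1 (inr j)))%N by rewrite -Lj -Ls; apply: ok_le.
have [lt|ge] := ltnP j.+1 (absn (L.1 (inr j))).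
  have [] := level_flip oL lL lt; rewrite LK Ls Lj => _ E.
  by rewrite -E ltnn in lt.
have E : absn (L.1 (inr j)) = absn (inr j : node N).
  by apply/eqP; rewrite eqn_leq ge le.
by case: (absn_eq E) => [/Ln|].
Qed.

(** The label of [rlo i] forces its partner to height at least i + 1. A partner other than [rhi i]
    would leave [rhi i] strictly inside the arc, with a label of at least i + 2. *)
Lemma small_arc L i : okada L -> L.2 (rlo i) = i.+1 :> nat ->
  (L.2 (rhi i) < i.+2)%N -> L.1 (rlo i) = rhi i.
Proof.
move=> oL E1 lt2; have [Ln LK Ls] := okada_matching oL.
have lt_i := ltn_ord i.
have le : (i.+1 <= absn (L.1 (rlo i)))%N by rewrite -E1 -Ls; apply: ok_le.
apply/eqP; apply: contraTT lt2 => /eqP q_hi; rewrite -ltnNge ltnS -E1.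
apply: (ok_nest oL).
- by move/eqP; rewrite eq_sym rlo_neq_rhi.
- by move/esym/q_hi.
move: le q_hi (Ln (rlo i)) => + /eqP + /eqP; rewrite absn_pos !node_eqE /ins.
by rewrite pos_rlo pos_rhi; lia.
Qed.

(** The least index from [j0] on whose label is not maximal comes just after one whose label is;
    [small_arc] applies to these two. *)
Lemma exists_small_arc L (n j0 : 'I_N) : okada L -> (j0 <= n)%N ->
  L.2 (inr j0) = j0.+1 :> nat -> L.2 (inr n) <> n.+1 :> nat ->
  exists i, [/\ (j0 <= i < n)%N, L.1 (rlo i) = rhi i & L.2 (rlo i) = i.+1 :> nat].
Proof.
move=> oL j0n E0 En.
have ex : exists k, (j0 <= k)%N && [exists k' : 'I_N, (val k' == k) && (L.2 (inr k') != k.+1 :> nat)].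
  by exists n; rewrite j0n; apply/existsP; exists n; rewrite eqxx; apply/eqP.
case: (ex_minnP ex) => k /andP[j0k /existsP[k' /andP[/eqP kk' /eqP Ek]]] kmin.
have kn : (k <= n)%N.
  apply: kmin; rewrite j0n; apply/existsP; exists n; rewrite eqxx; exact/eqP.
have j0_k : (j0 < k)%N.
  rewrite ltn_neqAle j0k andbT; apply/eqP => E; apply: Ek.
  have <- : j0 = k' by apply: val_inj; rewrite kk'.
  by rewrite E0 E.
have kN : (k < N)%N by rewrite -kk' ltn_ord.
have lt_i : (k.-1 < N.-1)%N by lia.
pose i : 'I_N.-1 := Ordinal lt_i.
have hiE : rhi i = inr k' by congr inr; apply: val_inj; rewrite /= kk' prednK //; lia.
have E1 : L.2 (rlo i) = i.+1 :> nat.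
  apply/eqP/negPn/negP => Ei; have: (k <= k.-1)%N; last by lia.
  apply: kmin; apply/andP; split; first by lia.
  by apply/existsP; exists (lo i); rewrite eqxx.
exists i; split=> //; first by rewrite /=; lia.
apply: small_arc => //; rewrite hiE.
have := ok_le oL (inr k'); rewrite /= -kk' prednK; last by lia.
rewrite leq_eqVlt => /predU1P[E|//]; first by case: Ek; rewrite E kk'.
Qed.

End Level.

(** * Removing a last letter: unfolding the outermost small right arc *)

Section Unfold.
Variables (N : nat) (D : labelled N) (n : nat) (i : 'I_N.-1).
Hypotheses (oD : okada D) (lD : level n.+1 D) (n_i : n = i.+1).
Hypotheses (D1 : D.1 (rlo i) = rhi i) (D2 : D.2 (rlo i) = i.+1 :> nat).

Let u0 : node N := inl (hi i).
Let p := D.1 u0.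

(* The arcs {u0, p} and {rhi i, rlo i} are replaced with {u0, rhi i} and
   {rlo i, p}; then D is the product of the new diagram by G_{i+1}. *)
Definition unfold_partner (v : node N) : node N :=
  if v == u0 then rhi i else if v == rhi i then u0
  else if v == rlo i then p else if v == p then rlo i else D.1 v.

Definition unfold_label (v : node N) : nat :=
  if (v == u0) || (v == rhi i) then i.+2
  else if v == rlo i then D.2 u0 else D.2 v.

Definition unfold : labelled N :=
  ([ffun v => unfold_partner v], [ffun v => inord (unfold_label v)]).

Let DK : involutive D.1 := ok_inv oD.
Let Dn : forall v, D.1 v <> v := ok_neq oD.
Let Ds : forall v, D.2 (D.1 v) = D.2 v := ok_sym oD.

Lemma unfoldE1 v : unfold.1 v = unfold_partner v.
Proof. by rewrite ffunE. Qed.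

Lemma unfoldE2 v : unfold.2 v = unfold_label v :> nat.
Proof.
have lt_i := ltn_ord i.
rewrite ffunE inordK // /unfold_label; case: ifP => _; first by lia.
by case: ifP => _; apply: ltn_ord.
Qed.

Let D1' : D.1 (rhi i) = rlo i. Proof. by rewrite -D1 DK. Qed.
Let D2' : D.2 (rhi i) = i.+1 :> nat. Proof. by rewrite -D1 Ds. Qed.
Let Dp : D.1 p = u0. Proof. exact: DK. Qed.

Let p_rhi : p <> rhi i.
Proof. by move/(congr1 D.1); rewrite Dp D1'. Qed.

Let p_rlo : p <> rlo i.
Proof. by move/(congr1 D.1); rewrite Dp D1. Qed.

Let p_u0 : p <> u0. Proof. exact: Dn. Qed.

Let low_p : (absn p <= n.+1)%N.
Proof.
rewrite leqNgt; apply/negP => hp; have [E _] := level_flip oD lD hp.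
by move: hp; rewrite -absn_flip -E Dp /u0 /= n_i ltnn.
Qed.

(** A label i + 2 at [u0] would force its partner to be the opposite node [rhi i], which is matched
    with [rlo i]. The bound makes [D.2 u0] admissible at [rlo i], and makes it the minimum when the
    product is formed again. *)
Lemma unfold_label_le : (D.2 u0 <= i.+1)%N.
Proof.
have uE : absn u0 = n.+1 by rewrite n_i.
have := ok_le oD u0; rewrite uE n_i leq_eqVlt ltnS => /predU1P[E|//].
have le : (n.+1 <= absn p)%N by rewrite n_i -E -Ds; apply: ok_le.
have : absn p = absn u0 by apply/eqP; rewrite eqn_leq uE le low_p.
by case/absn_eq => [/p_u0|/p_rhi].
Qed.

Variant unfold_spec v : node N -> nat -> Prop :=
| UnfoldU0 of v = u0 : unfold_spec v (rhi i) i.+2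
| UnfoldHi of v = rhi i : unfold_spec v u0 i.+2
| UnfoldLo of v = rlo i : unfold_spec v p (D.2 u0)
| UnfoldP of v = p : unfold_spec v (rlo i) (D.2 u0)
| UnfoldOther of v <> u0 & v <> rhi i & v <> rlo i & v <> p
    & D.1 v <> u0 & D.1 v <> rhi i & D.1 v <> rlo i & D.1 v <> p :
    unfold_spec v (D.1 v) (D.2 v).

Lemma unfoldP v : unfold_spec v (unfold.1 v) (unfold.2 v).
Proof.
rewrite unfoldE1 unfoldE2 /unfold_partner /unfold_label.
case: eqP => [/UnfoldU0 //|v0]; case: eqP => [/UnfoldHi //|vhi].
case: eqP => [/UnfoldLo //|vlo]; case: eqP => [vp|vp] /=.
  by rewrite [in D.2 v]vp Ds; apply: UnfoldP.
apply: UnfoldOther => // /(congr1 D.1); rewrite DK ?D1 ?D1' ?Dp //.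
Qed.

Let lohi : rlo i <> rhi i. Proof. by apply/eqP; rewrite rlo_neq_rhi. Qed.
Let E0 : unfold.1 u0 = rhi i. Proof. by rewrite unfoldE1 /unfold_partner eqxx. Qed.
Let Ehi : unfold.1 (rhi i) = u0.
Proof. by case: (unfoldP (rhi i)) => // /esym. Qed.
Let Elo : unfold.1 (rlo i) = p.
Proof. by case: (unfoldP (rlo i)) => // /esym /p_rlo. Qed.
Let Ep : unfold.1 p = rlo i. Proof. by case: (unfoldP p). Qed.

Let L0 : unfold.2 u0 = i.+2 :> nat. Proof. by rewrite unfoldE2 /unfold_label eqxx. Qed.
Let Lhi : unfold.2 (rhi i) = i.+2 :> nat.
Proof. by rewrite unfoldE2 /unfold_label eqxx orbT. Qed.
Let Llo : unfold.2 (rlo i) = D.2 u0 :> nat.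
Proof. by rewrite unfoldE2 /unfold_label rlo_neq_rhi eqxx. Qed.
Let Lp : unfold.2 p = D.2 u0 :> nat. Proof. by case: (unfoldP p). Qed.

Lemma unfold_matching : matching unfold.
Proof.
have oth v : v <> u0 -> v <> rhi i -> v <> rlo i -> v <> p -> unfold.1 v = D.1 v.
  by case: unfoldP.
split=> v.
- case: unfoldP => [->|->|->|->|//] //; try by move/esym.
- by case: (unfoldP v) => [->|->|->|->|*] //; rewrite oth.
- apply: val_inj => /=; case: (unfoldP v) => [_|_|_|_|v1 v2 v3 v4 v5 v6 v7 v8] //.
  by case: (unfoldP (D.1 v)) => // *; rewrite Ds.
Qed.

Let lt_i := ltn_ord i.

Let pos_u0 : pos u0 = n.+1. Proof. by rewrite /u0 /= n_i. Qed.

Let high (v : node N) := (n.+1 < absn v)%N.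

(** The new arc from [u0] to [rhi i] encloses exactly the nodes of height above n + 1, all on
    straight strands. The inside of the arc from [rlo i] to [p] therefore differs from that of the
    old arc at [u0] by these nodes only. *)
Let betw v : v <> u0 -> v <> rhi i ->
  (pos u0 < pos v) (+) (pos (rhi i) < pos v) = high v.
Proof.
move=> /eqP + /eqP; rewrite !node_eqE /high absn_pos pos_u0 pos_rhi n_i.
by have := pos_le v; have := pos_gt0 v; lia.
Qed.

Let adj v : v <> rhi i -> v <> rlo i ->
  ((pos (rlo i) < pos v) = (pos (rhi i) < pos v)) *
  ((pos v < pos (rlo i)) = (pos v < pos (rhi i))).
Proof.
by move=> /eqP + /eqP; rewrite !node_eqE pos_rlo pos_rhi; split; lia.
Qed.

Let high_low v : high v -> [/\ v <> u0, v <> rhi i, v <> rlo i & v <> p].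
Proof.
rewrite /high => hv; split=> E; move: hv; rewrite E ?n_i /u0 /=; by have := low_p; lia.
Qed.

Let highD v : high (D.1 v) = high v.
Proof.
have H w : high w -> high (D.1 w).
  by move=> hw; have [-> _] := level_flip oD lD hw; rewrite /high absn_flip.
by apply/idP/idP => [/H|/H //]; rewrite DK.
Qed.

Variant unfold_class v : Prop :=
| ClassA of v = u0 \/ v = rhi i
| ClassB of v = p \/ v = rlo i
| ClassC of [/\ v <> u0, v <> rhi i, v <> rlo i & v <> p]
    & [/\ D.1 v <> u0, D.1 v <> rhi i, D.1 v <> rlo i & D.1 v <> p]
    & unfold.1 v = D.1 v & unfold.2 v = D.2 v :> nat.

Lemma unfold_classP v : unfold_class v.
Proof.
case: (v =P u0) => [?|n0]; first by apply: ClassA; left.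
case: (v =P rhi i) => [?|n1]; first by apply: ClassA; right.
case: (v =P p) => [?|n3]; first by apply: ClassB; left.
case: (v =P rlo i) => [?|n2]; first by apply: ClassB; right.
apply: ClassC; first by split.
- by split=> // /(congr1 D.1); rewrite DK ?D1 ?D1' ?Dp.
- by case: (unfoldP v).
- by case: (unfoldP v).
Qed.

Lemma unfold_okada : okada unfold.
Proof.
have mU := unfold_matching; have [Un UK Us] := mU.
have insA v w : (v = u0 \/ v = rhi i) -> w <> u0 -> w <> rhi i ->
    ins unfold.1 v w = high w.
  move=> v0 w0 w1; rewrite -betw //; case: v0 => ->.
    by rewrite /ins E0.
  by rewrite /ins Ehi addbC.
have insB v w : (v = p \/ v = rlo i) -> w <> u0 -> w <> rhi i -> w <> rlo i -> w <> p ->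
    ins unfold.1 v w = ins D.1 u0 w (+) high w.
  move=> v0 w0 w1 w2 w3; rewrite -betw // -(adj w1 w2).1 /ins -/p.
  have -> : (pos v < pos w) (+) (pos (unfold.1 v) < pos w) =
      (pos p < pos w) (+) (pos (rlo i) < pos w).
    by case: v0 => ->; rewrite ?Ep ?Elo // addbC.
  by case: (pos u0 < _)%N; case: (pos p < _)%N; case: (pos (rlo i) < _)%N.
have insO v w : v <> u0 -> v <> rhi i -> v <> rlo i -> v <> p ->
    ins unfold.1 v w = ins D.1 v w.
  by rewrite /ins; case: unfoldP.
have ins_hi v : v <> u0 -> v <> rhi i -> D.1 v <> u0 -> D.1 v <> rhi i ->
    ins D.1 v (rhi i) = ins D.1 v u0.
  have gtE (y z : node N) : y <> z -> (pos y < pos z)%N = ~~ (pos z < pos y)%N.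
    by move/eqP; rewrite node_eqE; lia.
  move=> v0 v1 m0 m1; have := betw v0 v1; have := betw m0 m1; rewrite highD /ins.
  rewrite !(gtE _ u0) // !(gtE _ (rhi i)) //.
  by case: (high v); case: (pos u0 < pos v)%N; case: (pos u0 < pos (D.1 v))%N;
    case: (pos _ < pos v)%N; case: (pos _ < pos (D.1 v))%N.
have ins_lo v : v <> rhi i -> v <> rlo i -> D.1 v <> rhi i -> D.1 v <> rlo i ->
    ins D.1 v (rlo i) = ins D.1 v (rhi i).
  by move=> v1 v2 m1 m2; rewrite /ins (adj v1 v2).2 (adj m1 m2).2.
have lowB v : v = p \/ v = rlo i -> high v = false.
  by move=> vB; apply/negP => /high_low[_ _ + +]; case: vB => ->.
have gtE (y z : node N) : y <> z -> (pos y < pos z)%N = ~~ (pos z < pos y)%N.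
  by move/eqP; rewrite node_eqE; lia.
split=> //.
- move=> a c ca cUa.
  case: (unfold_classP a) => [aA|aB|[a0 a1 a2 a3] [a4 a5 a6 a7] aE _].
  + have [c0 c1] : c <> u0 /\ c <> rhi i.
      by case: aA ca cUa => ->; rewrite ?E0 ?Ehi.
    case: (unfold_classP c) => [[]//|cB|_ [c4 c5 c6 c7] cE _]; last first.
      by rewrite cE !insA // highD.
    by rewrite !insA ?lowB //; case: cB => ->; rewrite ?Ep ?Elo; auto.
  + have [c0 c1] : c <> p /\ c <> rlo i.
      by case: aB ca cUa => ->; rewrite ?Ep ?Elo.
    case: (unfold_classP c) => [cA|[]//|[c2 c3 _ _] [c4 c5 c6 c7] cE _]; last first.
      by rewrite cE !insB // highD (ok_cross oD).
    suff E : ins unfold.1 a u0 = ins unfold.1 a (rhi i).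
      by case: cA => ->; rewrite ?E0 ?Ehi.
    have := betw p_u0 p_rhi; rewrite lowB; last by left.
    have insE w : ins unfold.1 a w = (pos p < pos w) (+) (pos (rlo i) < pos w).
      by rewrite /ins; case: aB => ->; rewrite ?Ep ?Elo // addbC.
    rewrite !insE (gtE p u0) // (gtE p (rhi i)) // pos_u0 pos_rlo pos_rhi n_i.
    by lia.
  rewrite !insO //.
  case: (unfold_classP c) => [cA|cB|[c0 c1 c2 c3] _ cE _].
  + by case: cA => ->; rewrite ?E0 ?Ehi ins_hi.
  + have E : ins D.1 a (rlo i) = ins D.1 a p.
      by rewrite ins_lo // ins_hi // (ok_cross oD) //; apply/nesym.
    by case: cB => ->; rewrite ?Ep ?Elo E.
  + by rewrite cE (ok_cross oD) // -aE.
- by move=> v; case: unfoldP => // *; rewrite ok_pos.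
- move=> v; have le := unfold_label_le; case: unfoldP => [->|->|->|->|*] //=.
    by rewrite -Ds; apply: ok_le.
  exact: ok_le.
- move=> v; have := ok_odd oD u0; rewrite -/p pos_u0 => odd_l.
  have := betw p_u0 p_rhi; rewrite lowB; last by left.
  have /eqP := p_rlo; have /eqP := p_rhi; have /eqP := p_u0.
  rewrite !node_eqE pos_u0 pos_rlo pos_rhi n_i => n1 n2 n3 lp.
  have lo_odd : odd (D.2 u0) = odd (minn (N.*2 - i) (pos p)).
    by rewrite odd_l n_i; have := pos_le p; lia.
  case: unfoldP => [->|->|->|->|*]; rewrite ?pos_rlo ?pos_rhi ?pos_u0 ?n_i //.
  + by congr (odd _); apply/esym/minn_idPl; move: lt_i; clear; lia.
  + by congr (odd _); apply/esym/minn_idPr; move: lt_i; clear; lia.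
  + by rewrite minnC.
  + exact: ok_odd.
- move=> a c ac aUc.
  case: (unfold_classP c) => [cA|cB|[c0 c1 c2 c3] [c4 c5 c6 c7] cE ->].
  + have [a0 a1] : a <> u0 /\ a <> rhi i.
      by case: cA ac aUc => ->; rewrite ?E0 ?Ehi.
    rewrite insA // => ha; have [_ _ a2 a3] := high_low ha.
    case: (unfold_classP a) => [[]//|[]//|_ _ _ ->].
    have [_ ->] := level_flip oD lD ha.
    by case: cA => ->; rewrite ?L0 ?Lhi -n_i.
  + have [a2 a3] : a <> p /\ a <> rlo i.
      by case: cB ac aUc => ->; rewrite ?Ep ?Elo.
    have -> : unfold.2 c = D.2 u0 :> nat by case: cB => ->.
    have le := unfold_label_le.
    case: (unfold_classP a) => [aA _|[]//|[a0 a1 _ _] _ _ ->].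
      by case: aA => ->; rewrite ?L0 ?Lhi.
    rewrite insB //; have [ha _|_] := boolP (high a).
      by have [_ ->] := level_flip oD lD ha; apply: leq_trans ha; rewrite ltnS n_i ltnW.
    by rewrite addbF; apply: (ok_nest oD).
  rewrite insO //; rewrite cE in aUc.
  case: (unfold_classP a) => [aA|aB|_ _ _ ->]; last exact: (ok_nest oD).
  + move=> ins_a; have : ins D.1 c (rhi i).
      by case: aA ins_a => -> //; rewrite ins_hi.
    have -> : unfold.2 a = i.+2 :> nat by case: aA => ->.
    by move/(ok_nest oD) => H; rewrite ltnS ltnW // -D2' H //; apply/nesym.
  + move=> ins_a; have : ins D.1 c u0.
      rewrite -(ok_cross oD) -/p; try exact: nesym.
      by case: aB ins_a => -> //; rewrite ins_lo // ins_hi // -(ok_cross oD) //; apply/nesym.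
    have -> : unfold.2 a = D.2 u0 :> nat by case: aB => ->.
    by apply: (ok_nest oD); apply/nesym.
Qed.

Lemma level_unfold : level n unfold.
Proof.
move=> j; rewrite leq_eqVlt => /predU1P[nj|jn].
  have -> : j = hi i by apply: val_inj; rewrite /= -nj n_i.
  by rewrite -/(rhi i) Ehi Lhi.
have hj : high (inr j) by rewrite /high /=.
have [E1 E2] := lD jn; have [j0 j1 j2 j3] := high_low hj.
by case: (unfoldP (inr j)).
Qed.

Lemma rmul_unfold : rmul unfold i = D.
Proof.
have mU := unfold_matching.
have pE : ~~ inpair i p by rewrite /inpair; apply/norP; split; apply/eqP.
have iu0 : ~~ inpair i u0 by [].
apply: labelled_eq => v.
  case: (unfold_classP v) => [[]->|[]->|[v0 v1 v2 v3] [v4 v5 v6 v7] vE _].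
  - by rewrite rmul_thru1 ?E0 ?inpair_hi // swap_hi Elo.
  - by rewrite rmul_pair1 ?inpair_hi // swap_hi D1'.
  - by rewrite rmul_thru1 ?Ep ?inpair_lo // swap_lo Ehi Dp.
  - by rewrite rmul_pair1 ?inpair_lo // swap_lo D1.
  - by rewrite rmul_far1 // ?vE //; rewrite /inpair; apply/norP; split; apply/eqP.
have lu := unfold_label_le.
case: (unfold_classP v) => [[]->|[]->|[v0 v1 v2 v3] [v4 v5 v6 v7] vE vL].
- rewrite rmul_thru2 ?E0 ?inpair_hi // swap_hi Llo L0.
  by apply/minn_idPr; lia.
- by rewrite rmul_pair2 ?inpair_hi // D2'.
- rewrite rmul_thru2 ?Ep ?inpair_lo // swap_lo Lhi Lp [in RHS]/p Ds.
  by apply/minn_idPl; lia.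
- by rewrite rmul_pair2 ?inpair_lo // D2.
- by rewrite rmul_far2 // ?vE //; rewrite /inpair; apply/norP; split; apply/eqP.
Qed.

End Unfold.

(** * Normal words and diagrams *)

Section NormalDiagrams.
Variable N : nat.
Implicit Types (L C D : labelled N) (u v w a c : node N) (i j : 'I_N.-1).

Lemma level_rmul n L i : okada L -> (i < n)%N -> level n.+1 L -> level n.+1 (rmul L i).
Proof.
move=> oL lt_n lL k nk; have [E1 E2] := lL k nk; have mL := okada_matching oL.
have iE : ~~ inpair i (inr k).
  rewrite /inpair !node_eqE pos_rlo pos_rhi /=.
  by have := ltn_ord k; have := ltn_ord i; lia.
by rewrite rmul_far1 ?rmul_far2 // E1.
Qed.

Lemma wl_rcons s i : wl (rcons s i) = rmul (wl s) i.
Proof. by rewrite /wl -cats1 foldl_cat. Qed.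

(** A label i + 2 at height i + 3 has the wrong parity unless the other end has height i + 2. That
    end would be [rhi i], already matched, or its opposite, excluded by the parity of positions. *)
Lemma label_gap L i j : okada L -> j = i.+1 :> nat -> L.1 (rlo i) = rhi i ->
  L.2 (rhi j) <> i.+2 :> nat.
Proof.
move=> oL ji E1 E2; have [Ln LK Ls] := okada_matching oL.
have hl := rhi_rlo ji.
have par := okada_parity oL (rhi j).
have := ok_odd oL (rhi j); rewrite -(odd_min_absn par) E2 /= ji.
have : (i.+2 <= absn (L.1 (rhi j)))%N by rewrite -E2 -Ls; apply: ok_le.
rewrite leq_eqVlt => /predU1P[E _|lt]; last by rewrite (minn_idPl lt) /= negbK; case: odd.
have /absn_eq[E'|E'] : absn (L.1 (rhi j)) = absn (rhi i) by rewrite -E.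
  by have /eqP := congr1 L.1 E'; rewrite LK -E1 LK node_eqE pos_rlo pos_rhi; have := ltn_ord j; have := ltn_ord i; lia.
move: par; rewrite E' pos_rhi /= oddB ?odd_double //; last by have := ltn_ord j; lia.
by rewrite ji /=; case: odd.
Qed.

(** Outer induction on the height n above which L is the identity: the strand at the top is
    straight, or a small right arc exists. The inner induction, on the distance from that arc to the
    top, moves it outwards until [unfold] applies. *)
Lemma wl_surj L : okada L -> exists s, L = wl s.
Proof.
move=> oL; suff H n : (n <= N)%N -> forall L', okada L' -> level n L' -> exists s, L' = wl s.
  exact: (H N (leqnn _) L oL (level_top L)).
elim: n => [_ L' oL' /(level0 oL') ->|n IHn nN {}L {}oL lL]; first by exists [::].
have IH L' := IHn (ltnW nN) L'.
pose nn : 'I_N := Ordinal nN.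
suff Q d : forall i L', (n - i <= d)%N -> (i < n)%N -> okada L' -> level n.+1 L' ->
    L'.1 (rlo i) = rhi i -> L'.2 (rlo i) = i.+1 :> nat -> exists s, L' = wl s.
  have [E|E] := eqVneq (L.2 (inr nn) : nat) n.+1.
    by apply: IH => //; apply: (@level_pred _ L nn).
  have N0 : (0 < N)%N by lia.
  pose z : 'I_N := Ordinal N0.
  have z1 : L.2 (inr z) = z.+1 :> nat.
    by have := ok_pos oL (inr z); have := ok_le oL (inr z); rewrite /=; lia.
  have [i [/andP[_ lt_in] E1 E2]] := exists_small_arc oL (leq0n nn : (z <= nn)%N) z1 (elimN eqP E).
  exact: (Q n i L (leq_subr _ _)).
elim: d => [|d IHd] i L' di lt_in oL' lL' E1 E2; first by lia.
have [ni|ni] := eqVneq n i.+1.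
  have [s sE] := IH _ (unfold_okada oL' lL' ni E1 E2) (level_unfold oL' lL' ni E1 E2).
  by exists (rcons s i); rewrite wl_rcons -sE (rmul_unfold oL' lL' ni E1 E2).
have lt_j : (i.+1 < N.-1)%N by lia.
pose j : 'I_N.-1 := Ordinal lt_j.
(* A low label lets G_(j+1) move the arc outwards, reversibly by [rmul_braidV]. Otherwise
   [label_gap] makes the label maximal, and a small arc further out is taken instead, unless the top
   strand is already straight. *)
have [le|gt] := leqP (L'.2 (rhi j)) i.+1.
  have oR := rmul_okada j oL'.
  have [s sE] : exists s, rmul L' j = wl s.
    apply: (IHd j) => //.
    - by rewrite /=; lia.
    - by rewrite /=; lia.
    - by apply: level_rmul => //=; lia.
    - by rewrite rmul_pair1 ?inpair_lo // swap_lo.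
    - by rewrite rmul_pair2 ?inpair_lo.
  by exists (rcons s i); rewrite wl_rcons -sE (@rmul_braidV _ L' i j).
have E3 : L'.2 (inr (hi j)) = (hi j).+1 :> nat.
  have := ok_le oL' (rhi j); have := @label_gap L' i j oL' erefl E1.
  by rewrite /rhi /= in gt *; lia.
have [E|E] := eqVneq (L'.2 (inr nn) : nat) n.+1.
  by apply: IH => //; apply: (@level_pred _ L' nn).
have jn : (hi j <= nn)%N by rewrite /=; lia.
have [i' [/andP[ji' i'n] F1 F2]] := exists_small_arc oL' jn E3 (elimN eqP E).
by apply: (IHd i') => //; move: ji'; rewrite /=; lia.
Qed.

Definition rmuln L (k : nat) : labelled N := if insub k is Some i then rmul L i else L.

Lemma rmulnE L i : rmuln L i = rmul L i.
Proof. by rewrite /rmuln valK. Qed.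

Definition wn (s : seq nat) : labelled N := foldl rmuln (unit_labelled N) s.

Lemma rmuln_okada L k : okada L -> okada (rmuln L k).
Proof. by rewrite /rmuln; case: insub => // i; apply: rmul_okada. Qed.

Lemma foldl_rmuln_okada L s : okada L -> okada (foldl rmuln L s).
Proof. by elim: s L => //= k s IH L oL; apply/IH/rmuln_okada. Qed.

Lemma wn_okada s : okada (wn s).
Proof. exact/foldl_rmuln_okada/okadaP/unit_okada. Qed.

Lemma wn_level n s : all (fun k => k < n)%N s -> level n.+1 (wn s).
Proof.
elim/last_ind: s => [_ k _|s k IH].
  by rewrite unitE1 unitE2.
rewrite all_rcons => /andP[kn /IH lv]; rewrite /wn -cats1 foldl_cat /=.
rewrite {1}/rmuln; case: insubP => [i _ iE|_]; last exact: lv.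
by apply: level_rmul => //; [apply: wn_okada | rewrite iE].
Qed.

(** Multiplication by G_(i+1) can be undone here: the strand of L at [rlo i] is joined to the
    straight strand of height i + 2, of larger label, so its other end and its label reappear at
    [inl (hi i)]. *)
Lemma rmul_top L i : okada L -> level i.+1 L -> forall v,
  [/\ L.1 v = (if v == rhi i then inl (hi i) else if v == inl (hi i) then rhi i
               else if v == rlo i then (rmul L i).1 (inl (hi i))
               else if (rmul L i).1 v == inl (hi i) then rlo i
               else (rmul L i).1 v)
    & L.2 v = (if (v == rhi i) || (v == inl (hi i)) then i.+2
               else if v == rlo i then (rmul L i).2 (inl (hi i)) : nat
               else (rmul L i).2 v : nat) :> nat].
Proof.
move=> oL lL v; have mL := okada_matching oL; have [Ln LK Ls] := mL.
have [E1 E2] := lL (hi i) (leqnn _); rewrite -/(rhi i) in E1 E2.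
have E1' : L.1 (inl (hi i)) = rhi i by rewrite -E1 LK.
have E2' : L.2 (inl (hi i)) = i.+2 :> nat by rewrite -E1 Ls.
have lo_le := ok_le oL (rlo i); rewrite /= in lo_le.
have [->|vhi] := eqVneq v (rhi i); first by rewrite E1 E2.
have [->|vu] := eqVneq v (inl (hi i)); first by rewrite E1' E2'.
rewrite (@rmul_thru1 _ L i (inl (hi i))) ?E1' ?inpair_hi // swap_hi.
rewrite (@rmul_thru2 _ L i (inl (hi i))) ?E1' ?inpair_hi // swap_hi E2'.
have [->|vlo] := eqVneq v (rlo i); first by split=> //; rewrite (minn_idPr _) //; lia.
have iv : ~~ inpair i v by rewrite /inpair negb_or vlo vhi.
have [im|im] := boolP (inpair i (L.1 v)); last first.
  rewrite rmul_far1 // rmul_far2 //; case: eqP => // E; move: vhi.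
  by rewrite -(LK v) E E1' eqxx.
have [E|E] := inpairP im.
  rewrite rmul_thru1 // rmul_thru2 // E swap_lo E1 eqxx E2; split=> //.
  by apply/esym/minn_idPl; rewrite -(Ls v) E; apply: leqW.
by move: vu; rewrite -(LK v) E E1 eqxx.
Qed.

Lemma rmul_top_inj L L' i : okada L -> okada L' -> level i.+1 L -> level i.+1 L' ->
  rmul L i = rmul L' i -> L = L'.
Proof.
move=> oL oL' lL lL' E; apply: labelled_eq => v;
  have [H1 H2] := rmul_top oL lL v; have [H1' H2'] := rmul_top oL' lL' v.
  by rewrite H1 H1' E.
by rewrite H2 H2' E.
Qed.

Definition run n L k := foldl rmuln L (dn (n.+1 - k) k).

Lemma run_S n L k i : i = n - k :> nat -> (k <= n)%N -> run n L k.+1 = rmul (run n L k) i.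
Proof.
move=> iE kn; rewrite /run dnS -cats1 foldl_cat /= subSS -iE rmulnE.
by rewrite iE (_ : (n - k).+1 = n.+1 - k)%N; last lia.
Qed.

(** This recovers the length k: among the right nodes of index at most n + 1, [n.+1 - k] is the last
    one with maximal label. Each new letter gives its lower node a maximal label and its upper node
    a label one too small. *)
Lemma run_label n L k : (n.+1 < N)%N -> okada L -> level n.+1 L -> (k <= n.+1)%N ->
  forall j : 'I_N, (j <= n.+1)%N ->
  (j = n.+1 - k :> nat -> (run n L k).2 (inr j) = j.+1 :> nat) /\
  (n.+1 - k < j -> (run n L k).2 (inr j) <= j)%N.
Proof.
move=> nN oL lL; elim: k => [|k IH] kn j jn.
  rewrite subn0; split; last by move=> ?; lia.
  by move=> jE; case: (lL j) => //; rewrite jE.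
have lt_i : (n - k < N.-1)%N by lia.
pose i : 'I_N.-1 := Ordinal lt_i.
rewrite (@run_S n L k i) //; have mR : matching (run n L k).
  exact/okada_matching/foldl_rmuln_okada.
have [ij|ij] := boolP (inpair i (inr j)).
  rewrite rmul_pair2 //; case/orP: ij => /eqP -[->] /=; lia.
have jE : (j != n - k :> nat) && (j != (n - k).+1 :> nat).
  by move: ij; rewrite /inpair negb_or => /andP[+ +]; rewrite !node_eqE /=; lia.
split=> [?|lt]; first by lia.
have [_ IH2] := IH (ltnW kn) j jn.
rewrite rmulE2 /rmul_label (negPf ij) geq_min IH2 //; lia.
Qed.

(** A run of at least two letters loses its last one when multiplied by the letter before it, by the
    braid relation; a single letter is cancelled by [rmul_top_inj]. *)
Lemma run_inj n L L' k : (n.+1 < N)%N -> okada L -> okada L' ->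
  level n.+1 L -> level n.+1 L' -> (k <= n.+1)%N ->
  run n L k = run n L' k -> L = L'.
Proof.
move=> nN oL oL' lL lL'; elim: k => [//|[|k] IH] kn.
  have lt_i : (n < N.-1)%N by lia.
  rewrite !(@run_S n _ 0 (Ordinal lt_i)) ?subn0 //.
  exact: rmul_top_inj.
have lt_i : (n - k.+1 < N.-1)%N by lia.
have lt_j : (n - k < N.-1)%N by lia.
pose i : 'I_N.-1 := Ordinal lt_i; pose j : 'I_N.-1 := Ordinal lt_j.
have kn' : (k <= n)%N by lia.
have ji : j = i.+1 :> nat by rewrite /=; lia.
have H X : okada X -> rmul (rmul (run n X k.+1) i) j = run n X k.+1.
  rewrite (@run_S n X k j) // => oX.
  have : okada (run n X k) by apply: foldl_rmuln_okada.
  move: (run n X k) => R oR.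
  apply: rmul_braid => //; first exact: rmul_okada.
    by rewrite rmul_pair1 ?inpair_lo // swap_lo.
  by rewrite rmul_pair2 ?inpair_lo.
rewrite !(@run_S n _ k.+1 i) // => /(congr1 (fun X => rmul X j)).
by rewrite (H L oL) (H L' oL'); apply: IH; exact: ltnW.
Qed.

Lemma wn_nword_inj n : (n < N)%N -> injective (fun c : code n => wn (nword c)).
Proof.
elim: n => [|n IH] nN; first by case=> -[].
move=> [c k] [c' k']; rewrite ![nword _]/= /wn !foldl_cat.
rewrite -!/(wn _) -!/(run n _ _) => E.
have [oc oc'] := (wn_okada (nword c), wn_okada (nword c')).
have lc := wn_level (nword_lt c); have lc' := wn_level (nword_lt c').
have kn : (k <= n.+1)%N by rewrite -ltnS. have kn' : (k' <= n.+1)%N by rewrite -ltnS.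
have neq (l l' : nat) (X X' : labelled N) : okada X -> level n.+1 X -> okada X' -> level n.+1 X' ->
    (l < l')%N -> (l' <= n.+1)%N -> run n X l <> run n X' l'.
  move=> oX lX oX' lX' ll ln F.
  have bN : (n.+1 - l < N)%N by lia.
  have bn : (Ordinal bN <= n.+1)%N by rewrite /= leq_subr.
  have [|H _] := run_label nN oX lX (k := l) _ bn; first by lia.
  have [|_ H'] := run_label nN oX' lX' (k := l') _ bn; first by lia.
  have := H' _; rewrite -F H //= ltnn => /(_ _); lia.
have kk : k = k'.
  apply: val_inj; case: (ltngtP k k') => [lt|lt|//].
    by case: (neq k k' _ _ oc lc oc' lc' lt kn' E).
  by case: (neq k' k _ _ oc' lc' oc lc lt kn (esym E)).
rewrite -kk in E *; have := run_inj nN oc oc' lc lc' kn E.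
by move/(IH (ltnW nN)) => ->.
Qed.

End NormalDiagrams.

(** * The monoid of diagrams and its relations *)

Section Monoid.
Variable N : nat.
Implicit Types (C D E : diagram N) (i j : 'I_N.-1).

(** As D is a product of elementary diagrams, composing with it is a succession of [rmul], each
    preserving Okada diagrams. Hence the default value in [comp] is never taken. *)
Lemma val_comp C D : val (Defs.comp C D) = comp_labelled C D.
Proof.
rewrite /Defs.comp insubdK // unfold_in; apply/okadaP.
have [s ->] := wl_surj (diagram_okada D).
by rewrite comp_labelled_wl; [apply: foldl_rmul_okada|]; apply: diagram_okada.
Qed.

Lemma compA : associative (@Defs.comp N).
Proof.
move=> C D E; apply: val_inj; rewrite !val_comp comp_labelledA //;
  exact/okada_matching/diagram_okada.
Qed.

Lemma compm1 : right_id (unit_diagram N) (@Defs.comp N).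
Proof.
by move=> C; apply: val_inj; rewrite val_comp comp_labelledr1 //; apply: diagram_okada.
Qed.

Lemma comp1m : left_id (unit_diagram N) (@Defs.comp N).
Proof.
move=> C; apply: val_inj; rewrite val_comp.
have [s sE] := wl_surj (diagram_okada C).
rewrite -[RHS]/(diag C) sE comp_labelled_wl //.
exact: (diagram_okada (unit_diagram N)).
Qed.

HB.instance Definition _ :=
  Monoid.isLaw.Build (diagram N) (unit_diagram N) (@Defs.comp N) compA comp1m compm1.

Lemma word_diagram_cat s t :
  word_diagram (s ++ t) = Defs.comp (word_diagram s) (word_diagram t) :> diagram N.
Proof. exact: big_cat. Qed.

Lemma val_word_diagram (s : seq 'I_N.-1) : val (word_diagram s) = wl s.
Proof.
elim/last_ind: s => [|s i IH]; first by rewrite /word_diagram big_nil.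
rewrite -cats1 word_diagram_cat val_comp /word_diagram big_seq1 -/(word_diagram s).
by rewrite IH cats1 wl_rcons rmulE //; apply: wl_okada.
Qed.

(* The letter k stands for G_{k+1}; letters out of range are dropped. *)
Definition wd (s : seq nat) : diagram N := word_diagram (pmap insub s).

Lemma wd_cat s t : wd (s ++ t) = Defs.comp (wd s) (wd t).
Proof. by rewrite /wd pmap_cat word_diagram_cat. Qed.

Lemma val_wd s : val (wd s) = wn N s.
Proof.
rewrite val_word_diagram /wl /wn; elim: s (unit_labelled N) => //= k s IH L.
by rewrite /oapp /rmuln; case: insub => [i|] /=; apply: IH.
Qed.

Lemma wd_map (s : seq 'I_N.-1) : wd (map val s) = word_diagram s.
Proof.
by congr word_diagram; elim: s => //= i s IH; rewrite valK /= IH.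
Qed.

Lemma wd_surj D : exists2 s, all (fun k => k < N.-1)%N s & D = wd s.
Proof.
have [s sE] := wl_surj (diagram_okada D); exists (map val s).
  by rewrite all_map; apply/allP => i _ /=.
by apply: val_inj; rewrite wd_map val_word_diagram.
Qed.

Lemma wd_nword_inj : (0 < N)%N -> injective (fun c : code N.-1 => wd (nword c)).
Proof.
move=> N0 c c' /(congr1 val); rewrite !val_wd; apply: wn_nword_inj.
by rewrite prednK.
Qed.

Lemma elem_diagram_square i : Defs.comp (elem_diagram i) (elem_diagram i) = elem_diagram i.
Proof.
have oG := okadaP _ (elem_okada i).
apply: val_inj; rewrite val_comp rmulE // rmul_id //.
  by rewrite elemE1 /= eqxx.
by rewrite elemE2 elem_labelE /touches inpair_lo.
Qed.

Lemma elem_diagram_far i j : far i j ->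
  Defs.comp (elem_diagram i) (elem_diagram j) = Defs.comp (elem_diagram j) (elem_diagram i).
Proof.
have [oi oj] := (okadaP _ (elem_okada i), okadaP _ (elem_okada j)).
move=> ij; apply: val_inj; rewrite 2!val_comp (rmulE _ oi) (rmulE _ oj).
exact: rmul_elem_far.
Qed.

Lemma elem_diagram_braid i j : j = i.+1 :> nat ->
  Defs.comp (Defs.comp (elem_diagram j) (elem_diagram i)) (elem_diagram j) = elem_diagram j.
Proof.
move=> ji; have oj := okadaP _ (elem_okada j).
apply: val_inj; rewrite !val_comp !rmulE //; last exact: rmul_okada.
rewrite rmul_braid // ?elemE1 ?elemE2 ?elem_labelE /touches ?inpair_lo //.
by rewrite /= eqxx.
Qed.

(** Letters out of range become the unit, which is harmless in squares and commutations. A braid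
    with only [i.+1] out of range would break, hence the bound in [weq_braid]. *)
Lemma wd_weq (K : comNzRingType) (x y : nat -> K) s c t :
  weq x y N.-1 s c t -> wd s = wd t.
Proof.
have cat3 (a s' t' b : seq nat) : wd s' = wd t' -> wd (a ++ s' ++ b) = wd (a ++ t' ++ b).
  by move=> E; rewrite (wd_cat a) (wd_cat s') E -(wd_cat t') -(wd_cat a).
have wd1 (i : 'I_N.-1) : wd [:: val i] = elem_diagram i.
  by rewrite -[[:: _]]/(map val [:: i]) wd_map /word_diagram big_seq1.
have wd2 (k l : nat) : wd [:: k; l] = Defs.comp (wd [:: k]) (wd [:: l]).
  exact: (wd_cat [:: k]).
have wd_out k : (N.-1 <= k)%N -> wd [:: k] = unit_diagram N.
  by move=> Nk; rewrite /wd /= insubN -?leqNgt // /word_diagram big_nil.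
elim=> {s c t} //.
- by move=> s c t d u _ -> _ ->.
- move=> a b k; apply: cat3; rewrite wd2; have [/wd_out ->|kN] := leqP N.-1 k.
    exact: compm1.
  by rewrite (wd1 (Ordinal kN)) elem_diagram_square.
- move=> a b k l kl; apply: cat3; rewrite !wd2.
  have [/wd_out ->|kN] := leqP N.-1 k; first by rewrite compm1 comp1m.
  have [/wd_out ->|lN] := leqP N.-1 l; first by rewrite compm1 comp1m.
  by rewrite (wd1 (Ordinal kN)) (wd1 (Ordinal lN)); apply: elem_diagram_far.
- move=> a b k kN; apply: cat3; rewrite (wd_cat [:: k.+1; k]) wd2.
  rewrite (wd1 (Ordinal kN)) (wd1 (Ordinal (ltnW kN))).
  exact: elem_diagram_braid.
Qed.

End Monoid.

(** * The isomorphism *)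

Local Open Scope ring_scope.

Section NormalWords.
Variables (N : nat) (K : fieldType) (X : (N.-1).-tuple K) (Y : (N.-2).-tuple K).
Hypothesis N_gt0 : (0 < N)%N.
Implicit Types (C D : diagram N) (s t : seq nat).

Notation weqN := (weq (xs X) (ys Y) N.-1).
Notation coefN := (coef (xs X) (ys Y) N.-1).
Notation letters := (all (fun k => k < N.-1)%N).

Lemma reduces_word s : letters s -> exists c (q : code N.-1), weqN s c (nword q).
Proof.
move=> /word_diamond[P [dP rP]]; have [c [Q [red nQ]]] := exists_normal X Y dP.
have [dQ W] := reducesP dP red; have [q qE] := normal_word dQ nQ.
by exists c, q; rewrite -qE (_ : s = word P) // /word rP -map_comp map_id.
Qed.

Lemma wd_nword_surj D : exists c : code N.-1, wd N (nword c) = D.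
Proof.
have [s sN ->] := wd_surj D; have [c [q W]] := reduces_word sN.
by exists q; rewrite (wd_weq W).
Qed.

Definition nf D : seq nat :=
  if [pick c : code N.-1 | wd N (nword c) == D] is Some c then nword c else [::].

Lemma nfP D : exists2 c : code N.-1, nf D = nword c & wd N (nword c) = D.
Proof.
rewrite /nf; case: pickP => [c /eqP|none]; first by exists c.
by have [c /eqP] := wd_nword_surj D; rewrite none.
Qed.

Lemma wd_nf D : wd N (nf D) = D.
Proof. by have [c ->] := nfP D. Qed.

Lemma nf_wd (c : code N.-1) : nf (wd N (nword c)) = nword c.
Proof. by have [c' -> /(wd_nword_inj N_gt0) ->] := nfP (wd N (nword c)). Qed.

Lemma letters_nf D : letters (nf D).
Proof. by have [c -> _] := nfP D; apply: nword_lt. Qed.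

Lemma coef_nf D : coefN (nf D) = 1.
Proof. by have [c -> _] := nfP D; apply: coef_nword. Qed.

Lemma weq_nf s : letters s -> weqN s (coefN s) (nf (wd N s)).
Proof.
move=> /reduces_word[c [q W]].
by rewrite (wd_weq W) nf_wd (coef_weq N.-1 W) coef_nword mulr1.
Qed.

Lemma card_diagram : #|{: diagram N}| = N`!.
Proof.
rewrite -[in RHS](prednK N_gt0) -card_code; apply/esym.
have /choice[g gK] := wd_nword_surj.
apply: (@bij_eq_card _ _ (fun c => wd N (nword c))); exists g => // c.
by apply: wd_nword_inj => //; rewrite gK.
Qed.

Lemma map_val_insub s : letters s -> map val (pmap insub s : seq 'I_N.-1) = s.
Proof. by elim: s => //= k s IH /andP[kN sN]; rewrite insubT /= IH. Qed.

Lemma represents_word P C : diamond N P -> represents P C <-> wd N (word P) = C.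
Proof.
move=> dP; split=> [[s rP ->]|<-].
  by rewrite -wd_map /word rP -map_comp.
exists (pmap insub (word P)) => //.
by rewrite (reading_word dP) -{1}(map_val_insub (word_lt dP)) -map_comp.
Qed.

Lemma is_weightP C D c : is_weight X Y C D c -> c = coefN (nf C ++ nf D).
Proof.
case=> PC [PD [P [Q [[dC nC rC] [dD nD rD] [dP rP] red nQ]]]].
have H PE E : diamond N PE -> normal X Y PE -> represents PE E -> word PE = nf E.
  move=> dE nE /(represents_word _ dE) <-.
  by have [q ->] := normal_word dE nE; rewrite nf_wd.
have [dQ W] := reducesP dP red.
have [q qE] := normal_word dQ nQ; rewrite qE in W.
rewrite -(H _ _ dC nC rC) -(H _ _ dD nD rD) -map_cat -rP.
by rewrite (coef_weq N.-1 W) coef_nword mulr1.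
Qed.

Lemma exists_normal_form D : exists P, normal_form_of X Y D P.
Proof.
have [P [dP rP]] := word_diamond (letters_nf D).
have [c [Q [red nQ]]] := exists_normal X Y dP; have [dQ W] := reducesP dP red.
exists Q; split=> //; apply/represents_word => //.
by rewrite -(wd_weq W) /word rP -map_comp map_id wd_nf.
Qed.

(** All choices of diamond diagrams and moves give this value, by [is_weightP]; exhibiting one
    choice keeps [xget] off its default. *)
Lemma weightE C D : weight X Y C D = coefN (nf C ++ nf D).
Proof.
apply: is_weightP; rewrite /weight; apply: (@xgetPex _ 0 [set c | is_weight X Y C D c]%classic).
have [PC nC] := exists_normal_form C; have [PD nD] := exists_normal_form D.
have [[dC _ _] [dD _ _]] := (nC, nD).
have [|P [dP rP]] := @word_diamond N (word PC ++ word PD).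
  by rewrite all_cat !word_lt.
have [c [Q [red nQ]]] := exists_normal X Y dP.
exists c, PC, PD, P, Q; split=> //; split=> //.
by rewrite rP map_cat -!(@reading_word N).
Qed.

End NormalWords.

(** * The two inverse maps between the Okada algebra and the diagram space *)

Section Isomorphism.
Variables (N : nat) (K : fieldType) (X : (N.-1).-tuple K) (Y : (N.-2).-tuple K).
Hypothesis N_gt0 : (0 < N)%N.
Implicit Types (C D : diagram N) (s t : seq nat).

Notation weqN := (weq (xs X) (ys Y) N.-1).
Notation coefN := (coef (xs X) (ys Y) N.-1).
Notation letters := (all (fun k => k < N.-1)%N).
Notation free_alg := {malg K[{fmonom 'I_N.-1}]}.
Notation algebra := (okada_algebra X Y).
Notation space := (diagram_space N K).

(** The value 0 out of range satisfies the square rule whatever the parameter is. *)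
Definition letter_gen (k : nat) : algebra := oapp (okada_gen X Y) 0 (insub k).
Definition eval s : algebra := \prod_(k <- s) letter_gen k.

Lemma letter_genE (i : 'I_N.-1) : letter_gen i = okada_gen X Y i.
Proof. by rewrite /letter_gen valK. Qed.

Lemma letter_gen_out k : (N.-1 <= k)%N -> letter_gen k = 0.
Proof. by move=> Nk; rewrite /letter_gen insubN // -leqNgt. Qed.

Lemma eval_cat s t : eval (s ++ t) = eval s * eval t.
Proof. exact: big_cat. Qed.

Lemma okada_piMr (u v : free_alg) :
  okada_pi X Y u * okada_pi X Y v = okada_pi X Y (u * v).
Proof. by rewrite okada_piM. Qed.

Lemma okada_piZr (k : K) (u : free_alg) : k *: okada_pi X Y u = okada_pi X Y (k *: u).
Proof. by rewrite okada_piZ. Qed.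

Lemma relatorE u v : okada_relator X Y (u - v) -> okada_pi X Y u = okada_pi X Y v.
Proof. by move=> r; apply/okada_piP/asboolP/ideal_relator. Qed.

Lemma eval_weq s c t : weqN s c t -> eval s = c *: eval t.
Proof.
have ev2 k l : eval [:: k; l] = letter_gen k * letter_gen l.
  by rewrite /eval !big_cons big_nil mulr1.
have ev1 k : eval [:: k] = letter_gen k by rewrite /eval big_seq1.
have cat3 a b c' s' t' : eval s' = c' *: eval t' ->
    eval (a ++ s' ++ b) = c' *: eval (a ++ t' ++ b).
  by move=> E; rewrite !eval_cat E [in RHS]scalerAr scalerAl.
elim=> {s c t}.
- by move=> s; rewrite scale1r.
- by move=> s c t d u _ -> _ ->; rewrite scalerA.
- move=> a b k; apply: cat3; rewrite ev2 ev1.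
  have [/letter_gen_out ->|kN] := leqP N.-1 k; first by rewrite mul0r scaler0.
  rewrite (letter_genE (Ordinal kN)) -[LHS]okada_piM -[RHS]okada_piZ.
  by apply: relatorE; apply: (relator_square X Y (Ordinal kN)).
- move=> a b k l kl; apply: cat3; rewrite !ev2 scale1r.
  have [/letter_gen_out ->|kN] := leqP N.-1 k; first by rewrite mul0r mulr0.
  have [/letter_gen_out ->|lN] := leqP N.-1 l; first by rewrite mul0r mulr0.
  rewrite (letter_genE (Ordinal kN)) (letter_genE (Ordinal lN)).
  rewrite -[LHS]okada_piM -[RHS]okada_piM.
  exact/relatorE/relator_comm.
- move=> a b k kN; apply: cat3.
  rewrite -[[:: _; _; _]]/([:: k.+1; k] ++ [:: k.+1]) eval_cat ev2 !ev1.
  rewrite (letter_genE (Ordinal kN)) (letter_genE (Ordinal (ltnW kN))).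
  rewrite /okada_gen !okada_piMr okada_piZr.
  exact/relatorE/relator_braid.
Qed.

Definition wseq (m : {fmonom 'I_N.-1}) : seq nat := map val (m : seq 'I_N.-1).

Lemma wseq_letters m : letters (wseq m).
Proof. by rewrite all_map; apply/allP => i _ /=. Qed.

Lemma wseqM m1 m2 : wseq (mmul m1 m2) = wseq m1 ++ wseq m2.
Proof. by rewrite /wseq fmM map_cat. Qed.

Lemma wseqU i : wseq (fmu i) = [:: val i].
Proof. by rewrite /wseq fmU. Qed.

Lemma malgUM (c d : K) (m1 m2 : {fmonom 'I_N.-1}) :
  << c *g m1 >> * << d *g m2 >> = << c * d *g mmul m1 m2 >> :> free_alg.
Proof. by rewrite malgM_def fgmulUU. Qed.

Lemma okada_piU (m : {fmonom 'I_N.-1}) : okada_pi X Y << m >> = eval (wseq m).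
Proof.
have -> : m = FMonom m by rewrite fmK.
elim: (m : seq _) => [|i s IH].
  rewrite /eval /wseq big_nil; congr (okada_pi X Y << _ >>).
  by apply: val_inj; rewrite -[RHS]/(fmonom_val _) fm1.
have -> : FMonom (i :: s) = mmul (fmu i) (FMonom s).
  by apply: val_inj; rewrite -[RHS]/(fmonom_val _) fmM fmU.
rewrite wseqM wseqU eval_cat -IH -{1}(mulr1 1) -malgUM -okada_piMr.
by congr (_ * _); rewrite /eval big_seq1 letter_genE.
Qed.

Lemma malgUZ (c : K) (m : {fmonom 'I_N.-1}) : c *: << m >> = << c *g m >> :> free_alg.
Proof. by rewrite -mul_malgC malgUM mulr1 mul1m. Qed.

Lemma free_alg_ind (P : free_alg -> Prop) : P 0 ->
  (forall c m w, P w -> P (<< c *g m >> + w)) -> forall u, P u.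
Proof.
move=> P0 PD u; rewrite [u]monalgE.
by elim: (msupp u : seq _) => [|m r IH]; rewrite ?big_nil ?big_cons //; apply: PD.
Qed.

Lemma okada_pi0 : okada_pi X Y 0 = 0.
Proof. by rewrite -(scale0r (0 : free_alg)) -okada_piZr scale0r. Qed.

Lemma linear_ext (V : lmodType K) (f g : algebra -> V) : linear f -> linear g ->
  (forall s, letters s -> f (eval s) = g (eval s)) -> f =1 g.
Proof.
move=> lf lg fg a; have [u ->] := okada_pi_surj a.
have l0 (h : algebra -> V) : linear h -> h 0 = 0.
  by move=> lh; have := lh (-1) 0 0; rewrite scaler0 addr0 scaleN1r addNr.
elim/free_alg_ind: u => [|c m w IH]; first by rewrite okada_pi0 !l0.
have -> : okada_pi X Y (<< c *g m >> + w) =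
    c *: eval (wseq m) + okada_pi X Y w.
  by rewrite okada_piD -(malgUZ c) -okada_piZr okada_piU.
rewrite (lf c) (lg c) IH.
by rewrite (fg (wseq m) (wseq_letters m)).
Qed.

Definition vecw s : space := coefN s *: diagram_vect K (wd N s).

Lemma vecw_weq s c t : weqN s c t -> vecw s = c *: vecw t.
Proof.
by move=> W; rewrite /vecw (wd_weq W) (coef_weq N.-1 W) scalerA.
Qed.

Lemma vecw_nf D : vecw (nf D) = diagram_vect K D.
Proof. by rewrite /vecw coef_nf (wd_nf X Y) scale1r. Qed.

(** [mmap] takes its values in a ring, so the linear extension is made coordinate by coordinate. *)
Definition theta_free (u : free_alg) : space :=
  [ffun D => mmap idfun (fun m => vecw (wseq m) D) u].

Lemma theta_freeD u v : theta_free (u + v) = theta_free u + theta_free v.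
Proof. by apply/ffunP => D; rewrite !ffunE mmapD. Qed.

Lemma theta_freeZ c u : theta_free (c *: u) = c *: theta_free u.
Proof.
apply/ffunP => D; rewrite !ffunE (mmapEw (msuppZ_le _ _)) mmapE scaler_sumr.
by apply: eq_bigr => m _; rewrite /= mcoeffZ -mulrA.
Qed.

Lemma theta_freeB u v : theta_free (u - v) = theta_free u - theta_free v.
Proof. by apply/ffunP => D; rewrite !ffunE mmapB. Qed.

Lemma theta_freeU c m : theta_free << c *g m >> = c *: vecw (wseq m).
Proof. by apply/ffunP => D; rewrite !ffunE mmapU !ffunE. Qed.

Lemma theta_free0 : theta_free 0 = 0.
Proof. by rewrite -(scale0r (0 : free_alg)) theta_freeZ scale0r. Qed.

Lemma relator_weq u : okada_relator X Y u ->
  exists m1 m2 c, weqN (wseq m1) c (wseq m2) /\ u = << m1 >> - << c *g m2 >>.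
Proof.
case=> [i|i j ij|i j ji].
- exists (mmul (fmu i) (fmu i)), (fmu i), (xs X i).
  rewrite wseqM wseqU /gen malgUM mulr1 malgUZ; split=> //.
  exact: (@weq_square _ _ _ _ [::] [::] i).
- exists (mmul (fmu i) (fmu j)), (mmul (fmu j) (fmu i)), 1.
  rewrite !wseqM !wseqU /gen !malgUM mulr1; split=> //.
  exact: (@weq_comm _ _ _ _ [::] [::] i j).
- exists (mmul (mmul (fmu j) (fmu i)) (fmu j)), (fmu j), (ys Y i).
  rewrite !wseqM !wseqU /gen !malgUM !mulr1 malgUZ; split=> //.
  rewrite /= ji; apply: (@weq_braid _ _ _ _ [::] [::] i).
  by rewrite -ji ltn_ord.
Qed.

Lemma theta_free_add0 u v : theta_free u = 0 -> theta_free v = 0 ->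
  theta_free (u + v) = 0.
Proof. by move=> u0 v0; rewrite theta_freeD u0 v0 addr0. Qed.

(** Reduces to monomial factors, so that a relator becomes a difference of words in a context, as in
    [weq_cat]. *)
Lemma theta_free_mul0 (r : free_alg) :
  (forall e k d l, theta_free (<< e *g k >> * r * << d *g l >>) = 0) ->
  forall a b, theta_free (a * r * b) = 0.
Proof.
move=> H a b.
have Dl (u v w : free_alg) : (u + v) * w = u * w + v * w by exact: mulrDl.
have Dr (u v w : free_alg) : u * (v + w) = u * v + u * w by exact: mulrDr.
have T0 (u v w : free_alg) : u = v + w -> theta_free w = 0 -> theta_free v = 0 ->
    theta_free u = 0.
  by move=> -> w0 v0; apply: theta_free_add0.
elim/free_alg_ind: a => [|e k a IHa]; first by rewrite !mul0r theta_free0.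
have E := etrans (congr1 ( *%R^~ b) (Dl << e *g k >> a r)) (Dl _ _ b).
apply: (T0 _ _ _ E IHa); clear E IHa.
elim/free_alg_ind: b => [|d l b IHb]; first by rewrite mulr0 theta_free0.
by apply: (T0 _ _ _ (Dr (<< e *g k >> * r) << d *g l >> b) IHb); clear IHb; apply: H.
Qed.

(** Quantifying over both factors makes the induction pass through the multiplication rules of the
    ideal. *)
Lemma theta_free_ideal u : okada_ideal_prop X Y u ->
  forall a b, theta_free (a * u * b) = 0.
Proof.
elim=> {u} [u /relator_weq[m1 [m2 [c [W ->]]]]||u v _ Hu _ Hv|a' u _ Hu|a' u _ Hu] a b.
- move: a b; apply: theta_free_mul0 => e k d l.
  have -> : << e *g k >> * (<< m1 >> - << c *g m2 >>) * << d *g l >> =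
      << e * d *g mmul (mmul k m1) l >> - << e * c * d *g mmul (mmul k m2) l >> :> free_alg.
    apply: (etrans (congr1 ( *%R^~ _) (mulrBr _ << m1 >> << c *g m2 >>))).
    apply: (etrans (mulrBl _ (<< e *g k >> * << m1 >>) (<< e *g k >> * << c *g m2 >>))).
    by rewrite !malgUM mulr1.
  rewrite theta_freeB !theta_freeU !wseqM -!catA.
  rewrite (vecw_weq (weq_cat (wseq k) (wseq l) W)) scalerA.
  by rewrite mulrAC subrr.
- by rewrite mulr0 mul0r theta_free0.
- have E := etrans (congr1 ( *%R^~ b) (mulrDr a u v)) (mulrDl (a * u) (a * v) b).
  apply: (etrans (congr1 theta_free E)); clear E.
  exact: theta_free_add0 (Hu a b) (Hv a b).
- exact: (etrans (congr1 (fun w => theta_free (w * b)) (mulrA a a' u)) (Hu (a * a') b)).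
- have E := etrans (congr1 ( *%R^~ b) (mulrA a u a')) (esym (mulrA (a * u) a' b)).
  exact: (etrans (congr1 theta_free E) (Hu a (a' * b))).
Qed.

Definition theta (a : algebra) : space := theta_free (repr a).

Lemma theta_pi u : theta (okada_pi X Y u) = theta_free u.
Proof.
have /asboolP/theta_free_ideal/(_ 1 1) := okada_repr X Y u.
rewrite mul1r mulr1 -scaleN1r theta_freeD theta_freeZ scaleN1r => /eqP.
by rewrite subr_eq0 => /eqP.
Qed.

Lemma theta_linear : linear theta.
Proof.
move=> c a b; have [u ->] := okada_pi_surj a; have [v ->] := okada_pi_surj b.
by rewrite okada_piZr -okada_piD !theta_pi theta_freeD theta_freeZ.
Qed.

Lemma theta_eval s : letters s -> theta (eval s) = vecw s.
Proof.
move=> sN; rewrite -(map_val_insub sN) -[map _ _]/(wseq (FMonom (pmap insub s))).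
by rewrite -okada_piU theta_pi theta_freeU scale1r.
Qed.

Definition psi (v : space) : algebra := \sum_(D : diagram N) (v D : K) *: eval (nf D).

Lemma psi_linear : linear psi.
Proof.
move=> c v w; rewrite /psi scaler_sumr -big_split; apply: eq_bigr => D _.
by rewrite /= !ffunE scalerDl scalerA.
Qed.

Lemma psiZ c v : psi (c *: v) = c *: psi v.
Proof.
by rewrite /psi scaler_sumr; apply: eq_bigr => D _; rewrite ffunE scalerA.
Qed.

Lemma diagram_spaceE (v : space) : v = \sum_(D : diagram N) (v D : K) *: diagram_vect K D.
Proof.
apply/ffunP => D; rewrite sum_ffunE (bigD1 D) //= !ffunE eqxx.
rewrite big1 ?addr0 => [|C CD]; first by rewrite /GRing.scale /= mulr1.
by rewrite !ffunE (negPf CD) /GRing.scale /= mulr0.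
Qed.

Lemma psi_vect D : psi (diagram_vect K D) = eval (nf D).
Proof.
rewrite /psi (bigD1 D) //= ffunE eqxx scale1r big1 ?addr0 // => C CD.
by rewrite ffunE eq_sym (negPf CD) scale0r.
Qed.

Lemma linear_sum_scale (U V : lmodType K) (f : U -> V) (I : Type) (r : seq I)
    (c : I -> K) (u : I -> U) : linear f ->
  f (\sum_(k <- r) c k *: u k) = \sum_(k <- r) c k *: f (u k).
Proof.
move=> lf; elim: r => [|k r IH]; last by rewrite !big_cons lf IH.
by rewrite !big_nil; have := lf (-1) 0 0; rewrite scaler0 addr0 scaleN1r addNr.
Qed.

Lemma psiK : cancel psi theta.
Proof.
move=> v; rewrite /psi (linear_sum_scale _ _ _ theta_linear).
rewrite [RHS]diagram_spaceE; apply: eq_bigr => D _.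
by rewrite (theta_eval (letters_nf X Y D)) vecw_nf.
Qed.

Lemma thetaK : cancel theta psi.
Proof.
apply: (linear_ext (f := psi \o theta) (g := id)) => //.
- by move=> c a b; rewrite /= theta_linear psi_linear.
- move=> s sN /=; rewrite (theta_eval sN) psiZ psi_vect.
  exact: esym (eval_weq (weq_nf _ _ N_gt0 sN)).
Qed.

Lemma weight_nf C D : vecw (nf C ++ nf D) = weight X Y C D *: diagram_vect K (Defs.comp C D).
Proof. by rewrite (weightE X Y N_gt0) /vecw wd_cat !(wd_nf X Y). Qed.

(** Both factors are expanded over normal words by [thetaK]. A product of two normal words is their
    concatenation, whose coefficient is the weight. *)
Lemma thetaM a b : theta (a * b) = diagram_mul X Y (theta a) (theta b).
Proof.
rewrite -{1}[a]thetaK -{1}[b]thetaK {1}/psi mulr_suml.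
rewrite -(eq_bigr _ (fun D _ => scalerAl _ _ _)).
rewrite (linear_sum_scale _ _ _ theta_linear); apply: eq_bigr => C _.
rewrite /psi mulr_sumr -(eq_bigr _ (fun D _ => scalerAr _ _ _)).
rewrite (linear_sum_scale _ _ _ theta_linear) scaler_sumr; apply: eq_bigr => D _.
rewrite -eval_cat theta_eval ?weight_nf ?scalerA //.
by rewrite all_cat !(letters_nf X Y).
Qed.

(** The empty word and the one-letter words are normal, so [theta] sends them to diagrams with
    coefficient 1. *)
Lemma nword_nil n : exists c : code n, nword c = [::].
Proof. by elim: n => [|n [c cE]]; [exists tt | exists (c, ord0); rewrite /= cE]. Qed.

Lemma nword_letter n i : (i < n)%N -> exists c : code n, nword c = [:: i].
Proof.
elim: n => // n IH; rewrite ltnS leq_eqVlt => /predU1P[->|/IH[c cE]].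
  have [c cE] := nword_nil n; exists (c, inord 1).
  by rewrite /= cE inordK // subn1.
by exists (c, ord0); rewrite /= cE.
Qed.

Lemma theta1 : theta 1 = diagram_one N K.
Proof.
have <- : eval [::] = 1 by rewrite /eval big_nil.
have [c cE] := nword_nil N.-1.
rewrite theta_eval // -cE /vecw coef_nword scale1r cE.
by rewrite /wd /word_diagram big_nil.
Qed.

Lemma theta_gen i : theta (okada_gen X Y i) = diagram_vect K (elem_diagram i).
Proof.
have <- : eval [:: val i] = okada_gen X Y i by rewrite /eval big_seq1 letter_genE.
have [c cE] := nword_letter (ltn_ord i).
rewrite theta_eval /= ?ltn_ord // -cE /vecw coef_nword scale1r cE.
by rewrite -[[:: _]]/(map val [:: i]) wd_map /word_diagram big_seq1.
Qed.

Lemma theta_isomorphism : algebra_isomorphism theta.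
Proof.
split; [exact: theta_linear | exact: theta1 | exact: thetaM |].
by exists psi; [exact: thetaK | exact: psiK].
Qed.

Lemma isomorphism_unique (f : algebra -> space) : algebra_isomorphism f ->
  (forall i, f (okada_gen X Y i) = diagram_vect K (elem_diagram i)) -> theta = f.
Proof.
case=> lf f1 fM _ fg; apply/funext.
apply: (linear_ext theta_linear lf) => s sN.
elim: s sN => [_|k s IH /= /andP[kN sN]].
  by rewrite /eval big_nil theta1 f1.
rewrite -cat1s eval_cat /eval big_seq1 (letter_genE (Ordinal kN)) -/(eval s).
by rewrite thetaM fM (IH sN) theta_gen fg.
Qed.

Lemma subalgebra_full (U : {vspace space}) : subalgebra X Y U ->
  (forall i, diagram_vect K (elem_diagram i) \in U) -> U = {: space}%VS.
Proof.
case=> U1 UM Ug; apply/vspaceP => v; rewrite memvf.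
rewrite [v]diagram_spaceE; apply: memv_suml => D _; apply: memvZ.
rewrite -(vecw_nf D) -(theta_eval (letters_nf X Y D)).
elim: (nf D) (letters_nf X Y D) => [_|k s IH /= /andP[kN sN]].
  by rewrite /eval big_nil theta1.
rewrite -cat1s eval_cat /eval big_seq1 (letter_genE (Ordinal kN)) -/(eval s).
by rewrite thetaM UM ?theta_gen ?IH.
Qed.

End Isomorphism.

Theorem theorem3p9 (N : nat) (hN : (1 <= N)%N) (K : fieldType)
    (X : (N.-1).-tuple K) (Y : (N.-2).-tuple K) :
  [/\ \dim {: diagram_space N K} = N`!,
      forall U : {vspace diagram_space N K}, subalgebra X Y U ->
        (forall i : 'I_N.-1, diagram_vect K (elem_diagram i) \in U) ->
        U = {: diagram_space N K}%VS
    & exists! Theta : okada_algebra X Y -> diagram_space N K,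
        algebra_isomorphism Theta /\
        forall i : 'I_N.-1,
          Theta (okada_gen X Y i) = diagram_vect K (elem_diagram i)].
Proof.
split; last 2 first.
- exact: subalgebra_full.
- exists (@theta N K X Y); split=> [|f [isof fg]].
    by split; [exact: theta_isomorphism | exact: theta_gen].
  exact: isomorphism_unique.
by rewrite dimvf /dim /= (card_diagram X Y hN) muln1.
Qed.
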